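(* Suppose that conditions (C1), (C2), (C3) of the context are all satisfied and that $\gamma_L\le 0$. Let $T_1=\inf\{t>0:N_t=1\}$. Then $P(T_1<\infty)=1$ and, for $\mathbb P$-almost every $\omega$, under $P_\omega$, $$T_1\overset{\mathscr D}{=}\xi_{0,1}+\sum_{i\le -1}\sum_{k=1}^{U_{i,1}}\xi_{i,k}+\sum_{i\le -1}\sum_{k=1}^{U_{i,1}+\dots+U_{i,L}}\tilde\xi_{i+1,k},$$ where $\overset{\mathscr D}{=}$ means equality in distribution, and, given $\omega$: - $(U_i)_{i\le 0}$, $U_i=(U_{i,1},\dots,U_{i,L})$, is an $L$-type branching process (with time index $i$ running over $0,-1,-2,\dots$) with $U_0=\mathbf e_1$ and offspring distributions, for $u_1,\dots,u_L\in\{0,1,2,\dots\}$, $$P_\omega\big(U_{i-1}=(u_1,\dots,u_L)\,\big|\,U_i=\mathbf e_1\big)=\frac{(u_1+\dots+u_L)!}{u_1!\cdots u_L!}\Big(\frac{\mu_i^1}{\lambda_i+\sum_{l=1}^L\mu_i^l}\Big)^{u_1}\cdots\Big(\frac{\mu_i^L}{\lambda_i+\sum_{l=1}^L\mu_i^l}\Big)^{u_L}\frac{\lambda_i}{\lambda_i+\sum_{l=1}^L\mu_i^l},$$ and, for $2\le m\le L$, $$P_\omega\big(U_{i-1}=(u_1,\dots,1+u_{m-1},\dots,u_L)\,\big|\,U_i=\mathbf e_m\big)=\frac{(u_1+\dots+u_L)!}{u_1!\cdots u_L!}\Big(\frac{\mu_i^1}{\lambda_i+\sum_{l=1}^L\mu_i^l}\Big)^{u_1}\cdots\Big(\frac{\mu_i^L}{\lambda_i+\sum_{l=1}^L\mu_i^l}\Big)^{u_L}\frac{\lambda_i}{\lambda_i+\sum_{l=1}^L\mu_i^l};$$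 - $\xi_{i,k},\tilde\xi_{i,k}$, $i\le 0$, $k\ge 1$, are mutually independent random variables, all independent of $(U_i)_{i\le 0}$, with $P_\omega(\xi_{i,k}\ge t)=P_\omega(\tilde\xi_{i,k}\ge t)=e^{-(\lambda_i+\sum_{l=1}^L\mu_i^l)t}$ for $t\ge 0$. Moreover, for $\mathbb P$-almost every $\omega$, $$E_\omega T_1=\sum_{i=-\infty}^0\frac{1}{\lambda_i}\,\mathbf e_1M_0M_{-1}\cdots M_{i+1}\mathbf 1,$$ where the empty product (the case $i=0$) is the identity matrix.
   Context: Fix an integer $L\ge 1$. Let $\Omega$ be the set of all $\omega=(\omega_i)_{i\in\mathbb Z}=(\mu_i^L,\dots,\mu_i^1,\lambda_i)_{i\in\mathbb Z}$ with $\lambda_i,\mu_i^l\ge 0$ for all $i\in\mathbb Z$, $l=1,\dots,L$, equipped with its Borel $\sigma$-algebra $\mathcal F$. Let $\mathbb P$ be a probability measure on $(\Omega,\mathcal F)$ under which $(\omega_i)_{i\in\mathbb Z}$ is a sequence of i.i.d. random vectors; $\mathbb E$ is the expectation under $\mathbb P$. Conditions: (C1) $\mathbb P\left(\lambda_0+\sum_{l=1}^L\mu_0^l>0\right)=1$. (C2) $\mathbb P\Big(\sum_{n=1}^\infty\frac{1}{\lambda_n+\sum_{l=1}^L\mu_n^l}=\infty,\ \sum_{n=-\infty}^0\frac{1}{\max_{1\le k\le L}\{\lambda_{nL-k}+\sum_{l=1}^L\mu_{nL-k}^l\}}=\infty\Big)=1.$ (C3) $\mathbb E\ln\frac{\lambda_0}{\lambda_0+\sum_{l=1}^L\mu_0^l}>-\infty$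 and $\mathbb E\ln\frac{\mu_0^L}{\lambda_0+\sum_{l=1}^L\mu_0^l}>-\infty$. The process: given $\omega$, $(N_t)_{t\ge0}$ is the continuous time Markov chain on $\mathbb Z$ with $N_0=0$ which waits at a state $n$ an exponentially distributed time with parameter $\lambda_n+\sum_{l=1}^L\mu_n^l$ and then jumps to $n-i$ with probability $\mu_n^i/(\lambda_n+\sum_{l=1}^L\mu_n^l)$, $i=1,\dots,L$, or to $n+1$ with probability $\lambda_n/(\lambda_n+\sum_{l=1}^L\mu_n^l)$. (Under (C1) and (C2), for $\mathbb P$-a.e. $\omega$ the transition function with these rates is unique, so the process is well defined for all times.) $P_\omega$ denotes the (quenched) law of $N$ started from $0$ given $\omega$, with expectation $E_\omega$, and $P(\cdot)=\int_\Omega P_\omega(\cdot)\,\mathbb P(d\omega)$ is the annealed law. Matrices: for $i\in\mathbb Z$, $M_i$ is the $L\times L$ matrix whose first row is $\left(\frac{\mu_i^1}{\lambda_i},\dots,\frac{\mu_i^L}{\lambda_i}\right)$ and whose $k$-th row, $2\le k\le L$, equals the first row plus $\mathbf e_{k-1}$. Here $\mathbf e_i$ is the row vector in $\mathbb R^L$ with $i$-th component $1$ and all others $0$, and $\mathbf 1=(\mathbf e_1+\dots+\mathbf e_L)^T$ is the column vector of ones. The $M_i$ are i.i.d. under $\mathbb P$, and under (C3) $\mathbb E|\ln\|M_0^{-1}\||+\mathbb E|\ln\|M_0\||<\infty$, so Oseledec's multiplicative ergodic theorem applies; its (deterministic, finite) Lyapunov exponents for the products $M_0M_1\cdots M_n$,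 counted with multiplicity in increasing order, are $-\infty<\gamma_1\le\dots\le\gamma_L<\infty$ (i.e. the $\mathbb P$-a.s. limits of $\frac1n\ln$ of the singular values of $M_0M_1\cdots M_{n-1}$). An $L$-type branching process with offspring distributions as in the claim: given $\omega$ and $U_i$, $U_{i-1}$ is distributed as the sum of independent offspring vectors, one for each of the $U_{i,m}$ individuals of type $m$ in generation $i$ ($m=1,\dots,L$), where an individual of type $m$ has offspring vector distributed as $U_{i-1}$ given $U_i=\mathbf e_m$. *)

(* Defs.v *)
From HB Require Import structures.
From mathcomp Require Import all_boot all_order all_algebra.
From mathcomp Require Import all_classical all_reals all_analysis.
From mathcomp Require Import measurable_realfun.

Set Implicit Arguments.
Unset Strict Implicit.
Unset Printing Implicit Defensive.

Import Order.TTheory GRing.Theory Num.Theory.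
Import numFieldNormedType.Exports.

Local Open Scope classical_set_scope.
Local Open Scope ring_scope.

(* The maximal left jump is L = K.+1, so that L >= 1 is built in and the types
   1, ..., L of the branching process are the elements of 'I_K.+1, type l being
   the ordinal of value l - 1. *)

Definition nnreal (R : realType) : Type := {nonneg R}.
HB.instance Definition _ (R : realType) := Choice.on (nnreal R).
HB.instance Definition _ (R : realType) := isPointed.Build (nnreal R) 0%:nng.

(* A vector (lambda, mu^1, ..., mu^L): coordinate 0 is lambda and coordinate l
   is mu^l for 1 <= l <= L. *)
Definition site (K : nat) (R : realType) :=
  g_sigma_algebraType [set A : set ('I_K.+2 -> nnreal R) |
    exists j (B : set R), measurable B /\ A = [set v | B (v j)%:num]].
HB.instance Definition _ (K : nat) (R : realType) := Measurable.on (site K R).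

(* Omega with the sigma-algebra generated by the coordinates; as the index set
   is countable, this is the Borel sigma-algebra of the product topology. *)
Definition env (K : nat) (R : realType) :=
  g_sigma_algebraType [set A : set (int -> site K R) |
    exists i (B : set (site K R)), measurable B /\ A = [set w | B (w i)]].
HB.instance Definition _ (K : nat) (R : realType) := Measurable.on (env K R).

Definition lam (K : nat) (R : realType) (w : env K R) (i : int) : R :=
  (w i ord0)%:num.

Definition mu (K : nat) (R : realType) (w : env K R) (i : int)
    (l : 'I_K.+1) : R := (w i (lift ord0 l))%:num.

Definition rate (K : nat) (R : realType) (w : env K R) (i : int) : R :=
  lam w i + \sum_(l < K.+1) mu w i l.

Definition mutually_independent d (S : measurableType d) (R : realType)
    (Q : {measure set S -> \bar R}) (J : choiceType)
    d' (E : measurableType d') (X : J -> S -> E) : Prop :=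
  forall (js : seq J) (B : J -> set E), uniq js ->
    (forall j, measurable (B j)) ->
    Q [set s | forall j, j \in js -> B j (X j s)] =
    (\prod_(j <- js) Q (X j @^-1` B j))%E.

Definition identically_distributed d (S : measurableType d) (R : realType)
    (Q : {measure set S -> \bar R}) (J : Type)
    d' (E : measurableType d') (X : J -> S -> E) : Prop :=
  forall (j j' : J) (B : set E), measurable B ->
    Q (X j @^-1` B) = Q (X j' @^-1` B).

Definition iid_env (K : nat) (R : realType) (P : probability (env K R) R) :=
  let omega := fun (i : int) (w : env K R) => (w i : site K R) in
  mutually_independent P omega /\ identically_distributed P omega.

Definition condC1 (K : nat) (R : realType) (P : probability (env K R) R) :=
  P [set w | 0 < rate w 0] = 1%E.

(* In the second series the summation index n <= 0 is - n below, and k ranges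
   over 0, ..., L - 1 instead of 1, ..., L. *)
Definition condC2 (K : nat) (R : realType) (P : probability (env K R) R) :=
  P [set w |
    (\sum_(1 <= n <oo) ((rate w n%:Z)^-1)%:E = +oo)%E /\
    (\sum_(0 <= n <oo)
      ((\big[Num.max/0]_(k < K.+1)
          rate w (- (n * K.+1)%N%:Z - k.+1%:Z))^-1)%:E = +oo)%E] = 1%E.

(* lne is the logarithm with lne 0 = -oo. *)
Definition condC3 (K : nat) (R : realType) (P : probability (env K R) R) :=
  (-oo < \int[P]_w lne (lam w 0 / rate w 0)%:E)%E /\
  (-oo < \int[P]_w lne (mu w 0 ord_max / rate w 0)%:E)%E.

Definition Mmx (K : nat) (R : realType) (w : env K R) (i : int) : 'M[R]_K.+1 :=
  \matrix_(k, j) (mu w i j / lam w i + (k == j.+1 :> nat)%:R).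

(* The singular values of A with multiplicity, in increasing order: the square
   roots of the eigenvalues of A^T A. *)
Definition singular_values (R : realType) (n : nat) (A : 'M[R]_n)
    (s : 'I_n -> R) : Prop :=
  [/\ forall k, 0 <= s k,
      forall k k' : 'I_n, (k <= k')%N -> s k <= s k' &
      char_poly (A^T *m A) = \prod_(k < n) ('X - (s k ^+ 2)%:P)].

Definition lyapunov_exponents (K : nat) (R : realType)
    (P : probability (env K R) R) (gamma : 'I_K.+1 -> R) : Prop :=
  {ae P, forall w, exists s : nat -> 'I_K.+1 -> R,
    (forall n, singular_values (\prod_(j < n) Mmx w j%:Z) (s n)) /\
    (forall k, (fun n => ln (s n k) / n%:R) @ \oo --> gamma k)}.

Definition jump_prob (K : nat) (R : realType) (w : env K R) (x y : int) : R :=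
  ((y == x + 1)%:R * lam w x +
   \sum_(l < K.+1) (y == x - l.+1%:Z)%:R * mu w x l) / rate w x.

(* Right-continuity for the discrete topology of the state space; together with
   the measurability of each N t it makes hitting times measurable. *)
Definition step_process d (S : measurableType d) (R : realType)
    (N : R -> S -> int) : Prop :=
  (forall t n, 0 <= t -> measurable [set s | N t s = n]) /\
  (forall t s, 0 <= t -> \forall u \near t^'+, N u s = N t s).

(* Y is the embedded jump chain and tau the sequence of holding times. No
   condition is put on the path after a possible explosion: under (C1) and (C2)
   there is almost surely no explosion. *)
Definition quenched_chain (K : nat) (R : realType) (w : env K R)
    d (S : measurableType d) (Pw : {measure set S -> \bar R})
    (N : R -> S -> int) : Prop :=
  exists (Y : nat -> S -> int) (tau : nat -> S -> R),
  [/\ forall k n, measurable [set s | Y k s = n],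
      forall k, measurable_fun setT (tau k),
      forall n (y : nat -> int) (t : nat -> R), (forall k, 0 <= t k) ->
        Pw [set s | forall k, (k <= n)%N -> Y k s = y k /\ t k < tau k s] =
        ((y 0%N == 0 :> int)%:R * \prod_(k < n) jump_prob w (y k) (y k.+1) *
         \prod_(k < n.+1) expR (- (rate w (y k) * t k)))%:E &
      {ae Pw, forall s, forall k (t : R),
        \sum_(j < k) tau j s <= t < \sum_(j < k.+1) tau j s ->
        N t s = Y k s}].

Definition annealed (K : nat) (R : realType) (P : probability (env K R) R)
    d (S : measurableType d) (Pq : R.-pker (env K R) ~> S) (A : set S) : \bar R :=
  (\int[P]_w Pq w A)%E.

Definition hitting_time1 (R : realType) (S : Type) (N : R -> S -> int) (s : S) : \bar R :=
  ereal_inf [set t%:E | t in [set t : R | 0 < t /\ N t s = 1]].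

Definition multinomial_geometric (K : nat) (R : realType) (w : env K R)
    (i : int) (u : {ffun 'I_K.+1 -> nat}) : R :=
  ((\sum_j u j)%N`!)%:R / (\prod_j (u j)`!)%N%:R *
  (\prod_j (mu w i j / rate w i) ^+ u j) * (lam w i / rate w i).

(* Law of U_{i-1} given U_i = e_m. For the type m >= 2 this law is carried by
   the vectors e_{m-1} + u; [pred j | j.+1 == m] selects m - 1, and nothing when
   m is the first type. *)
Definition offspring (K : nat) (R : realType) (w : env K R) (i : int)
    (m : 'I_K.+1) (v : {ffun 'I_K.+1 -> nat}) : R :=
  let e := fun j : 'I_K.+1 => (j.+1 == m :> nat) : nat in
  if [forall j, (e j <= v j)%N]
  then multinomial_geometric w i [ffun j => (v j - e j)%N] else 0.

(* Probability that the sum of independent offspring vectors, one for each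
   individual of a generation i with u m individuals of type m, is v: an
   individual is a pair (m, k) with k < u m. *)
Definition branching_step (K : nat) (R : realType) (w : env K R) (i : int)
    (u v : {ffun 'I_K.+1 -> nat}) : \bar R :=
  \esum_(z in [set z : {ffun {m : 'I_K.+1 & 'I_(u m)} ->
                             {ffun 'I_K.+1 -> nat}} |
               forall j, (\sum_x z x j)%N = v j])
    (\prod_x offspring w i (tag x) (z x))%:E.

(* U n stands for U_{-n}. *)
Definition branching_process (K : nat) (R : realType) (w : env K R)
    d (S : measurableType d) (Q : {measure set S -> \bar R})
    (U : nat -> S -> {ffun 'I_K.+1 -> nat}) : Prop :=
  (forall n u, measurable [set s | U n s = u]) /\
  (forall n (u : nat -> {ffun 'I_K.+1 -> nat}),
     Q [set s | forall k, (k <= n)%N -> U k s = u k] =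
     ((u 0%N == [ffun j => (j == ord0) : nat])%:R%:E *
      \prod_(k < n) branching_step w (- k%:Z) (u k) (u k.+1))%E).

(* xi n k stands for xi_{-n, k + 1}, and similarly for xit. *)
Definition clocks (R : realType) (S : Type) (xi xit : nat -> nat -> S -> R)
    (j : bool * nat * nat) : S -> R :=
  if j.1.1 then xit j.1.2 j.2 else xi j.1.2 j.2.

Definition branching_model (K : nat) (R : realType) (w : env K R)
    d (S : measurableType d) (Q : {measure set S -> \bar R})
    (U : nat -> S -> {ffun 'I_K.+1 -> nat}) (xi xit : nat -> nat -> S -> R)
    : Prop :=
  [/\ branching_process w Q U,
      forall j, measurable_fun setT (clocks xi xit j),
      forall b n k (t : R), 0 <= t ->
        Q [set s | t <= clocks xi xit (b, n, k) s] =
        (expR (- (rate w (- n%:Z) * t)))%:E,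
      mutually_independent Q (clocks xi xit) &
      forall A B : set S,
        <<s [set C | exists n u, C = [set s | U n s = u]] >> A ->
        <<s [set C | exists j (D : set R),
                 measurable D /\ C = clocks xi xit j @^-1` D] >> B ->
        Q (A `&` B) = (Q A * Q B)%E].

(* In the two series the index n is - i - 1. *)
Definition branching_time (K : nat) (R : realType) (S : Type)
    (U : nat -> S -> {ffun 'I_K.+1 -> nat}) (xi xit : nat -> nat -> S -> R)
    (s : S) : \bar R :=
  ((xi 0%N 0%N s)%:E +
   \sum_(0 <= n <oo) (\sum_(k < U n.+1 s ord0) xi n.+1 k s)%:E +
   \sum_(0 <= n <oo) (\sum_(k < \sum_j U n.+1 s j) xit n k s)%:E)%E.

Definition equal_in_law (R : realType)
    d (S : measurableType d) (Q : {measure set S -> \bar R}) (X : S -> \bar R)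
    d' (S' : measurableType d') (Q' : {measure set S' -> \bar R})
    (X' : S' -> \bar R) : Prop :=
  [/\ measurable_fun setT X, measurable_fun setT X' &
      forall B : set (\bar R), measurable B ->
        Q (X @^-1` B) = Q' (X' @^-1` B)].

(* Main.v *)
(* Let [f_k] be the Laplace transform at [b >= 0] of the time that the walk needs
   to go from [- k] to [- k + 1]. Splitting at the first jump gives a recursion for
   the [f_k]; the generating functions of the branching process solve the same one,
   since its generation [k] counts the crossings of [- k] that are still to be
   made. Truncating at [n] generations on one side and at [n] jumps on the other
   shows that both times have Laplace transform [f_0].
     Recurrence is [f_0 = 1] at [b = 0]. There the escape probabilities are carried
   by the matrices: [1 - f_0 <= (M_0 ... M_(n-1) 1)_1 * f_0 ... f_(n-1)]. If
   [f_0 < 1], then [gamma_L <= 0] forces the Cesaro means of [1 - f_k] to vanish,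
   whereas by stationarity they all have mean [E (1 - f_0)]; so [f_0 = 1] almost
   surely. (C3) enters through the almost sure positivity of [lambda] and [mu^L],
   without which [f_0 = 1] would not propagate to the other [f_k].
     The mean of [T_1] is the derivative at [b = 0], that is the limit of
   [(1 - f_0(b)) / b], which is computed by iterating the recursion. *)

Require Import Defs.
From mathcomp Require Import all_boot all_order all_algebra.
From mathcomp Require Import all_classical all_reals all_analysis.
From mathcomp Require Import measurable_realfun.
From HB Require Import structures.
From mathcomp Require Import ring lra zify.
Set Implicit Arguments.
Unset Strict Implicit.
Unset Printing Implicit Defensive.
Import Order.TTheory GRing.Theory Num.Theory.
Import numFieldNormedType.Exports.
Local Open Scope classical_set_scope.
Local Open Scope ring_scope.

(** Stopping after finitely many generations or jumps leaves finitely many exponential clocks, mixed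
    over countably many discrete histories, so that each truncated transform is an iterated sum. The
    truncation is removed because the stopped event has probability tending to 1, and this is
    exactly [f_0 = 1] at [b = 0]: recurrence comes before the identity in law. In the recurrence
    argument, [f <= exp(- (1 - f))] turns the product of the [f_k] into the exponential of a sum, so
    that a bound on the growth of the matrix products becomes a bound on a Cesaro mean; stationarity
    and dominated convergence finish. Only the transforms at positive integers are compared. They
    are the moments of [exp(- T_1)], a variable in [[0, 1]], and moments determine a law there. For
    the mean, [(1 - E exp(- b T_1)) / b] increases to [E T_1], finite or not, as [b] decreases to 0.
    Its limit is identified by an upper and a lower bound at finite horizon, each passing to the
    partial sums of the same series, so that divergence is covered as well. *)

Lemma ler_wpdiv2l (R : realFieldType) (a x y : R) :
  0 <= a -> 0 < y -> y <= x -> a / x <= a / y.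
Proof.
by move=> a0 y0 yx; rewrite ler_wpM2l// lef_pV2 ?posrE//; exact: lt_le_trans yx.
Qed.

Lemma cvg_sumr (R : realType) (T : Type) (F : set_system T) (I : Type)
    (r : seq I) (f : I -> T -> R) (a : I -> R) : Filter F ->
  (forall i, f i x @[x --> F] --> a i) ->
  \sum_(i <- r) f i x @[x --> F] --> \sum_(i <- r) a i.
Proof.
move=> FF fa; elim: r => [|i r IHr].
  by rewrite big_nil; under eq_fun do rewrite big_nil; exact: cvg_cst.
by rewrite big_cons; under eq_fun do rewrite big_cons; exact: cvgD.
Qed.

(** * Generating functions of first passages *)

Section generating_functions.
Variables (R : realType) (K : nat) (la : nat -> R) (mu : nat -> 'I_K.+1 -> R).
Hypothesis la_gt0 : forall k, 0 < la k.
Hypothesis mu_ge0 : forall k l, 0 <= mu k l.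

Definition srate k := la k + \sum_(l < K.+1) mu k l.

(* [pgf b n k l] is the Laplace transform at [b] of the time that the walk
   started at [- k - l] needs to reach [- k + 1], on the event that it gets
   there before reaching [- k - n]. *)
Fixpoint pgf (b : R) (n k l : nat) : R :=
  if n is n'.+1 then
    la k / (srate k + b - \sum_(j < K.+1) mu k j * pgf b n' k.+1 j) *
    (if l is l'.+1 then pgf b n' k.+1 l' else 1)
  else 0.

Lemma srate_gt0 k : 0 < srate k.
Proof. by rewrite ltr_pwDl// sumr_ge0. Qed.

(** At most the whole rate to the left is subtracted. This keeps every quotient in [pgf] between 0
    and 1. *)
Lemma den_ge (b : R) k (v : nat -> R) : 0 <= b -> (forall j, v j <= 1) ->
  la k <= srate k + b - \sum_(j < K.+1) mu k j * v j.
Proof.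
move=> b0 v1.
have : \sum_(j < K.+1) mu k j * v j <= \sum_(j < K.+1) mu k j.
  by apply: ler_sum => j _; rewrite ler_piMr.
rewrite /srate; lra.
Qed.

Lemma den_gt0 (b : R) k (v : nat -> R) : 0 <= b -> (forall j, v j <= 1) ->
  0 < srate k + b - \sum_(j < K.+1) mu k j * v j.
Proof. by move=> b0 v1; apply: lt_le_trans (den_ge _ b0 v1). Qed.

(** The quotient is the solution [x] of [(srate k + b) * x = la k + x * \sum_j mu k j * pgf b n k.+1
    j]: after a jump to the left the walk has to come back to [- k], where it starts afresh. From
    further left it must first reach [- k], which is the second factor. *)
Lemma pgfS (b : R) n k l : pgf b n.+1 k l =
  la k / (srate k + b - \sum_(j < K.+1) mu k j * pgf b n k.+1 j) *
  (if l is l'.+1 then pgf b n k.+1 l' else 1).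
Proof. by []. Qed.

Lemma pgf_itv (b : R) n k l : 0 <= b -> 0 <= pgf b n k l <= 1.
Proof.
move=> b0; elim: n k l => [|n IHn] k l /=; first by rewrite lexx ler01.
have v1 j : pgf b n k.+1 j <= 1 by have /andP[] := IHn k.+1 j.
have d0 := den_gt0 k b0 v1.
have h1 := den_ge k b0 v1.
have h01 : 0 <= la k / (srate k + b - \sum_(j < K.+1) mu k j * pgf b n k.+1 j) <= 1.
  by apply/andP; split; [rewrite divr_ge0// ltW | rewrite ler_pdivrMr// mul1r].
have /andP[h0 h2] := h01.
case: l => [|l]; first by rewrite mulr1.
by have /andP[g0 g1] := IHn k.+1 l; rewrite mulr_ge0// mulr_ile1.
Qed.

Lemma pgf_ge0 (b : R) n k l : 0 <= b -> 0 <= pgf b n k l.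
Proof. by move=> /(pgf_itv n k l)/andP[]. Qed.

Lemma pgf_le1 (b : R) n k l : 0 <= b -> pgf b n k l <= 1.
Proof. by move=> /(pgf_itv n k l)/andP[]. Qed.

Lemma pgf_nd (b : R) n k l : 0 <= b -> pgf b n k l <= pgf b n.+1 k l.
Proof.
move=> b0; elim: n k l => [|n IHn] k l; first exact: pgf_ge0.
rewrite pgfS [X in _ <= X]pgfS.
have v1 m j : pgf b m k.+1 j <= 1 by exact: pgf_le1.
apply: ler_pM.
- by rewrite divr_ge0//; rewrite ltW// den_gt0// => j; exact: v1.
- by case: l => // l; exact: pgf_ge0.
- apply: ler_wpdiv2l; [exact: ltW|by apply: den_gt0 => // j; exact: v1|rewrite lerD2l lerN2].
  by apply: ler_sum => j _; rewrite ler_wpM2l.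
- by case: l => // l; exact: IHn.
Qed.

Lemma pgf_ndh (b : R) k l : 0 <= b -> {homo (fun n => pgf b n k l) : n m / (n <= m)%N >-> n <= m}.
Proof. move=> b0; apply: homo_leq => [//|m n p|n]; [exact: le_trans|exact: pgf_nd]. Qed.

Lemma pgf_anti (b : R) n k l : 0 <= b -> pgf b n k l <= pgf 0 n k l.
Proof.
move=> b0; elim: n k l => //= n IHn k l.
have v1 c j : 0 <= c -> pgf c n k.+1 j <= 1 by exact: pgf_le1.
apply: ler_pM.
- by rewrite divr_ge0//; rewrite ltW// den_gt0// => j; exact: v1.
- by case: l => // l; exact: pgf_ge0.
- apply: ler_wpdiv2l; [exact: ltW|by apply: den_gt0 => // i; exact: v1|].
  by rewrite addr0 lerD ?lerDl// lerN2 ler_sum// => i _; rewrite ler_wpM2l.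
- by case: l.
Qed.

Definition lpgf (b : R) k l : R := limn (fun n => pgf b n k l).

Lemma pgf_cvg (b : R) k l : 0 <= b -> pgf b n k l @[n --> \oo] --> lpgf b k l.
Proof.
move=> b0; suff : cvgn (fun n => pgf b n k l) by [].
apply: nondecreasing_is_cvgn; first by apply/nondecreasing_seqP => n; exact: pgf_nd.
by exists 1 => _ [n _ <-]; exact: pgf_le1.
Qed.

Lemma pgf_le_lim (b : R) n k l : 0 <= b -> pgf b n k l <= lpgf b k l.
Proof.
move=> b0; have cv := cvgP _ (@pgf_cvg b k l b0).
by apply: (@nondecreasing_cvgn_le _ (fun n => pgf b n k l)) => //; exact: pgf_ndh.
Qed.

Lemma lpgf_ge0 (b : R) k l : 0 <= b -> 0 <= lpgf b k l.
Proof. by move=> b0; apply: le_trans (pgf_le_lim 0 _ _ b0). Qed.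

Lemma lpgf_le (b : R) k l c : 0 <= b -> (forall n, pgf b n k l <= c) -> lpgf b k l <= c.
Proof.
move=> b0 h; apply: limr_le; first by exact: cvgP (@pgf_cvg b k l b0).
by near=> n; exact: h.
Unshelve. all: by end_near. Qed.

Lemma lpgf_le1 (b : R) k l : 0 <= b -> lpgf b k l <= 1.
Proof. by move=> b0; apply: lpgf_le => // n; exact: pgf_le1. Qed.

Lemma lpgfE (b : R) k l : 0 <= b -> lpgf b k l =
    la k / (srate k + b - \sum_(j < K.+1) mu k j * lpgf b k.+1 j) *
    (if l is l'.+1 then lpgf b k.+1 l' else 1).
Proof.
move=> b0; apply/cvg_lim => //.
rewrite -(cvg_shiftS (fun n => pgf b n k l)) /=.
apply: cvgM; last first.
  by case: l => [|l]; [exact: cvg_cst | exact: pgf_cvg].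
apply: cvgM; first exact: cvg_cst.
apply: cvgV.
  by rewrite gt_eqF//; apply: den_gt0 => // j; exact: lpgf_le1.
apply: cvgB; first exact: cvg_cst.
by apply: cvg_sumr => j; apply: cvgM; [exact: cvg_cst | exact: pgf_cvg].
Qed.

Lemma lpgf0E (b : R) k : 0 <= b ->
  lpgf b k 0 * (srate k + b - \sum_(j < K.+1) mu k j * lpgf b k.+1 j) = la k.
Proof.
move=> b0; rewrite lpgfE// mulr1 divfK// gt_eqF// den_gt0// => j; exact: lpgf_le1.
Qed.

Lemma lpgfS (b : R) k l : 0 <= b -> lpgf b k l.+1 = lpgf b k 0 * lpgf b k.+1 l.
Proof. by move=> b0; rewrite lpgfE// [in RHS]lpgfE// mulr1. Qed.

(** Jumps to the right have length 1, so going from [- k - l] to [- k + 1] crosses [l + 1] levels in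
    turn, with independent crossing times. *)
Lemma lpgf_prod (b : R) k l : 0 <= b ->
  lpgf b k l = \prod_(j < l.+1) lpgf b (k + j) 0.
Proof.
move=> b0; elim: l k => [|l IHl] k; first by rewrite big_ord1 addn0.
rewrite lpgfS// IHl [in RHS]big_ord_recl addn0; congr (_ * _).
by apply: eq_bigr => j _; rewrite lift0 addSnnS.
Qed.

(* The action of [M_k] on functions of all of [nat]: the subdiagonal of ones is
   not cut off at [K]. *)
Definition Mapp k (v : nat -> R) l : R :=
  \sum_(j < K.+1) mu k j / la k * v j + (if l is l'.+1 then v l' else 0).

Lemma Mapp_ge0 k v l : (forall j, 0 <= v j) -> 0 <= Mapp k v l.
Proof.
move=> v0; apply: addr_ge0; last by case: l.
by apply: sumr_ge0 => j _; rewrite mulr_ge0// divr_ge0// ltW.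
Qed.

Lemma le_Mapp k v w l : (forall j, v j <= w j) -> Mapp k v l <= Mapp k w l.
Proof.
move=> vw; apply: lerD; last by case: l.
by apply: ler_sum => j _; rewrite ler_wpM2l// divr_ge0// ltW.
Qed.

Fixpoint Mrow n k : nat -> R :=
  if n is n'.+1 then Mapp k (Mrow n' k.+1) else fun=> 1.

(* With [f = lpgf 0 k 0], the generating functions satisfy
   [1 - g_k = f_k M_k (1 - g_{k+1})]: harmonicity of the escape probability. *)
Lemma onem_lpgf k l :
  1 - lpgf 0 k l = lpgf 0 k 0 * Mapp k (fun j => 1 - lpgf 0 k.+1 j) l.
Proof.
have := lpgf0E k (lexx 0); rewrite addr0 /srate => E0.
have E : 1 - lpgf 0 k 0 =
    lpgf 0 k 0 * \sum_(j < K.+1) mu k j / la k * (1 - lpgf 0 k.+1 j).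
  have -> : \sum_(j < K.+1) mu k j / la k * (1 - lpgf 0 k.+1 j) =
     (\sum_(j < K.+1) mu k j - \sum_(j < K.+1) mu k j * lpgf 0 k.+1 j) / la k.
    rewrite -sumrB mulr_suml; apply: eq_bigr => j _.
    by rewrite mulrBr mulr1 mulrBl mulrAC.
  have l0 : la k != 0 by rewrite gt_eqF.
  apply: (mulIf l0); rewrite mulrA divfK// mulrBl mul1r -[X in X - _]E0; ring.
rewrite /Mapp mulrDr -E; case: l => [|l]; first by rewrite mulr0 addr0.
by rewrite lpgfS//; ring.
Qed.

(** [onem_lpgf] iterated [n] times; the last escape probability is bounded by 1, which is why [Mrow]
    starts from the constant 1. Keeping the factors [lpgf] in front of the matrix product is what
    drives the recurrence argument. *)
Lemma onem_lpgf_le n k l :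
  1 - lpgf 0 k l <= (\prod_(j < n) lpgf 0 (k + j) 0) * Mrow n k l.
Proof.
elim: n k l => [|n IHn] k l.
  by rewrite big_ord0 mul1r/= lerBlDr lerDl lpgf_ge0.
rewrite onem_lpgf /=.
have -> : \prod_(j < n.+1) lpgf 0 (k + j) 0 =
   lpgf 0 k 0 * \prod_(j < n) lpgf 0 (k.+1 + j) 0.
  by rewrite big_ord_recl addn0; congr (_ * _); apply: eq_bigr => j _; rewrite lift0 addSnnS.
rewrite -mulrA ler_wpM2l ?lpgf_ge0//.
apply: le_trans (le_Mapp _ _ (IHn k.+1)) _.
rewrite le_eqVlt; apply/orP; left; apply/eqP.
rewrite /Mapp mulrDr mulr_sumr; congr (_ + _).
  by apply: eq_bigr => j _; rewrite mulrCA.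
by case: l => [|l]; rewrite ?mulr0.
Qed.

Lemma Mrow_ge0 n k l : 0 <= Mrow n k l.
Proof. by elim: n k l => [|n IHn] k l //=; exact: Mapp_ge0. Qed.

(** By [onem_lpgf], a sum of nonnegative terms vanishes. The term of the longest jump, whose rate is
    positive, gives [lpgf 0 k.+1 K = 1], and this is a product of numbers in [[0, 1]] with
    [lpgf 0 k.+1 0] among them. *)
Lemma lpgf_eq1S k : 0 < mu k ord_max -> lpgf 0 k 0 = 1 -> lpgf 0 k.+1 0 = 1.
Proof.
move=> muK f1; have := onem_lpgf k 0.
rewrite f1 subrr mul1r /Mapp addr0 => /esym/eqP.
rewrite psumr_eq0; last first.
  by move=> j _; rewrite mulr_ge0 ?divr_ge0 ?(ltW (la_gt0 _))// subr_ge0 lpgf_le1.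
move=> /allP/(_ ord_max); rewrite mem_index_enum => /(_ isT)/=.
rewrite mulf_eq0 gt_eqF/=; last by rewrite divr_gt0.
rewrite subr_eq0 => /eqP/esym g1; apply/eqP; rewrite eq_le lpgf_le1//= -g1.
rewrite lpgf_prod// big_ord_recl addn0 ler_piMr ?lpgf_ge0// prodr_ile1// => j _.
by rewrite lpgf_ge0// lpgf_le1.
Qed.

(** Partial sums of the series for the mean passage time; [WserE] gives their matrix form. The
    recursive form is the one that can be compared with [pgf]. *)
Fixpoint Wser N k : nat -> R :=
  if N is N'.+1 then fun l => (la k)^-1 + Mapp k (Wser N' k.+1) l else fun=> 0.

(** The two quotients [p] and [f] differ by [p * f] times the difference of the denominators over
    [la k]. Bounding [p * f] by 1 leaves the recursion of [Wser], with the same horizon [n] on both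
    sides. *)
Lemma pgf_diff_le (b : R) n k l : 0 <= b ->
  pgf 0 n k l - pgf b n k l <= b * Wser n k l.
Proof.
move=> b0; elim: n k l => [|n IHn] k l; first by rewrite /= subrr mulr0.
rewrite /=.
set P := pgf 0 n k.+1; set Q := pgf b n k.+1.
have P1 j : P j <= 1 by exact: pgf_le1.
have Q1 j : Q j <= 1 by exact: pgf_le1.
have P0 j : 0 <= P j by exact: pgf_ge0.
have Q0 j : 0 <= Q j by exact: pgf_ge0.
set dp := srate k + 0 - _; set dq := srate k + b - _.
have dp0 : 0 < dp by exact: den_gt0.
have dq0 : 0 < dq by exact: den_gt0.
set p := la k / dp; set f := la k / dq.
have p0 : 0 <= p by rewrite divr_ge0 ?ltW.
have f0 : 0 <= f by rewrite divr_ge0 ?ltW.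
have p1 : p <= 1 by rewrite ler_pdivrMr// mul1r; apply: den_ge.
have f1 : f <= 1 by rewrite ler_pdivrMr// mul1r; apply: den_ge.
have l0 : la k != 0 by rewrite gt_eqF.
have main : p - f <= b * ((la k)^-1 + \sum_(j < K.+1) mu k j / la k * Wser n k.+1 j).
  have -> : p - f = p * f * ((dq - dp) / la k).
    rewrite /p /f; field; rewrite l0 !gt_eqF//.
  have -> : dq - dp = b + \sum_(j < K.+1) mu k j * (P j - Q j).
    rewrite /dp /dq; under [in RHS]eq_bigr do rewrite mulrBr.
    by rewrite sumrB; ring.
  have hs : 0 <= \sum_(j < K.+1) mu k j * Wser n k.+1 j.
    apply: sumr_ge0 => j _; rewrite mulr_ge0//.
    elim: (n) (k.+1) (nat_of_ord j) => //= m IHm k' j'.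
    by apply: addr_ge0; [rewrite invr_ge0 ltW | exact: Mapp_ge0].
  have h1 : b + \sum_(j < K.+1) mu k j * (P j - Q j) <=
            b * (1 + \sum_(j < K.+1) mu k j * Wser n k.+1 j).
    rewrite mulrDr mulr1 lerD2l mulr_sumr; apply: ler_sum => j _.
    by rewrite mulrCA ler_wpM2l// IHn.
  have -> : b * ((la k)^-1 + \sum_(j < K.+1) mu k j / la k * Wser n k.+1 j) =
     b * (1 + \sum_(j < K.+1) mu k j * Wser n k.+1 j) / la k.
    rewrite -mulrA; congr (_ * _); rewrite mulrDl mul1r mulr_suml; congr (_ + _).
    by apply: eq_bigr => j _; rewrite mulrAC.
  rewrite mulrA ler_pM2r ?invr_gt0//.
  apply: le_trans (ler_wpM2l (mulr_ge0 p0 f0) h1) _.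
  rewrite ler_piMl//; last by rewrite mulr_ile1.
  by rewrite mulr_ge0// addr_ge0.
case: l => [|l]; first by rewrite !mulr1 /Mapp addr0.
have -> : p * P l - f * Q l = p * (P l - Q l) + Q l * (p - f) by ring.
have -> : b * ((la k)^-1 + Mapp k (Wser n k.+1) l.+1) =
    b * Wser n k.+1 l +
    b * ((la k)^-1 + \sum_(j < K.+1) mu k j / la k * Wser n k.+1 j).
  by rewrite /Mapp; ring.
apply: lerD; last first.
  apply: le_trans main; rewrite ler_piMl// subr_ge0.
  apply: ler_wpdiv2l; [exact: ltW| by []|rewrite /dp /dq addr0].
  rewrite lerD ?lerDl// lerN2 ler_sum// => j _; rewrite ler_wpM2l//.
  exact: pgf_anti.
apply: le_trans (IHn k.+1 l); rewrite ler_piMl// subr_ge0.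
exact: pgf_anti.
Qed.

End generating_functions.

(** * Difference quotients of the Laplace transforms at 0 *)

Section derivative_at_zero.
Variables (R : realType) (K : nat) (la : nat -> R) (mu : nat -> 'I_K.+1 -> R).
Hypothesis la_gt0 : forall k, 0 < la k.
Hypothesis mu_ge0 : forall k l, 0 <= mu k l.
Variable u : nat -> R.
Hypothesis u_gt0 : forall m, 0 < u m.
Hypothesis u_cvg0 : u @ \oo --> 0.
Hypothesis rec : forall k, lpgf la mu 0 k 0 = 1.

Let u_ge0 m : 0 <= u m. Proof. exact: ltW. Qed.

Lemma pgf_cont n k l : pgf la mu (u m) n k l @[m --> \oo] --> pgf la mu 0 n k l.
Proof.
elim: n k l => [|n IHn] k l; first exact: cvg_cst.
rewrite /=; apply: cvgM; last by case: l => [|l]; [exact: cvg_cst | exact: IHn].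
apply: cvgM; first exact: cvg_cst.
apply: cvgV.
  by rewrite gt_eqF//; apply: den_gt0 => // j; exact: pgf_le1.
apply: cvgB; first by apply: cvgD => //; exact: cvg_cst.
by apply: cvg_sumr => j; apply: cvgM; [exact: cvg_cst | exact: IHn].
Qed.

Lemma lpgf0_eq1 k l : lpgf la mu 0 k l = 1.
Proof.
by rewrite lpgf_prod// big1// => j _; rewrite rec.
Qed.

(** As a supremum over [n] of functions continuous at 0, [lpgf] is lower semicontinuous there, and
    at [b = 0] it already takes its largest possible value 1. *)
Lemma lpgf_cont k l : lpgf la mu (u m) k l @[m --> \oo] --> (1 : R).
Proof.
apply/cvgrPdist_lt => e e0.
have := @pgf_cvg _ _ _ _ la_gt0 mu_ge0 0 k l (lexx 0).
rewrite lpgf0_eq1 => /cvgrPdist_lt/(_ (e / 2)); rewrite divr_gt0// => /(_ isT)[n _ hn].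
have := hn n (leqnn n) => {}hn.
have := @pgf_cont n k l => /cvgrPdist_lt/(_ (e / 2)); rewrite divr_gt0// => /(_ isT).
apply: filterS => m hm.
have h1 := @lpgf_le1 _ _ _ _ la_gt0 mu_ge0 (u m) k l (u_ge0 m).
have h2 := @pgf_le_lim _ _ _ _ la_gt0 mu_ge0 (u m) n k l (u_ge0 m).
rewrite ger0_norm ?subr_ge0//.
move: hn hm; rewrite !ltr_norml => /andP[_ hn] /andP[_ hm]; lra.
Qed.

(* [Wser] with return probabilities killed at rate [b] put back in, which makes
   it a lower bound of [(1 - lpgf b) / b] that converges to [Wser] as [b -> 0]. *)
Fixpoint Vser (b : R) (N k l : nat) : R :=
  if N is N'.+1 then
    lpgf la mu b k 0 *
    ((la k)^-1 + \sum_(j < K.+1) mu k j / la k * Vser b N' k.+1 j) *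
    (if l is l'.+1 then lpgf la mu b k.+1 l' else 1) +
    (if l is l'.+1 then Vser b N' k.+1 l' else 0)
  else 0.

(** The recursion of [Wser], exactly, but for the factor [lpgf b k 0], which tends to 1 with
    [b -> 0]. *)
Lemma lpgf_diffE (b : R) k : 0 < b ->
  (1 - lpgf la mu b k 0) / b = lpgf la mu b k 0 *
    ((la k)^-1 + \sum_(j < K.+1) mu k j / la k * ((1 - lpgf la mu b k.+1 j) / b)).
Proof.
move=> b0; have := @lpgf0E _ _ _ _ la_gt0 mu_ge0 b k (ltW b0); rewrite /srate => E0.
have -> : \sum_(j < K.+1) mu k j / la k * ((1 - lpgf la mu b k.+1 j) / b) =
   (\sum_(j < K.+1) mu k j - \sum_(j < K.+1) mu k j * lpgf la mu b k.+1 j) / la k / b.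
  rewrite -sumrB !mulr_suml; apply: eq_bigr => j _.
  by field; rewrite !gt_eqF.
have l0 : la k != 0 by rewrite gt_eqF.
have b1 : b != 0 by rewrite gt_eqF.
apply: (mulIf l0); apply: (mulIf b1).
transitivity (la k - lpgf la mu b k 0 * la k); first by field.
rewrite -[X in X - _]E0; field; exact/andP.
Qed.

Lemma Vser_le (b : R) N k l : 0 < b -> Vser b N k l <= (1 - lpgf la mu b k l) / b.
Proof.
move=> b0; elim: N k l => [|N IHN] k l.
  by rewrite /= divr_ge0 ?(ltW b0)// subr_ge0 lpgf_le1// ltW.
have f0 j k' : 0 <= lpgf la mu b k' j by rewrite lpgf_ge0// ltW.
have h : lpgf la mu b k 0 *
    ((la k)^-1 + \sum_(j < K.+1) mu k j / la k * Vser b N k.+1 j) <=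
    (1 - lpgf la mu b k 0) / b.
  rewrite lpgf_diffE// ler_wpM2l// lerD2l ler_sum// => j _.
  by rewrite ler_wpM2l// divr_ge0// ltW.
case: l => [|l]; first by rewrite /= mulr1 addr0.
rewrite lpgfS//; last exact: ltW.
have -> : (1 - lpgf la mu b k 0 * lpgf la mu b k.+1 l) / b =
  (1 - lpgf la mu b k 0) / b * lpgf la mu b k.+1 l + (1 - lpgf la mu b k.+1 l) / b.
  by field; rewrite gt_eqF.
by apply: lerD => //; rewrite ler_wpM2r.
Qed.

Lemma Vser_cvg N k l : Vser (u m) N k l @[m --> \oo] --> Wser la mu N k l.
Proof.
elim: N k l => [|N IHN] k l; first exact: cvg_cst.
have h : lpgf la mu (u m) k 0 *
    ((la k)^-1 + \sum_(j < K.+1) mu k j / la k * Vser (u m) N k.+1 j)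
    @[m --> \oo] --> 1 * ((la k)^-1 + \sum_(j < K.+1) mu k j / la k * Wser la mu N k.+1 j).
  apply: cvgM; first exact: lpgf_cont.
  apply: cvgD; first exact: cvg_cst.
  by apply: cvg_sumr => j; apply: cvgM; [exact: cvg_cst | exact: IHN].
rewrite mul1r in h.
case: l => [|l] /=.
  rewrite /Mapp addr0; under eq_fun do rewrite mulr1 addr0; exact: h.
rewrite /Mapp addrA; apply: cvgD; last exact: IHN.
rewrite -[X in _ --> X]mulr1; apply: cvgM; first exact: h.
exact: lpgf_cont.
Qed.

Lemma Wser_ge0 N k l : 0 <= Wser la mu N k l.
Proof.
elim: N k l => // N IHN k l /=.
by apply: addr_ge0; [rewrite invr_ge0 ltW | exact: Mapp_ge0].
Qed.

Lemma Wser_nd N k l : Wser la mu N k l <= Wser la mu N.+1 k l.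
Proof.
elim: N k l => [|N IHN] k l; first exact: Wser_ge0.
by rewrite [X in X <= _]/= [X in _ <= X]/= lerD2l; exact: le_Mapp.
Qed.

(** Upper bound on [D]: in [pgf_diff_le], [n] tends to infinity at fixed [u m], and [rec] turns the
    transform at 0 into 1. Lower bound: in [Vser_le], [N] is fixed and [m] tends to infinity. The
    existence of [D], possibly infinite, is supplied later by monotone convergence. *)
Lemma cvg_onem_lpgf_div (D : \bar R) k :
  ((1 - lpgf la mu (u m) k 0) / u m)%:E @[m --> \oo] --> D ->
  (Wser la mu N k 0)%:E @[N --> \oo] --> D.
Proof.
move=> hD.
have ndW : nondecreasing_seq (fun N => (Wser la mu N k 0)%:E).
  by apply/nondecreasing_seqP => N; rewrite lee_fin Wser_nd.
have cW := ereal_nondecreasing_is_cvgn ndW.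
suff -> : D = limn (fun N => (Wser la mu N k 0)%:E) by [].
apply/eqP; rewrite eq_le; apply/andP; split.
  rewrite -(cvg_lim _ hD)//; apply: lime_le; first exact: cvgP hD.
  apply: nearW => m.
  have hq : (pgf la mu 0 n k 0 - pgf la mu (u m) n k 0) / u m @[n --> \oo] -->
      (1 - lpgf la mu (u m) k 0) / u m.
    apply: cvgM; last exact: cvg_cst.
    rewrite -(lpgf0_eq1 k 0).
    by apply: cvgB; exact: pgf_cvg.
  have hq' : ((pgf la mu 0 n k 0 - pgf la mu (u m) n k 0) / u m)%:E @[n --> \oo] -->
      ((1 - lpgf la mu (u m) k 0) / u m)%:E.
    by apply/cvg_EFin; [exact: nearW | exact: hq].
  rewrite -(cvg_lim _ hq')//.
  apply: lee_lim; [exact: cvgP hq' | by [] |].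
  apply: nearW => n; rewrite lee_fin ler_pdivrMr// mulrC.
  exact: pgf_diff_le.
apply: lime_le => //; apply: nearW => N.
have hV : (Vser (u m) N k 0)%:E @[m --> \oo] --> (Wser la mu N k 0)%:E.
  by apply/cvg_EFin; [exact: nearW | exact: Vser_cvg].
rewrite -(cvg_lim _ hV)// -(cvg_lim _ hD)//.
apply: lee_lim; [exact: cvgP hV | exact: cvgP hD |].
by apply: nearW => m; rewrite lee_fin Vser_le.
Qed.

End derivative_at_zero.

(** * Exponential clocks *)

Section exponential_laplace.
Context d (S : measurableType d) (R : realType) (m : {measure set S -> \bar R}).

Lemma measurable_gt_fun (X : S -> R) (t : R) : measurable_fun setT X ->
  measurable [set s | t < X s].
Proof.
move=> mX; rewrite -[X in measurable X]setTI.
have -> : [set s | t < X s] = X @^-1` `]t, +oo[.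
  by apply/seteqP; split => s /=; rewrite in_itv/= andbT.
exact: mX.
Qed.

(** The values of [X] are cut into slices of length [h]. Their masses under [g] are geometric, and
    [expR (- (b * X))] varies little on each, so that two geometric series enclose the integral up
    to a factor [expR x] with [x] arbitrarily small. The weight [g] will carry the clocks already
    integrated out. *)
Lemma exp_tail_laplace (D : set S) (g X : S -> R) (c rho b : R) :
  measurable D -> measurable_fun setT g -> (forall s, 0 <= g s) ->
  measurable_fun setT X -> 0 <= c -> 0 < rho -> 0 <= b ->
  (forall t : R, (0 <= t)%R ->
     \int[m]_(s in D `&` [set s | (t < X s)%R]) (g s)%:E =
     (c * expR (- (rho * t)))%:E)%E ->
  (\int[m]_(s in D `&` [set s | (0 < X s)%R]) (g s * expR (- (b * X s)))%:E =
   (c * (rho / (rho + b)))%:E)%E.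
Proof.
move=> mD mg g0 mX c0 rho0 b0 H.
have rb0 : 0 < rho + b by rewrite ltr_wpDr.
set J := (X in X = _).
have mexp : measurable_fun setT (fun s => expR (- (b * X s))).
  apply: measurableT_comp => //; apply: measurableT_comp => //.
  exact: measurable_funM.
have mG : measurable_fun setT (fun s => (g s * expR (- (b * X s)))%:E).
  by apply/measurable_EFinP; exact: measurable_funM.
have mg' : measurable_fun setT (fun s => (g s)%:E) by exact/measurable_EFinP.
suff squeeze x : 0 < x ->
    ((expR (- x) * (c * (rho / (rho + b))))%:E <= J <=
     (expR x * (c * (rho / (rho + b))))%:E)%E.
  have [J0 J1] : (0 <= J)%E /\ (J < +oo)%E.
    have /andP[h1 h2] := squeeze 1 ltr01; split; last exact: le_lt_trans h2 (ltry _).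
    apply: le_trans h1; rewrite lee_fin mulr_ge0 ?expR_ge0// mulr_ge0//.
    by rewrite divr_ge0// ltW.
  have Jfin : J \is a fin_num by rewrite ge0_fin_numE.
  have [j Jj] : exists j, J = j%:E by exists (fine J); rewrite fineK.
  rewrite Jj in squeeze *; congr EFin.
  set C := c * _ in squeeze *.
  have h (n : nat) : expR (- n.+1%:R^-1) * C <= j <= expR (n.+1%:R^-1) * C.
    have n0 : 0 < n.+1%:R^-1 :> R by rewrite invr_gt0.
    by have := squeeze _ n0; rewrite !lee_fin.
  have cv : (fun n : nat => n.+1%:R^-1 : R) @ \oo --> (0 : R) by exact: cvg_harmonic.
  have e0 : C = expR 0 * C by rewrite expR0 mul1r.
  have cv1 : expR (n.+1%:R^-1) * C @[n --> \oo] --> C.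
    rewrite [X in _ --> X]e0; apply: cvgM; last exact: cvg_cst.
    by apply: continuous_cvg; [exact: continuous_expR | exact: cv].
  have cv2 : expR (- n.+1%:R^-1) * C @[n --> \oo] --> C.
    rewrite [X in _ --> X]e0 -[X in expR X * _]oppr0; apply: cvgM; last exact: cvg_cst.
    by apply: continuous_cvg; [exact: continuous_expR | exact: cvgN].
  apply/eqP; rewrite eq_le; apply/andP; split.
    rewrite -(cvg_lim _ cv1)//; apply: limr_ge; first exact: cvgP cv1.
    by apply: nearW => n; have /andP[] := h n.
  rewrite -[X in X <= _](cvg_lim _ cv2)//; apply: limr_le; first exact: cvgP cv2.
  by apply: nearW => n; have /andP[] := h n.
(* This mesh makes [p * q], the ratio of the geometric series below, equal to [expR (- x)]. *)
move=> x0; pose h := x / (rho + b).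
have h0 : 0 < h by rewrite divr_gt0.
pose A (i : nat) := D `&` [set s | i%:R * h < X s <= i.+1%:R * h].
have mT t : measurable (D `&` [set s | t < X s]).
  by apply: measurableI => //; exact: measurable_gt_fun.
have Aeq i : A i = (D `&` [set s | i%:R * h < X s]) `\` (D `&` [set s | i.+1%:R * h < X s]).
  apply/seteqP; split => s /=.
    move=> [Ds /andP[h1 h2]]; split => // -[_]; by rewrite ltNge h2.
  move=> [[Ds h1] h2]; split => //; apply/andP; split => //.
  by rewrite leNgt; apply/negP => h3; apply: h2.
have mA i : measurable (A i) by rewrite Aeq; exact: measurableD.
have DX : D `&` [set s | 0 < X s] = \bigcup_i A i.
  apply/seteqP; split => s /=.
    move=> [Ds Xs].
    have Xh : 0 <= X s / h by rewrite divr_ge0// ltW.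
    have /andP[n1 n2] := truncn_itv Xh.
    move: n1 n2; set k := Num.truncn _ => n1 n2.
    (* The slices are open on the left, so an exact multiple [k * h] belongs to slice [k - 1]. *)
    have [e|ne] := eqVneq (X s / h) k%:R.
      have t0 : (0 < k)%N.
        by rewrite -(ltr0n R) -e divr_gt0.
      exists k.-1 => //; split => //=; rewrite prednK//.
      apply/andP; split; last by rewrite -ler_pdivrMr// e.
      by rewrite -ltr_pdivlMr// e ltr_nat prednK.
    exists k => //; split => //=.
    apply/andP; split; last by rewrite -ler_pdivrMr// ltW.
    by rewrite -ltr_pdivlMr// lt_neqAle eq_sym ne.
  move=> [i _ [Ds /andP[h1 h2]]]; split => //.
  by apply: le_lt_trans h1; rewrite mulr_ge0// ltW.
have tA : trivIset setT A.
  apply: ltn_trivIset => i j ij; apply/seteqP; split => // s [] [_ /andP[h1 h2]] [_ /andP[h3 h4]].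
  suff hh : j.+1%:R * h <= i%:R * h by have := lt_le_trans h3 (le_trans h2 hh); rewrite ltxx.
  by rewrite ler_pM2r// ler_nat.
pose q := expR (- (rho * h)); pose p := expR (- (b * h)).
have q0 : 0 < q by exact: expR_gt0.
have p0 : 0 < p by exact: expR_gt0.
have q1 : q < 1 by rewrite expR_lt1 oppr_lt0 mulr_gt0.
have p1 : p <= 1 by rewrite -expR0 ler_expR oppr_le0 mulr_ge0// ltW.
have pqE : p * q = expR (- x).
  by rewrite /p /q -expRD; congr expR; rewrite /h; field; rewrite gt_eqF.
have pq1 : p * q < 1 by rewrite pqE expR_lt1 oppr_lt0.
have pq0 : 0 < p * q by rewrite mulr_gt0.
have qE (i : nat) : expR (- (rho * (i%:R * h))) = q ^+ i.
  by rewrite /q -expRM_natl; congr expR; ring.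
have intA i : (\int[m]_(s in A i) (g s)%:E = (c * (1 - q) * q ^+ i)%:E)%E.
  have := H (i%:R * h) (mulr_ge0 (ler0n _ _) (ltW h0)).
  have -> : D `&` [set s | i%:R * h < X s] = A i `|` (D `&` [set s | i.+1%:R * h < X s]).
    rewrite Aeq setUC setDUK// => s [Ds h1]; split => //=; apply: le_lt_trans h1.
    by rewrite ler_pM2r// ler_nat.
  rewrite ge0_integral_setU//; last 3 first.
  - exact: measurable_funTS.
  - by move=> s _; rewrite lee_fin.
  - by rewrite Aeq; apply/disj_setPS => s [[_ ?] ?].
  rewrite H; last by rewrite mulr_ge0// ltW.
  rewrite !qE; case: (\int[m]_(s in A i) (g s)%:E)%E => [a| |] //= [e].
  by congr EFin; rewrite mulrBr mulr1 mulrBl -e exprS; ring.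
have JE : J = (\sum_(0 <= i <oo) \int[m]_(s in A i) (g s * expR (- (b * X s)))%:E)%E.
  rewrite /J DX ge0_integral_bigcup//.
  - exact: measurable_funTS.
  - by move=> s _; rewrite lee_fin mulr_ge0// expR_ge0.
have intZ i a : 0 <= a ->
    (\int[m]_(s in A i) (a%:E * (g s)%:E) = a%:E * \int[m]_(s in A i) (g s)%:E)%E.
  move=> a0; apply: ge0_integralZl_EFin => //; last exact: measurable_funTS.
  by move=> s _; rewrite lee_fin.
have bnd i : ((c * (1 - q) * p * (p * q) ^+ i)%:E <=
     \int[m]_(s in A i) (g s * expR (- (b * X s)))%:E <=
     (c * (1 - q) * (p * q) ^+ i)%:E)%E.
  have pE (j : nat) : expR (- (b * (j%:R * h))) = p ^+ j.
    by rewrite /p -expRM_natl; congr expR; ring.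
  apply/andP; split.
    have -> : ((c * (1 - q) * p * (p * q) ^+ i)%:E =
      \int[m]_(s in A i) ((p ^+ i.+1)%:E * (g s)%:E))%E.
      rewrite intZ ?exprn_ge0 ?(ltW p0)//.
      rewrite intA -EFinM; congr EFin; rewrite exprS exprMn; ring.
    apply: ge0_le_integral => //.
    - by move=> s _; rewrite mule_ge0// lee_fin// exprn_ge0// ltW.
    - apply: measurable_funTS; apply: emeasurable_funM => //.
    - exact: measurable_funTS.
    move=> s [_ /andP[_ h2]]; rewrite -EFinM lee_fin mulrC ler_wpM2l//.
    by rewrite -pE ler_expR lerN2 ler_wpM2l.
  have -> : ((c * (1 - q) * (p * q) ^+ i)%:E =
    \int[m]_(s in A i) ((p ^+ i)%:E * (g s)%:E))%E.
    rewrite intZ ?exprn_ge0 ?(ltW p0)//.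
    rewrite intA -EFinM; congr EFin; rewrite exprMn; ring.
  apply: ge0_le_integral => //.
  - by move=> s _; rewrite lee_fin mulr_ge0// expR_ge0.
  - exact: measurable_funTS.
  - apply: measurable_funTS; apply: emeasurable_funM => //.
  move=> s [_ /andP[h1 h2]]; rewrite -EFinM lee_fin mulrC ler_wpM2r//.
  by rewrite -pE ler_expR lerN2 ler_wpM2l// ltW.
have geo a : (\sum_(0 <= i <oo) (a * (p * q) ^+ i)%:E = (a / (1 - p * q))%:E)%E.
  apply/cvg_lim => //.
  rewrite (_ : (fun n => _) = EFin \o series (geometric a (p * q))); last first.
    by apply/funext => n /=; rewrite sumEFin.
  apply/cvg_EFin; first exact: nearW.
  by apply: cvg_geometric_series; rewrite gtr0_norm.
have up : (J <= (c * (1 - q) / (1 - p * q))%:E)%E.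
  rewrite JE -geo; apply: lee_nneseries => i; last by move=> _; have /andP[] := bnd i.
  by move=> _ _; apply: integral_ge0 => s _; rewrite lee_fin mulr_ge0// expR_ge0.
have lo : ((c * (1 - q) * p / (1 - p * q))%:E <= J)%E.
  rewrite JE -geo; apply: lee_nneseries => i; last by move=> _; have /andP[] := bnd i.
  by rewrite lee_fin !mulr_ge0// ?exprn_ge0// ltW// subr_gt0.
(* Used at [y = rho * h] and at [y = x] to compare [(1 - q) / (1 - p * q)] with [rho * h / x], which
   is [rho / (rho + b)]. The lower bound loses the factor [p * q = expR (- x)], the upper bound its
   inverse. *)
have onem (y : R) : y * expR (- y) <= 1 - expR (- y) <= y.
  apply/andP; split; last by have := expR_ge1Dx (- y); lra.
  have := expR_ge1Dx y => hy.
  have /(_ (expR (- y)) (expR_ge0 _)) := ler_wpM2r _ hy.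
  by rewrite -expRD subrr expR0 mulrDl mul1r; lra.
have /andP[q2 q3] := onem (rho * h); rewrite -/q in q2 q3.
have /andP[x2 x3] := onem x; rewrite -pqE in x2 x3.
have d0 : 0 < 1 - p * q by rewrite subr_gt0.
have rE : rho / (rho + b) = rho * h / x by rewrite /h; field; rewrite !gt_eqF.
apply/andP; split.
  apply: le_trans lo; rewrite lee_fin -pqE rE.
  rewrite [X in X <= _](_ : _ = c * (p * (rho * h * q) / x)); last by ring.
  rewrite [X in _ <= X](_ : _ = c * (p * (1 - q) / (1 - p * q))); last by ring.
  rewrite ler_wpM2l//; apply: ler_pM => //.
  - by rewrite mulr_ge0 ?(ltW p0)// mulr_ge0 ?(ltW q0)// mulr_ge0// ltW.
  - by rewrite invr_ge0 ltW.
  - by rewrite ler_pM2l.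
  - by rewrite lef_pV2// ?posrE.
apply: le_trans up _; rewrite lee_fin -[x in expR x]opprK expRN -pqE rE.
rewrite [X in X <= _](_ : _ = c * ((1 - q) / (1 - p * q))); last by ring.
rewrite [X in _ <= X](_ : _ = c * (rho * h / (x * (p * q)))); last first.
  by field; rewrite !gt_eqF.
rewrite ler_wpM2l//; apply: ler_pM => //.
- by rewrite subr_ge0 ltW.
- by rewrite invr_ge0 ltW.
- by rewrite lef_pV2// ?posrE// mulr_gt0.
Qed.

Lemma exp_family_laplace (D : set S) (X : nat -> S -> R) (rho : nat -> R)
    (c b : R) (n : nat) :
  measurable D -> (forall k, measurable_fun setT (X k)) -> 0 <= c ->
  (forall k, 0 < rho k) -> 0 <= b ->
  (forall t : nat -> R, (forall k, 0 <= t k) ->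
     m (D `&` [set s | forall k, (k < n)%N -> t k < X k s]) =
     (c * \prod_(k < n) expR (- (rho k * t k)))%:E) ->
  (\int[m]_(s in D `&` [set s | forall k, (k < n)%N -> (0 < X k s)%R])
     (\prod_(k < n) expR (- (b * X k s)))%:E =
   (c * \prod_(k < n) (rho k / (rho k + b)))%:E)%E.
Proof.
move=> mD mX c0 rho0 b0 H.
have mX' k t : measurable [set s | t < X k s] by exact: measurable_gt_fun.
have mall (Q : pred nat) t : measurable [set s | forall k, (k < n)%N -> Q k -> t k < X k s].
  rewrite (_ : [set s | _] = \bigcap_(k in [set k | (k < n)%N && Q k]) [set s | t k < X k s]).
    by apply: bigcap_measurableType => k _; exact: mX'.
  apply/seteqP; split => s /= h k; first by move=> /andP[]; exact: h.
  by move=> kn Qk; apply: h; rewrite /= kn.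
have mallT t : measurable [set s | forall k, (k < n)%N -> t k < X k s].
  rewrite (_ : [set s | _] = [set s | forall k, (k < n)%N -> predT k -> t k < X k s]).
    exact: mall.
  by apply/seteqP; split => s /= h k kn => [_|]; exact: h.
have mP j : measurable_fun setT (fun s => \prod_(k < j) expR (- (b * X k s))).
  apply: measurable_prod => k _.
  apply: measurableT_comp => //; apply: measurableT_comp => //.
  exact: measurable_funM.
have rb k : 0 < rho k + b by rewrite ltr_wpDr.
(* Interpolation: the first [j] clocks already contribute their Laplace factors, the others still
   appear through their tails. Since [t] stays free, clock [j] comes with an arbitrary threshold, as
   [exp_tail_laplace] requires for the next step. *)
suff G j t : (j <= n)%N -> (forall k, 0 <= t k) ->
    (\int[m]_(s in D `&` [set s | forall k, (k < n)%N ->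
        ((if (k < j)%N then 0 else t k) < X k s)%R])
     (\prod_(k < j) expR (- (b * X k s)))%:E =
     (c * (\prod_(k < j) (rho k / (rho k + b))) *
        \prod_(j <= k < n) expR (- (rho k * t k)))%:E)%E.
  have := G n (fun=> 0) (leqnn n) (fun=> lexx 0).
  rewrite big_geq// mulr1 => <-; congr (integral _ _ _).
  apply/seteqP; split => s /= [Ds h]; split => // k kn; have := h k kn;
  by rewrite ?kn.
elim: j t => [|j IHj] t jn t0.
  rewrite big_ord0 mulr1 big_mkord -H//.
  under eq_integral do rewrite big_ord0.
  by rewrite integral_cst// ?mul1e//; apply: measurableI => //; exact: mallT.
pose t' x k := if k == j then x else t k.
pose D' := D `&` [set s | forall k, (k < n)%N -> k != j ->
  (if (k < j)%N then 0 else t k) < X k s].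
pose c' := c * (\prod_(k < j) (rho k / (rho k + b))) *
  \prod_(j.+1 <= k < n) expR (- (rho k * t k)).
have c'0 : 0 <= c'.
  apply: mulr_ge0; last by apply: prodr_ge0 => k _; exact: expR_ge0.
  by apply: mulr_ge0 => //; apply: prodr_ge0 => k _; rewrite divr_ge0// ltW.
have mD' : measurable D'.
  by apply: measurableI => //; exact: (mall [pred k | k != j] (fun k => if (k < j)%N then 0 else t k)).
have setE x : D' `&` [set s | x < X j s] = D `&` [set s | forall k, (k < n)%N ->
        ((if (k < j)%N then 0 else t' x k) < X k s)%R].
  apply/seteqP; split => s /=.
    move=> [[Ds h] xj]; split => // k kn; rewrite /t'.
    by case: eqVneq => [->|kj]; [rewrite ltnn | exact: h].
  move=> [Ds h]; split; last by have := h j jn; rewrite ltnn /t' eqxx.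
  split => // k kn kj; have := h k kn; by rewrite /t' (negbTE kj).
have := @exp_tail_laplace D' (fun s => \prod_(k < j) expR (- (b * X k s))) (X j) c' (rho j) b
  mD' (mP j) _ (mX j) c'0 (rho0 j) b0.
have g0 s : 0 <= \prod_(k < j) expR (- (b * X k s)) by rewrite prodr_ge0// => k _; exact: expR_ge0.
move=> /(_ g0); have hyp x : 0 <= x ->
  (\int[m]_(s in D' `&` [set s | (x < X j s)%R]) (\prod_(k < j) expR (- (b * X k s)))%:E =
   (c' * expR (- (rho j * x)))%:E)%E.
  move=> x0; rewrite setE IHj; last 2 first.
  - exact: ltnW.
  - by move=> k; rewrite /t'; case: ifP.
  congr EFin; rewrite /c' -!mulrA; congr (_ * (_ * _)).
  rewrite (big_ltn jn) /t' eqxx mulrC; congr (_ * _).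
  by apply: eq_big_nat => k /andP[jk _]; rewrite gtn_eqF.
move=> /(_ hyp) h; rewrite -[RHS](_ : (c' * (rho j / (rho j + b)))%:E = _); last first.
  by congr EFin; rewrite /c' big_ord_recr/=; ring.
rewrite -h setE.
have -> : [set s | forall k, (k < n)%N -> (if (k < j)%N then 0 else t' 0 k) < X k s] =
  [set s | forall k, (k < n)%N -> (if (k < j.+1)%N then 0 else t k) < X k s].
  apply/seteqP; split => s /= hs k kn; have := hs k kn; rewrite /t' ltnS (leq_eqVlt k j);
  by case: eqVneq => [->|//]; rewrite ltnn.
by apply: eq_integral => s _; rewrite big_ord_recr.
Qed.

End exponential_laplace.

(** * Recurrence *)

Section environment.
Variables (K : nat) (R : realType).
Local Notation env := (env K R).
Local Notation site := (site K R).

Definition reindex_env (sig : int -> int) (w : env) : env := fun i => w (sig i).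

Lemma measurable_site i : measurable_fun setT (fun w : env => w i : site).
Proof.
move=> _ B mB; rewrite setTI; apply: sub_sigma_algebra.
by exists i, B.
Qed.

Lemma measurable_coord i (j : 'I_K.+2) : measurable_fun setT (fun w : env => (w i j)%:num).
Proof.
move=> _ B mB; rewrite setTI.
have mS : measurable [set v : site | B (v j)%:num].
  by apply: sub_sigma_algebra; exists j, B.
by have := measurable_site i measurableT mS; rewrite setTI.
Qed.

Lemma measurable_lam i : measurable_fun setT (fun w : env => lam w i).
Proof. exact: measurable_coord. Qed.

Lemma measurable_mu i l : measurable_fun setT (fun w : env => mu w i l).
Proof. exact: measurable_coord. Qed.

Lemma measurable_rate i : measurable_fun setT (fun w : env => rate w i).
Proof.
apply: measurable_funD; first exact: measurable_lam.
by apply: measurable_sum => l; exact: measurable_mu.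
Qed.

Lemma measurable_reindex_env sig : measurable_fun setT (reindex_env sig).
Proof.
apply: (@measurability _ _ env env _ _ [set A | exists i (B : set site), measurable B /\ A = [set w : env | B (w i)]]) => //.
move=> _ [_ [i [B [mB ->]]] <-]; rewrite setTI; apply: sub_sigma_algebra.
by exists (sig i), B.
Qed.

Variable P : probability env R.
Hypothesis hiid : iid_env P.

Definition cylinders : set (set env) := [set A | exists (js : seq int) (B : int -> set site),
  (forall j, measurable (B j)) /\ A = [set w : env | forall j, j \in js -> B j (w j)]].

Lemma cylinders_setI : setI_closed cylinders.
Proof.
move=> _ _ [js1 [B1 [mB1 ->]]] [js2 [B2 [mB2 ->]]].
exists (js1 ++ js2), (fun j => (if j \in js1 then B1 j else setT) `&`
                               (if j \in js2 then B2 j else setT)).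
split; first by move=> j; apply: measurableI; case: ifP.
apply/seteqP; split => w /=.
  by move=> [h1 h2] j _; split; case: ifP => // /[dup] ?; [exact: h1 | exact: h2].
move=> h; split => j jj.
  by have := h j; rewrite mem_cat jj => /(_ isT)[].
by have := h j; rewrite mem_cat jj orbT => /(_ isT)[].
Qed.

Lemma measurable_cylinders A : cylinders A -> measurable A.
Proof.
move=> [js [B [mB ->]]].
elim: js => [|j js IH].
  have -> : [set w : env | forall j, j \in [::] -> B j (w j)] = setT.
    by apply/seteqP; split.
  exact: measurableT.
have -> : [set w : env | forall i, i \in j :: js -> B i (w i)] = ([set w : env | B j (w j)] `&` [set w : env | forall j, j \in js -> B j (w j)]).
  apply/seteqP; split => w /=.
    by move=> h; split=> [|i ijs]; apply: h; rewrite inE ?eqxx ?ijs ?orbT.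
  by move=> [h1 h2] i; rewrite inE => /orP[/eqP ->//|]; exact: h2.
apply: measurableI => //.
by have := measurable_site j measurableT (mB j); rewrite setTI.
Qed.

Lemma measurable_cylindersE : @measurable _ env = <<s cylinders >>.
Proof.
apply/seteqP; split.
  apply: smallest_sub; first exact: smallest_sigma_algebra.
  move=> _ [i [B [mB ->]]]; apply: sub_sigma_algebra.
  exists [:: i], (fun=> B); split => //.
  apply/seteqP; split => w /=; first by move=> h j; rewrite inE => /eqP ->.
  by apply; rewrite inE.
apply: smallest_sub; first exact: sigma_algebra_measurable.
exact: measurable_cylinders.
Qed.

(** Cylinders are a generating family closed under intersection, and relabelling the sites
    injectively does not change the finite-dimensional laws. It is applied to translations and to
    the reflection of the integers. *)
Lemma iid_env_reindex sig : injective sig -> forall A, measurable A ->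
  P (reindex_env sig @^-1` A) = P A.
Proof.
move=> inj A mA.
have mphi := measurable_reindex_env sig.
pose nu := [the measure _ _ of pushforward P (reindex_env sig)] : {measure set env -> \bar R}.
have := @measure_unique _ _ _ cylinders (fun=> setT) measurable_cylindersE
  cylinders_setI _ _ (nu mphi) P _ _ A mA; apply.
- by move=> _; exists [::], (fun=> setT); split => //; apply/seteqP; split.
- by apply/seteqP; split => // w _; exists 0%N.
- move=> _ [js [B [mB ->]]]; rewrite /nu /= /pushforward /=.
  case: hiid => hind hid.
  have -> : [set w : env | forall j, j \in js -> B j (w j)] =
    [set w : env | forall j, j \in undup js -> B j (w j)].
    by apply/seteqP; split => w /= h j; have := h j; rewrite mem_undup.
  rewrite (hind _ B (undup_uniq js) mB).
  (* The constraint on site [j] is carried over to site [sig j]; injectivity makes the choice of [j]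
     unambiguous, and the sites off the image of [js] stay free. *)
  pose B' i := if [pick j : seq_sub js | sig (val j) == i] is Some j then B (val j) else setT.
  have B'E j : j \in js -> B' (sig j) = B j.
    move=> jj; rewrite /B'; case: pickP => [k /eqP/inj -> //|/(_ (SeqSub jj))].
    by rewrite eqxx.
  transitivity (P [set w : env | forall i, i \in map sig (undup js) -> B' i (w i)]).
    congr (P _); apply/seteqP; split => w /= h.
      move=> i /mapP[j jj ij]; have jj' : j \in js by rewrite -mem_undup.
      by rewrite ij (B'E j jj'); exact: (h j jj).
    move=> j jj; have jj' : j \in js by rewrite -mem_undup.
    have : sig j \in [seq sig j0 | j0 <- undup js] by apply: map_f.
    by move=> /(h (sig j)); rewrite (B'E j jj').
  rewrite hind; last 2 first.
  - by rewrite map_inj_uniq// undup_uniq.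
  - by move=> i; rewrite /B'; case: pickP.
  rewrite big_map big_seq [RHS]big_seq; apply: eq_bigr => j.
  rewrite mem_undup => jj; rewrite B'E//; exact: hid.
- by move=> _; rewrite /nu /= /pushforward /= preimage_setT probability_setT ltry.
Qed.

Lemma iid_env_integral sig (f : env -> \bar R) : injective sig ->
  measurable_fun setT f -> (forall w, 0 <= f w)%E ->
  (\int[P]_w f (reindex_env sig w) = \int[P]_w f w)%E.
Proof.
move=> inj mf f0; have mphi := measurable_reindex_env sig.
have := @ge0_integral_pushforward _ _ _ _ _ _ mphi P setT f measurableT mf.
rewrite preimage_setT => /(_ (fun y _ => f0 y)) <-.
apply: eq_measure_integral => A mA _; exact: iid_env_reindex.
Qed.

Lemma iid_env_ae sig (Q : env -> Prop) : injective sig ->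
  {ae P, forall w, Q w} -> {ae P, forall w, Q (reindex_env sig w)}.
Proof.
move=> inj [A [mA A0 QA]]; exists (reindex_env sig @^-1` A); split.
- by have := measurable_reindex_env sig measurableT mA; rewrite setTI.
- by rewrite iid_env_reindex.
- by move=> w h; exact: QA.
Qed.

End environment.

(** * Matrix products and their singular values *)

Section matrix_form.
Variables (R : realType) (K : nat) (la : nat -> R) (mu : nat -> 'I_K.+1 -> R).

Definition companion k : 'M[R]_K.+1 :=
  \matrix_(i, j) (mu k j / la k + (i == j.+1 :> nat)%:R).

(** For [l <= K] the uncut subdiagonal of [Mapp] is read only at indices below [K], where it agrees
    with that of the matrix. *)
Lemma companion_mul k (v : nat -> R) (u : 'cV[R]_K.+1) (l : 'I_K.+1) :
  (forall j, u j ord0 = v j) -> (companion k *m u) l ord0 = Mapp la mu k v l.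
Proof.
move=> uv; rewrite mxE /Mapp.
under eq_bigr do rewrite mxE mulrDl uv.
rewrite big_split /=; congr (_ + _).
case: l => [[|l] lK] /=; first by rewrite big1// => j _; rewrite mul0r.
rewrite (bigD1 (Ordinal (ltnW lK)))//= eqxx mul1r big1 ?addr0// => j jl.
rewrite eqSS; case: eqP => [e|]; last by rewrite mul0r.
by move/eqP: jl; case; apply: val_inj.
Qed.

Lemma MrowE n k (l : 'I_K.+1) :
  ((\prod_(j < n) companion (k + j)) *m (const_mx 1 : 'cV[R]_K.+1)) l ord0 = Mrow la mu n k l.
Proof.
elim: n k l => [|n IHn] k l; first by rewrite big_ord0 mul1mx mxE.
rewrite big_ord_recl addn0 -mulmxA /=; apply: companion_mul => j.
rewrite -IHn; congr ((_ *m _) _ _); apply: eq_bigr => i _.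
by rewrite /bump leq0n add1n addSnnS.
Qed.

Lemma WserE N k (l : 'I_K.+1) :
  Wser la mu N k l = \sum_(n < N)
    (la (k + n))^-1 * ((\prod_(j < n) companion (k + j)) *m (const_mx 1 : 'cV[R]_K.+1)) l ord0.
Proof.
elim: N k l => [|N IHN] k l; first by rewrite big_ord0.
rewrite big_ord_recl addn0 big_ord0 mul1mx [X in _ * X]mxE mulr1 /=; congr (_ + _).
rewrite -(@companion_mul k _ (\sum_(n < N) (la (k.+1 + n))^-1 *:
  ((\prod_(j < n) companion (k.+1 + j)) *m (const_mx 1 : 'cV[R]_K.+1)))); last first.
  by move=> j; rewrite IHN summxE; apply: eq_bigr => n _; rewrite mxE.
rewrite mulmx_sumr summxE; apply: eq_bigr => n _.
rewrite -scalemxAr mxE /bump leq0n add1n addSnnS; congr (_ * _).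
rewrite mulmxA big_ord_recl addn0; congr ((_ *m _ *m _) _ _).
by apply: eq_bigr => i _; rewrite lift0 addSnnS.
Qed.

End matrix_form.

Section singular_value_bound.
Variable R : realType.

(** Both sides are, up to sign, the coefficient of degree [n] of the characteristic polynomial, once
    read off the matrix and once off its roots. *)
Lemma mxtrace_singular_values n (A : 'M[R]_n.+1) (s : 'I_n.+1 -> R) :
  singular_values A s -> \tr (A^T *m A) = \sum_k s k ^+ 2.
Proof.
move=> [_ _ E]; have := char_poly_trace (A^T *m A) (ltn0Sn n).
rewrite E => h; apply: oppr_inj; rewrite -h /=.
have := @coefPn_prod_XsubC R [seq s k ^+ 2 | k <- index_enum 'I_n.+1].
have -> : size [seq s k ^+ 2 | k <- index_enum 'I_n.+1] = n.+1.
  by rewrite size_map [index_enum _]unlock -enumT size_enum_ord.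
by rewrite !big_map => ->.
Qed.

(** The square of an entry is at most the trace of [A^T *m A], the sum of the [n.+1] squared
    singular values; so an entry is at most [n.+1 * s ord_max], and a row has [n.+1] entries. The
    crude constant disappears after logarithms are divided by the number of factors. *)
Lemma row_sum_le_singular n (A : 'M[R]_n.+1) (s : 'I_n.+1 -> R) i :
  singular_values A s -> \sum_j A i j <= n.+1%:R ^+ 2 * s ord_max.
Proof.
move=> sA; have trE := mxtrace_singular_values sA; case: sA => s0 smono _.
have AE j : A i j <= n.+1%:R * s ord_max.
  apply: le_trans (ler_norm _) _.
  rewrite -(@ler_pXn2r _ 2)// ?nnegrE ?normr_ge0 ?mulr_ge0// real_normK ?num_real//.
  rewrite exprMn; apply: (@le_trans _ _ (\sum_k s k ^+ 2)); last first.
    apply: (@le_trans _ _ (\sum_(k < n.+1) (s ord_max) ^+ 2)).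
      by apply: ler_sum => k _; rewrite lerXn2r ?nnegrE// smono// -ltnS.
    rewrite sumr_const card_ord -[X in X <= _]mulr_natl ler_wpM2r ?sqr_ge0//.
    by rewrite ler_eXnr// ler1n.
  rewrite -trE /mxtrace (bigD1 j)//= mxE (bigD1 i)//= mxE -expr2 -addrA lerDl.
  rewrite addr_ge0//; first by apply: sumr_ge0 => k _; rewrite mxE -expr2 sqr_ge0.
  by apply: sumr_ge0 => k _; rewrite mxE; apply: sumr_ge0 => k' _; rewrite mxE -expr2 sqr_ge0.
apply: (@le_trans _ _ (\sum_(j < n.+1) n.+1%:R * s ord_max)); first exact: ler_sum.
by rewrite sumr_const card_ord -[X in X <= _]mulr_natl mulrA -expr2.
Qed.

End singular_value_bound.

(** * Positive rates and the mean escape probability *)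

Section recurrence.
Variables (K : nat) (R : realType) (P : probability (env K R) R).
Local Notation env := (env K R).

(** As [x <= 1], the function [- lne x] is nonnegative, hence integrable and almost surely finite,
    while [lne] is [-oo] at every nonpositive argument. *)
Lemma lne_integral_gt0 (x : env -> R) : measurable_fun setT x ->
  (forall w, x w <= 1) -> (-oo < \int[P]_w lne (x w)%:E)%E ->
  {ae P, forall w, 0 < x w}.
Proof.
move=> mx x1 hint.
pose g w : \bar R := (- lne (x w)%:E)%E.
have mf : measurable_fun setT (fun w => lne (x w)%:E).
  rewrite (_ : (fun w => lne (x w)%:E) =
    (fun w => if x w <= 0 then -oo%E else (ln (x w))%:E)); last exact/funext.
  apply: measurable_fun_ifT => //; first exact: measurable_fun_ler.
  by apply/measurable_EFinP; apply: measurableT_comp => //; exact: measurable_ln.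
have g0 w : (0 <= g w)%E by rewrite /g oppe_ge0 lne_le0 lee_fin.
have fE : (fun w => lne (x w)%:E) = (fun w => - g w)%E.
  by apply/funext => w; rewrite /g oppeK.
have ig : P.-integrable setT g.
  apply/integrableP; split; first by apply: measurableT_comp.
  under eq_integral do rewrite gee0_abs//.
  move: hint; rewrite fE integral_ge0N//.
  by rewrite -[(-oo)%E]/(- +oo)%E lteN2.
have := integrable_ae measurableT ig; apply: filterS => w /(_ I).
by rewrite /g fin_numN /lne leNgt; case: ifP => //= /negbFE.
Qed.

Hypothesis hiid : iid_env P.
Hypothesis hC3 : condC3 P.

Lemma lam_ge0 (w : env) i : 0 <= lam w i. Proof. by rewrite /lam. Qed.
Lemma mu_ge0 (w : env) i l : 0 <= mu w i l. Proof. by rewrite /mu. Qed.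
Lemma rate_ge0 (w : env) i : 0 <= rate w i.
Proof. by rewrite addr_ge0 ?lam_ge0 ?sumr_ge0// => l _; exact: mu_ge0. Qed.

Lemma measurable_invr_ge0 d (T : measurableType d) (f : T -> R) :
  measurable_fun setT f -> (forall x, 0 <= f x) -> measurable_fun setT (fun x => (f x)^-1).
Proof.
move=> mf f0; rewrite (_ : (fun x => (f x)^-1) = (fun x => f x `^ (-1))).
  exact: (measurableT_comp (@measurable_powR R (-1)) mf).
by apply/funext => x; rewrite powR_inv1.
Qed.

Lemma ae_lam_mu_gt0 : {ae P, forall w, forall i, 0 < lam w i /\ 0 < mu w i ord_max}.
Proof.
have H0 : {ae P, forall w, 0 < lam w 0 /\ 0 < mu w 0 ord_max}.
  case: hC3 => h1 h2.
  have mi : measurable_fun setT (fun w : env => (rate w 0)^-1).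
    by apply: measurable_invr_ge0; [exact: measurable_rate | move=> w; exact: rate_ge0].
  (* If the rate is 0 the quotient is 0, by the convention for division. *)
  have le1 (w : env) x : 0 <= x -> x <= rate w 0 -> x / rate w 0 <= 1.
    move=> x0; have := rate_ge0 w 0; rewrite le_eqVlt => /predU1P[<-|r0] xr.
      by rewrite invr0 mulr0.
    by rewrite ler_pdivrMr// mul1r.
  have a1 := @lne_integral_gt0 (fun w => lam w 0 / rate w 0)
    (measurable_funM (@measurable_lam K R 0) mi) _ h1.
  have a2 := @lne_integral_gt0 (fun w => mu w 0 ord_max / rate w 0)
    (measurable_funM (@measurable_mu K R 0 ord_max) mi) _ h2.
  have {}a1 := a1 (fun w => le1 w _ (lam_ge0 w 0) _).
  have {}a2 := a2 (fun w => le1 w _ (mu_ge0 w 0 ord_max) _).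
  have {}a1 : {ae P, forall w, 0 < lam w 0 / rate w 0}.
    by apply: a1 => w; rewrite /rate lerDl sumr_ge0// => l _; exact: mu_ge0.
  have {}a2 : {ae P, forall w, 0 < mu w 0 ord_max / rate w 0}.
    apply: a2 => w; rewrite /rate (bigD1 ord_max)//= addrCA lerDl addr_ge0 ?lam_ge0//.
    by rewrite sumr_ge0// => l _; exact: mu_ge0.
  apply: filterS2 a1 a2 => w b1 b2.
  have r0 := rate_ge0 w 0.
  split; rewrite lt_neqAle ?lam_ge0 ?mu_ge0 andbT eq_sym.
    by apply: contraTneq b1 => ->; rewrite mul0r ltxx.
  by apply: contraTneq b2 => ->; rewrite mul0r ltxx.
have Hi (i : int) : {ae P, forall w, 0 < lam w i /\ 0 < mu w i ord_max}.
  have inj : injective (fun j : int => j + i) by exact: addIr.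
  have := iid_env_ae hiid inj H0; apply: filterS => w.
  by rewrite /lam /mu /reindex_env add0r.
have Hn : {ae P, forall w, forall n : nat, (0 < lam w n%:Z /\ 0 < mu w n%:Z ord_max) /\
    (0 < lam w (- n%:Z) /\ 0 < mu w (- n%:Z) ord_max)}.
  apply: ae_foralln => n; have := Hi n%:Z; have := Hi (- n%:Z).
  by apply: filterS2 => w h1 h2; split.
apply: filterS Hn => w h; case=> n; first by have [] := h n.
by rewrite NegzE; have [] := h n.+1.
Qed.

(* Where a jump rate to the right vanishes it is replaced by 1, so that the
   generating functions below are defined for every environment. *)
Definition flam (w : env) (k : nat) : R := lam w k%:Z + (lam w k%:Z == 0)%:R.
Definition fmu (w : env) (k : nat) (l : 'I_K.+1) : R := mu w k%:Z l.

Lemma flam_gt0 w k : 0 < flam w k.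
Proof.
rewrite /flam; case: eqVneq => [->|h]; first by rewrite add0r ltr01.
by rewrite addr0 lt_neqAle eq_sym h lam_ge0.
Qed.

Lemma fmu_ge0 w k l : 0 <= fmu w k l. Proof. exact: mu_ge0. Qed.

Lemma measurable_flam k : measurable_fun setT (flam^~ k).
Proof.
apply: measurable_funD; first exact: measurable_lam.
rewrite (_ : (fun w => _) = (fun w : env => if lam w k%:Z == 0 then 1 else 0 : R)).
  apply: measurable_fun_ifT => //; apply: measurable_fun_eqr => //.
  exact: measurable_lam.
by apply/funext => w; case: eqP.
Qed.

Lemma measurable_pgf n k l : measurable_fun setT (fun w => pgf (flam w) (fmu w) 0 n k l).
Proof.
elim: n k l => [|n IHn] k l; first exact: measurable_cst.
rewrite /=; apply: measurable_funM; last by case: l.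
apply: measurable_funM; first exact: measurable_flam.
apply: measurable_invr_ge0; last first.
  move=> w; apply: ltW; apply: den_gt0 => //; first exact: flam_gt0.
    by move=> *; exact: fmu_ge0.
  by move=> j; apply: pgf_le1 => //; [exact: flam_gt0 | move=> *; exact: fmu_ge0].
apply: measurable_funB; last first.
  apply: measurable_sum => j; apply: measurable_funM => //; exact: measurable_mu.
apply: measurable_funD => //; apply: measurable_funD; first exact: measurable_flam.
by apply: measurable_sum => j; exact: measurable_mu.
Qed.

(* The environment is read towards [+oo], so [Fret w] is the probability that
   the walk in the reflected environment ever reaches 1 from 0. *)
Definition Fret (w : env) : R := lpgf (flam w) (fmu w) 0 0 0.

Lemma measurable_Fret : measurable_fun setT Fret.
Proof.
apply: (@measurable_fun_cvg _ _ _ setT (fun n w => pgf (flam w) (fmu w) 0 n 0 0)).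
  by move=> n; exact: measurable_pgf.
move=> w _; apply: pgf_cvg => //; [exact: flam_gt0 | exact: fmu_ge0].
Qed.

Lemma pgf_shift w i n k l :
  pgf (flam (reindex_env (fun j => j + i%:Z) w)) (fmu (reindex_env (fun j => j + i%:Z) w)) 0 n k l =
  pgf (flam w) (fmu w) 0 n (k + i) l.
Proof.
elim: n k l => //= n IHn k l.
congr (_ / (_ + _ - _) * _); last by case: l.
by apply: eq_bigr => j _; rewrite IHn.
Qed.

Lemma Fret_shift w k : Fret (reindex_env (fun j => j + k%:Z) w) = lpgf (flam w) (fmu w) 0 k 0.
Proof. by rewrite /Fret /lpgf; under eq_fun do rewrite pgf_shift add0n. Qed.

Lemma Fret_itv w : 0 <= Fret w <= 1.
Proof.
by apply/andP; split; [apply: lpgf_ge0 | apply: lpgf_le1] => //;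
  [exact: flam_gt0 | exact: fmu_ge0 | exact: flam_gt0 | exact: fmu_ge0].
Qed.

Definition escape_mean n (w : env) : R :=
  n.+1%:R^-1 * \sum_(k < n.+1) (1 - Fret (reindex_env (fun j => j + k%:Z) w)).

Lemma measurable_escape k :
  measurable_fun setT (fun w : env => 1 - Fret (reindex_env (fun j => j + k) w)).
Proof.
apply: measurable_funB => //; apply: measurableT_comp; first exact: measurable_Fret.
exact: measurable_reindex_env.
Qed.

Lemma measurable_escape_mean n : measurable_fun setT (escape_mean n).
Proof.
apply: measurable_funM => //; apply: measurable_sum => k.
exact: measurable_escape.
Qed.

(** Translations preserve the law of the environment, so every term of the Cesaro mean has the same
    expectation. *)
Lemma integral_escape_mean n :
  (\int[P]_w (escape_mean n w)%:E = \int[P]_w (1 - Fret w)%:E)%E.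
Proof.
have F0 w : 0 <= 1 - Fret w by rewrite subr_ge0; have /andP[] := Fret_itv w.
have mF : measurable_fun setT (fun w => (1 - Fret w)%:E).
  by apply/measurable_EFinP; apply: measurable_funB => //; exact: measurable_Fret.
rewrite /escape_mean; under eq_integral do rewrite EFinM -sumEFin.
rewrite ge0_integralZl_EFin//; last 2 first.
- by move=> w _; apply: sume_ge0 => k _; rewrite lee_fin.
- apply: emeasurable_sum => k; apply/measurable_EFinP; exact: measurable_escape.
rewrite ge0_integral_sum//; last first.
- by move=> k w _; rewrite lee_fin.
- by move=> k; apply/measurable_EFinP; exact: measurable_escape.
have [r rE] : exists r, (\int[P]_w (1 - Fret w)%:E = r%:E)%E.
  exists (fine (\int[P]_w (1 - Fret w)%:E)); rewrite fineK// ge0_fin_numE; last first.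
    by apply: integral_ge0 => w _; rewrite lee_fin.
  apply: (@le_lt_trans _ _ (\int[P]_w (1%E : \bar R))%E).
    apply: ge0_le_integral => //; first by move=> w _; rewrite lee_fin.
    by move=> w _; rewrite lee_fin lerBlDr lerDl; have /andP[] := Fret_itv w.
  by rewrite integral_cst// mul1e (le_lt_trans (probability_le1 P measurableT))// ltry.
rewrite (eq_bigr (fun=> r%:E)); last first.
  move=> k _; rewrite -rE.
  rewrite (iid_env_integral hiid (sig := fun j => j + k%:Z) (f := fun w => (1 - Fret w)%:E))//.
  exact: addIr.
rewrite sumEFin -EFinM rE sumr_const card_ord -[r *+ _]mulr_natl mulrA mulVf ?mul1r//.
Qed.

End recurrence.

(** * Recurrence from the Lyapunov exponents *)

Section recurrence_theorem.
Variables (K : nat) (R : realType) (P : probability (env K R) R).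
Variable gamma : 'I_K.+1 -> R.
Local Notation env := (env K R).
Hypothesis hiid : iid_env P.
Hypothesis hC3 : condC3 P.
Hypothesis hgamma : lyapunov_exponents P gamma.
Hypothesis hgammaL : gamma ord_max <= 0.

Lemma escape_mean_ge0 n (w : env) : 0 <= escape_mean n w.
Proof.
rewrite mulr_ge0// sumr_ge0// => k _; rewrite subr_ge0.
by have /andP[] := Fret_itv (reindex_env (fun j => j + k%:Z) w).
Qed.

Lemma escape_mean_le1 n (w : env) : escape_mean n w <= 1.
Proof.
rewrite /escape_mean mulrC ler_pdivrMr// mul1r.
apply: (@le_trans _ _ (\sum_(k < n.+1) 1)); last by rewrite sumr_const card_ord.
apply: ler_sum => k _; rewrite lerBlDr lerDl.
by have /andP[] := Fret_itv (reindex_env (fun j => j + k%:Z) w).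
Qed.

Lemma prod_le_expR_sum (n : nat) (f : nat -> R) : (forall j, 0 <= f j) ->
  \prod_(j < n) f j <= expR (- \sum_(j < n) (1 - f j)).
Proof.
move=> f0; rewrite -sumrN expR_sum; apply: ler_prod => j _; rewrite f0 /=.
by have := expR_ge1Dx (- (1 - f j)); rewrite opprB addrC subrK.
Qed.

(* [onem_lpgf_le] gives [1 - f_0 <= (M_0 ... M_(n-1) 1)_1 * \prod_(k < n) f_k].
   If [f_0 < 1], taking logarithms bounds the mean of the [1 - f_k] by
   [ln (s n) / n + O(1 / n)], whose limit is [gamma ord_max <= 0]. *)
Lemma escape_mean_cvg0 (w : env) (s : nat -> 'I_K.+1 -> R) :
  (forall i, 0 < lam w i /\ 0 < mu w i ord_max) ->
  (forall n, singular_values (\prod_(j < n) Mmx w j%:Z) (s n)) ->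
  (fun n => ln (s n ord_max) / n%:R) @ \oo --> gamma ord_max ->
  escape_mean n w @[n --> \oo] --> 0.
Proof.
move=> wpos hs cs.
have l0 k : 0 < flam w k by exact: flam_gt0.
have m0 k l : 0 <= fmu w k l by exact: fmu_ge0.
pose f k := lpgf (flam w) (fmu w) 0 k 0.
have f0 k : 0 <= f k by exact: lpgf_ge0.
have ZE n : escape_mean n w = n.+1%:R^-1 * \sum_(k < n.+1) (1 - f k).
  by congr (_ * _); apply: eq_bigr => k _; rewrite Fret_shift.
have [f1|f1] := eqVneq (f 0%N) 1.
  have fk k : f k = 1.
    elim: k => // k IHk; apply: lpgf_eq1S => //.
    by have [] := wpos k%:Z.
  rewrite (_ : (fun n => _) = (fun=> 0)); first exact: cvg_cst.
  by apply/funext => n; rewrite ZE big1 ?mulr0// => k _; rewrite fk subrr.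
have d0 : 0 < 1 - f 0%N by rewrite subr_gt0 lt_neqAle f1 lpgf_le1.
(* The constant of [row_sum_le_singular] for matrices of size [L]. *)
pose C : R := K.+1%:R ^+ 2.
have C0 : 0 < C by rewrite exprn_gt0.
have key n : (1 - f 0%N) * expR (\sum_(j < n) (1 - f j)) <= C * s n ord_max.
  have h1 := onem_lpgf_le l0 m0 n 0 0.
  have sE : \prod_(j < n) Mmx w j%:Z = \prod_(j < n) companion (flam w) (fmu w) (0 + j).
    apply: eq_bigr => j _; apply/matrixP => a b; rewrite !mxE add0n /flam.
    by have [lj _] := wpos j%:Z; rewrite (gt_eqF lj) addr0.
  have h2 : Mrow (flam w) (fmu w) n 0 0 <= C * s n ord_max.
    rewrite -[0%N in X in X <= _]/(nat_of_ord (@ord0 K)).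
    have := MrowE (flam w) (fmu w) n 0 ord0 => /= <-; rewrite -sE mxE.
    under eq_bigr do rewrite mxE mulr1.
    exact: row_sum_le_singular.
  have h3 : 1 - f 0%N <= expR (- \sum_(j < n) (1 - f j)) * (C * s n ord_max).
    apply: le_trans h1 _; under eq_bigr do rewrite add0n.
    apply: ler_pM => //; [by apply: prodr_ge0 => j _; exact: f0 | exact: Mrow_ge0 |].
    exact: prod_le_expR_sum.
  have := ler_wpM2r (expR_ge0 (\sum_(j < n) (1 - f j))) h3.
  by rewrite mulrAC -expRD addNr expR0 mul1r.
(* Logarithms of the singular values may be taken because the left-hand side of [key] is positive,
   thanks to [f 0 < 1]. *)
have spos n : 0 < s n ord_max.
  rewrite -(pmulr_rgt0 _ C0); apply: lt_le_trans (key n).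
  by rewrite mulr_gt0// expR_gt0.
have ub n : escape_mean n w <= (ln C - ln (1 - f 0%N)) * n.+1%:R^-1 +
     ln (s n.+1 ord_max) / n.+1%:R.
  rewrite ZE mulrC -mulrDl ler_wpM2r//.
  have := key n.+1; rewrite -ler_ln ?posrE ?mulr_gt0 ?expR_gt0//.
  by rewrite !lnM ?posrE ?expR_gt0// expRK; lra.
have cub : (ln C - ln (1 - f 0%N)) * n.+1%:R^-1 + ln (s n.+1 ord_max) / n.+1%:R
    @[n --> \oo] --> gamma ord_max.
  rewrite -[X in _ --> X]add0r; apply: cvgD.
    rewrite -[X in _ --> X](mulr0 (ln C - ln (1 - f 0%N))).
    by apply: cvgM; [exact: cvg_cst | exact: cvg_harmonic].
  by rewrite (cvg_shiftS (fun n => ln (s n ord_max) / n%:R)).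
(* The means are nonnegative, so it suffices that their upper bound is eventually below
   [gamma ord_max + e <= e]. *)
apply/cvgrPdist_lt => e e0.
move/cvgrPdist_lt : cub => /(_ _ e0); apply: filterS => n.
rewrite ltr_norml => /andP[h _]; rewrite sub0r normrN ger0_norm ?escape_mean_ge0//.
apply: le_lt_trans (ub n) _; move: h; set x := (X in gamma ord_max - X) => h.
rewrite -(ltrD2l (- e)) addNr; apply: (lt_le_trans (y := gamma ord_max)) => //.
by rewrite -ltrBrDr.
Qed.

Lemma Fret_eq1_ae : {ae P, forall w, Fret w = 1}.
Proof.
have mZ n : measurable_fun setT (fun w : env => (escape_mean n w)%:E).
  by apply/measurable_EFinP; exact: measurable_escape_mean.
have aecv : {ae P, forall w, setT w -> (escape_mean n w)%:E @[n --> \oo] --> (0 : \bar R)}.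
  have := ae_lam_mu_gt0 hiid hC3; move: hgamma; apply: filterS2 => w [s [hs cs]] wpos _.
  apply/cvg_EFin; first exact: nearW.
  exact: (escape_mean_cvg0 wpos hs (cs ord_max)).
have ig : P.-integrable setT (fun=> 1%E : \bar R).
  exact: (finite_measure_integrable_cst P 1 measurableT).
have dom : {ae P, forall w, forall n : nat, setT w -> (`|(escape_mean n w)%:E| <= 1%E :> \bar R)%E}.
  by apply: aeW => w n _; rewrite gee0_abs lee_fin ?escape_mean_ge0// escape_mean_le1.
have [_ _ cv] := dominated_convergence measurableT mZ (measurable_cst _) aecv ig dom.
have int0 : (\int[P]_w (1 - Fret w)%:E = 0)%E.
  have cv' : (fun=> \int[P]_w (1 - Fret w)%:E)%E @ \oo --> (0 : \bar R)%E.
    have <- : (fun n => \int[P]_w (escape_mean n w)%:E)%E =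
              (fun=> \int[P]_w (1 - Fret w)%:E)%E.
      by apply/funext => n; exact: integral_escape_mean.
    by move: cv; rewrite integral0.
  by rewrite -(cvg_lim _ cv')// lim_cst.
have mF : measurable_fun setT (fun w : env => (1 - Fret w)%:E).
  by apply/measurable_EFinP; apply: measurable_funB => //; exact: measurable_Fret.
have := (ae_eq_integral_abs P measurableT mF).1.
under eq_integral do rewrite gee0_abs ?lee_fin ?subr_ge0 ?(andP (Fret_itv _)).2//.
move=> /(_ int0); apply: filterS => w /(_ I) /= [] /eqP.
by rewrite subr_eq0 => /eqP.
Qed.

(* Only finitely many steps back are compared with the Lyapunov exponents of
   the forward products, hence the reflection of the environment. *)
Lemma recurrent_ae : {ae P, forall w,
  (forall i, 0 < lam w i) /\
  (forall k, lpgf (fun k => lam w (- k%:Z)) (fun k => mu w (- k%:Z)) 0 k 0 = 1)}.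
Proof.
have inj : injective (fun i : int => - i) by exact: oppr_inj.
have H := iid_env_ae hiid inj Fret_eq1_ae.
have H' := iid_env_ae hiid inj (ae_lam_mu_gt0 hiid hC3).
apply: filterS2 H H' => w F1 wpos.
have l0 i : 0 < lam w i by have [] := wpos (- i); rewrite /lam /reindex_env opprK.
split => //.
have <- : flam (reindex_env (fun i => - i) w) = (fun k => lam w (- k%:Z)).
  by apply/funext => k; rewrite /flam (gt_eqF (l0 (- k%:Z))) addr0.
elim=> [|k IHk]; first exact: F1.
apply: lpgf_eq1S => //.
- by move=> *; exact: flam_gt0.
- by move=> *; exact: mu_ge0.
- by have [] := wpos k%:Z.
Qed.

End recurrence_theorem.

(** * Laplace transforms determine laws *)

Section moments.
Context d (S : measurableType d) (R : realType) (Q : probability S R).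
Variable Z : S -> R.
Hypothesis mZ : measurable_fun setT Z.
Hypothesis Z01 : forall s, 0 <= Z s <= 1.

Lemma integrable_pow01 n : Q.-integrable setT (fun s => (Z s ^+ n)%:E).
Proof.
apply: (@le_integrable _ _ _ Q setT measurableT _ (EFin \o cst 1)).
- by apply/measurable_EFinP; exact: measurable_funX.
- move=> s _; have /andP[z0 z1] := Z01 s.
  by rewrite /= !lee_fin normr1 ger0_norm ?exprn_ge0// exprn_ile1.
- exact: finite_measure_integrable_cst.
Qed.

(** The exponential series at [- c * (Z / a) ^+ n] contains only the powers [Z ^+ (n * j)]. As
    [0 <= Z <= 1], its partial sums are dominated by the constant [M], and the series may be
    integrated term by term. *)
Lemma integral_gumbel (c a : R) n : 0 < a ->
  (\sum_(j < J) (((- c) ^+ j / j`!%:R * (a^-1 ^+ (n * j)))%:E *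
      \int[Q]_s (Z s ^+ (n * j))%:E) @[J --> \oo] -->
   \int[Q]_s (expR (- c * (Z s / a) ^+ n))%:E)%E.
Proof.
move=> a0.
pose p J s := \sum_(j < J) (- c * (Z s / a) ^+ n) ^+ j / j`!%:R.
pose M := expR (`|c| * (a^-1 ^+ n)).
have mp J : measurable_fun setT (p J).
  apply: measurable_sum => j; apply: measurable_funM => //.
  apply: measurable_funX; apply: measurable_funM => //.
  by apply: measurable_funX; exact: measurable_funM.
have pE J : (\int[Q]_s (p J s)%:E = \sum_(j < J) (((- c) ^+ j / j`!%:R * (a^-1 ^+ (n * j)))%:E *
      \int[Q]_s (Z s ^+ (n * j))%:E))%E.
  rewrite /p; under eq_integral do rewrite -sumEFin.
  rewrite integral_sum//; last first.
    move=> j; rewrite (_ : (fun s => _) = (fun s => ((- c) ^+ j / j`!%:R * (a^-1 ^+ (n * j)))%:E * (Z s ^+ (n * j))%:E)%E).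
      by apply: integrableZl => //; exact: integrable_pow01.
    apply/funext => s; rewrite -EFinM; congr EFin.
    by rewrite exprMn -exprM expr_div_n exprVn; ring.
  apply: eq_bigr => j _; rewrite -integralZl//; last exact: integrable_pow01.
  apply: eq_integral => s _; rewrite -EFinM; congr EFin.
  by rewrite exprMn -exprM expr_div_n exprVn; ring.
rewrite (_ : (fun J => _) = (fun J => \int[Q]_s (p J s)%:E)%E); last first.
  by apply/funext => J; rewrite pE.
have xle s : `|- c * (Z s / a) ^+ n| <= `|c| * (a^-1 ^+ n).
  have /andP[z0 z1] := Z01 s.
  have ai0 : 0 <= a^-1 by rewrite invr_ge0 ltW.
  have q0 : 0 <= Z s / a by rewrite mulr_ge0.
  rewrite normrM normrN ler_wpM2l// ger0_norm ?exprn_ge0//.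
  by rewrite lerXn2r ?nnegrE// ler_piMl.
apply: (@dominated_cvg _ _ _ Q setT measurableT _ _ (fun=> M%:E)) => //.
- by move=> J; exact/measurable_EFinP.
- move=> s _; apply/cvg_EFin; first exact: nearW.
  have := @is_cvg_series_exp_coeff R (- c * (Z s / a) ^+ n).
  rewrite /expR (_ : series _ = (fun J => p J s)); first exact.
  by apply/funext => J; rewrite /series /= /p big_mkord.
- exact: finite_measure_integrable_cst.
move=> J s _; rewrite abse_EFin lee_fin /p.
apply: le_trans (ler_norm_sum _ _ _) _.
apply: (@le_trans _ _ (series (exp_coeff (`|c| * (a^-1 ^+ n))) J)).
  rewrite /series /= big_mkord; apply: ler_sum => j _.
  by rewrite normrM normrX normfV normr_nat ler_wpM2r// lerXn2r// nnegrE// (le_trans _ (xle s)).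
apply: nondecreasing_cvgn_le; last exact: is_cvg_series_exp_coeff.
apply/nondecreasing_seqP => i; rewrite /series /= big_nat_recr//= lerDl.
by rewrite divr_ge0// exprn_ge0// mulr_ge0// exprn_ge0// invr_ge0 ltW.
Qed.

(* [expR (- c * z ^+ n)] tends to 1, [expR (- c)] or 0 according as [z] is below,
   at or above 1, and its mean is a power series in the moments: letting [c] vary
   recovers the law from the moments without polynomial approximation. *)
Lemma gumbel_cvg (c a : R) : 0 < a -> 0 < c ->
  (\int[Q]_s (expR (- c * (Z s / a) ^+ n))%:E @[n --> \oo] -->
   Q [set s | (Z s < a)%R] + (expR (- c))%:E * Q [set s | Z s = a])%E.
Proof.
move=> a0 c0.
have m1 : measurable [set s | Z s < a].
  by rewrite -[X in measurable X]setTI; apply: measurable_fun_ltr.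
have m2 : measurable [set s | Z s = a].
  by rewrite -[X in measurable X]setTI; exact: mZ (measurable_set1 a).
have -> : (Q [set s | (Z s < a)%R] + (expR (- c))%:E * Q [set s | Z s = a] =
  \int[Q]_s ((\1_[set s | (Z s < a)%R] s)%:E + (expR (- c))%:E * (\1_[set s | Z s = a] s)%:E))%E.
  have mi1 : measurable_fun setT (fun s => (\1_[set s | Z s < a] s)%:E : \bar R).
    by apply/measurable_EFinP; exact: measurable_indic.
  have mi2 : measurable_fun setT (fun s => (\1_[set s | Z s = a] s)%:E : \bar R).
    by apply/measurable_EFinP; exact: measurable_indic.
  have mi3 : measurable_fun setT (fun s => (expR (- c))%:E * (\1_[set s | Z s = a] s)%:E)%E.
    exact: emeasurable_funM.
  have n1 (s : S) : setT s -> (0 <= (\1_[set s | Z s < a] s : R)%:E)%E by rewrite lee_fin.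
  have n2 (s : S) : setT s -> (0 <= (\1_[set s | Z s = a] s : R)%:E)%E by rewrite lee_fin.
  have n3 (s : S) : setT s -> (0 <= (expR (- c))%:E * (\1_[set s | Z s = a] s)%:E)%E.
    by move=> _; rewrite mule_ge0// lee_fin// expR_ge0.
  rewrite (ge0_integralD Q measurableT n1 mi1 n3 mi3).
  rewrite (ge0_integralZl_EFin Q measurableT n2 mi2 (expR_ge0 _)).
  by rewrite !integral_indic// !setIT.
apply: (@dominated_cvg _ _ _ Q setT measurableT _ _ (fun=> 1%:E)) => //.
- move=> n; apply/measurable_EFinP; apply: measurableT_comp => //.
  apply: measurable_funM => //; apply: measurable_funX; exact: measurable_funM.
- move=> s _; rewrite -EFinM -EFinD; apply/cvg_EFin; first exact: nearW.
  have /andP[z0 z1] := Z01 s; rewrite !indicE.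
  have cE : continuous (@expR R) by exact: continuous_expR.
  have [za|za|za] := ltgtP (Z s) a.
  + rewrite (mem_set (A := [set s | Z s < a]) za) (memNset (A := [set s | Z s = a])); last by move=> /= e; rewrite e ltxx in za.
    rewrite /= mulr0 addr0 (_ : true%:R = expR 0 :> R); last by rewrite expR0.
    rewrite -(mulr0 (- c)); apply: continuous_cvg; first exact: cE.
    apply: cvgM; first exact: cvg_cst.
    apply: cvg_expr; rewrite ger0_norm ?divr_ge0 ?(ltW a0)//.
    by rewrite ltr_pdivrMr// mul1r.
  + rewrite (memNset (A := [set s | Z s = a])); last by move=> /= e; rewrite e ltxx in za.
    rewrite (memNset (A := [set s | Z s < a])); last by move=> /= h; rewrite ltNge (ltW za) in h.
    rewrite mulr0 addr0.
    have q1 : 1 < Z s / a by rewrite ltr_pdivlMr// mul1r.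
    have q0 : 0 < Z s / a by exact: lt_trans q1.
    have cv0 : c^-1 * (Z s / a)^-1 ^+ n @[n --> \oo] --> 0.
      rewrite -[X in _ --> X](mulr0 c^-1); apply: cvgM; first exact: cvg_cst.
      by apply: cvg_expr; rewrite ger0_norm ?invr_ge0 ?(ltW q0)// invf_lt1.
    apply: (@squeeze_cvgr _ _ _ _ (fun=> 0) (fun n => c^-1 * (Z s / a)^-1 ^+ n)) => //.
    - apply: nearW => n; rewrite expR_ge0 /= mulNr expRN exprVn -invfM.
      have y0 : 0 < c * (Z s / a) ^+ n by rewrite mulr_gt0// exprn_gt0.
      rewrite lef_pV2 ?posrE ?expR_gt0//.
      by have := expR_ge1Dx (c * (Z s / a) ^+ n); lra.
    - exact: cvg_cst.
  + rewrite (memNset (A := [set s | Z s < a])); last by move=> /=; rewrite za ltxx.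
    rewrite (mem_set (A := [set s | Z s = a]))//= mulr1 add0r za divff ?gt_eqF//.
    by under eq_fun do rewrite expr1n mulr1; exact: cvg_cst.
- exact: finite_measure_integrable_cst.
move=> n s _; have /andP[z0 z1] := Z01 s.
rewrite abse_EFin lee_fin ger0_norm ?expR_ge0//.
by rewrite -expR0 ler_expR mulNr oppr_le0 mulr_ge0 ?(ltW c0)// exprn_ge0// divr_ge0// ltW.
Qed.

End moments.

Lemma moments_determine_lt d (S : measurableType d) d' (S' : measurableType d')
    (R : realType) (Q : probability S R) (Q' : probability S' R)
    (Z : S -> R) (Z' : S' -> R) (a : R) :
  measurable_fun setT Z -> measurable_fun setT Z' ->
  (forall s, 0 <= Z s <= 1) -> (forall s, 0 <= Z' s <= 1) ->
  (forall n, \int[Q]_s (Z s ^+ n)%:E = \int[Q']_s (Z' s ^+ n)%:E)%E ->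
  0 < a -> Q [set s | Z s < a] = Q' [set s | Z' s < a].
Proof.
move=> mZ mZ' Z01 Z01' H a0.
have I c n : (\int[Q]_s (expR (- c * (Z s / a) ^+ n))%:E =
              \int[Q']_s (expR (- c * (Z' s / a) ^+ n))%:E)%E.
  have h1 := @integral_gumbel _ _ _ Q Z mZ Z01 c a n a0.
  have h2 := @integral_gumbel _ _ _ Q' Z' mZ' Z01' c a n a0.
  rewrite -(cvg_lim _ h1)// -(cvg_lim _ h2)//; congr (limn _).
  by apply/funext => J; apply: eq_bigr => j _; rewrite H.
have L c : 0 < c -> (Q [set s | (Z s < a)%R] + (expR (- c))%:E * Q [set s | Z s = a] =
   Q' [set s | (Z' s < a)%R] + (expR (- c))%:E * Q' [set s | Z' s = a])%E.
  move=> c0; have h1 := gumbel_cvg (Q:=Q) mZ Z01 a0 c0.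
  have h2 := gumbel_cvg (Q:=Q') mZ' Z01' a0 c0.
  rewrite -(cvg_lim _ h1)// -(cvg_lim _ h2)//; congr (limn _).
  by apply/funext => n; rewrite I.
have m1 : measurable [set s | Z s < a].
  by rewrite -[X in measurable X]setTI; apply: measurable_fun_ltr.
have m2 : measurable [set s | Z s = a].
  by rewrite -[X in measurable X]setTI; exact: mZ (measurable_set1 a).
have m1' : measurable [set s | Z' s < a].
  by rewrite -[X in measurable X]setTI; apply: measurable_fun_ltr.
have m2' : measurable [set s | Z' s = a].
  by rewrite -[X in measurable X]setTI; exact: mZ' (measurable_set1 a).
have fin e (T : measurableType e) (P : probability T R) A : measurable A ->
    exists r, P A = r%:E.
  by move=> mA; exists (fine (P A)); rewrite fineK// fin_num_measure.
have [p pE] := fin _ _ Q _ m1; have [r rE] := fin _ _ Q _ m2.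
have [p' pE'] := fin _ _ Q' _ m1'; have [r' rE'] := fin _ _ Q' _ m2'.
(* Two values of [c] give two linear relations between the masses below and at [a]; their
   coefficients [expR (- 1)] and [expR (- 2)] differ, which separates the two masses. *)
have := L 1 ltr01; have := L 2 (ltr0n _ 2); rewrite pE pE' rE rE' => -[e2] [e1].
have lt12 : expR (- 2) < expR (- 1) :> R by rewrite ltr_expR ltrN2 ltr1n.
congr EFin.
have : (expR (- 1) - expR (- 2)) * (r - r') = 0 by lra.
move/eqP; rewrite mulf_eq0 gt_eqF ?subr_gt0//= subr_eq0 => /eqP er.
by move: e1; rewrite er => /addIr.
Qed.

(** The transforms at positive integers are the moments of [Z = expR (- X)], and for [t >= 0] the
    event [t < X] is [Z < expR (- t)]. So [moments_determine_lt] gives all the tails, and half-lines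
    generate the Borel sets. *)
Lemma laplace_determines_law d (S : measurableType d) d' (S' : measurableType d')
    (R : realType) (Q : probability S R) (Q' : probability S' R)
    (X : S -> \bar R) (X' : S' -> \bar R) :
  measurable_fun setT X -> measurable_fun setT X' ->
  {ae Q, forall s, (0 <= X s < +oo)%E} -> {ae Q', forall s, (0 <= X' s < +oo)%E} ->
  (forall n, \int[Q]_s (expR (- (n.+1%:R * fine (X s))))%:E =
             \int[Q']_s (expR (- (n.+1%:R * fine (X' s))))%:E)%E ->
  forall B : set (\bar R), measurable B -> Q (X @^-1` B) = Q' (X' @^-1` B).
Proof.
move=> mX mX' X0 X0' H.
(* The absolute value keeps [Z] in [[0, 1]] on the null set where [X] may be negative. *)
pose Z s := expR (- `|fine (X s)|); pose Z' s := expR (- `|fine (X' s)|).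
have mfine e (T : measurableType e) (Y : T -> \bar R) : measurable_fun setT Y ->
    measurable_fun setT (fun s => fine (Y s)).
  by move=> mY; apply: measurableT_comp.
have mZ_ e (T : measurableType e) (Y : T -> \bar R) : measurable_fun setT Y ->
    measurable_fun setT (fun s => expR (- `|fine (Y s)|)).
  move=> mY; apply: measurableT_comp => //; apply: measurableT_comp => //.
  by apply: measurableT_comp => //; exact: mfine.
have mE e (T : measurableType e) (Y : T -> \bar R) n : measurable_fun setT Y ->
    measurable_fun setT (fun s => (expR (- (n%:R * fine (Y s))))%:E).
  move=> mY; apply/measurable_EFinP; apply: measurableT_comp => //.
  by apply: measurableT_comp => //; apply: measurable_funM => //; exact: mfine.
have mom e (T : measurableType e) (P : probability T R) (Y : T -> \bar R) n :
    measurable_fun setT Y -> {ae P, forall s, (0 <= Y s < +oo)%E} ->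
    (\int[P]_s (expR (- `|fine (Y s)|) ^+ n.+1)%:E =
     \int[P]_s (expR (- (n.+1%:R * fine (Y s))))%:E)%E.
  move=> mY Y0.
  have h : ae_eq P setT (fun s => (expR (- `|fine (Y s)|) ^+ n.+1)%:E)
                        (fun s => (expR (- (n.+1%:R * fine (Y s))))%:E).
    apply: filterS Y0 => s /andP[y0 _] _.
    by rewrite -expRM_natl ger0_norm ?fine_ge0// mulrN.
  apply: ge0_ae_eq_integral => //.
  - by apply/measurable_EFinP; apply: measurable_funX; exact: mZ_.
  - exact: mE.
have Z01 e (T : measurableType e) (Y : T -> \bar R) s : 0 <= expR (- `|fine (Y s)|) <= 1.
  by rewrite expR_ge0 /= -expR0 ler_expR oppr_le0.
have lt_eq a : 0 < a -> Q [set s | Z s < a] = Q' [set s | Z' s < a].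
  move=> a0; apply: moments_determine_lt => //; try exact: mZ_; try exact: Z01.
  case=> [|n]; last by rewrite !mom.
  have one e (T : measurableType e) (P : probability T R) (Y : T -> R) :
      (\int[P]_s (Y s ^+ 0)%:E = 1)%E.
    by under eq_integral do rewrite expr0; rewrite integral_cst// mul1e; exact: probability_setT.
  by rewrite !one.
have aeE e (T : measurableType e) (P : probability T R) (A B : set T) :
    measurable A -> measurable B -> {ae P, forall s, A s <-> B s} -> P A = P B.
  move=> mA mB h; rewrite -(setIT A) -(setIT B) -!integral_indic//.
  have h' : ae_eq P setT (fun s => (\1_A s)%:E : \bar R) (fun s => (\1_B s)%:E).
    apply: filterS h => s h _; rewrite !indicE.
    suff -> : (s \in A) = (s \in B) by [].
    by apply/idP/idP; rewrite !inE => /h.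
  apply: ge0_ae_eq_integral => //.
  - by apply/measurable_EFinP; exact: measurable_indic.
  - by apply/measurable_EFinP; exact: measurable_indic.
have gt_eq t : Q [set s | t < fine (X s)] = Q' [set s | t < fine (X' s)].
  have mgt e (T : measurableType e) (Y : T -> \bar R) : measurable_fun setT Y ->
      measurable [set s | t < fine (Y s)].
    move=> mY; rewrite -[X in measurable X]setTI; apply: measurable_fun_ltr => //.
    exact: mfine.
  have [t0|t0] := ltP t 0.
    have one e (T : measurableType e) (P : probability T R) (Y : T -> \bar R) :
        measurable_fun setT Y -> {ae P, forall s, (0 <= Y s < +oo)%E} ->
        P [set s | t < fine (Y s)] = 1%E.
      move=> mY Y0; rewrite -(probability_setT P); apply: aeE => //; first exact: mgt.
      apply: filterS Y0 => s /andP[y0 _]; split => // _ /=.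
      by apply: lt_le_trans t0 _; exact: fine_ge0.
    by rewrite !one.
  have red e (T : measurableType e) (P : probability T R) (Y : T -> \bar R) :
      measurable_fun setT Y -> {ae P, forall s, (0 <= Y s < +oo)%E} ->
      P [set s | t < fine (Y s)] = P [set s | expR (- `|fine (Y s)|) < expR (- t)].
    move=> mY Y0; apply: aeE; first exact: mgt.
      by rewrite -[X in measurable X]setTI; apply: measurable_fun_ltr => //; exact: mZ_.
    apply: filterS Y0 => s /andP[y0 _] /=.
    by rewrite ltr_expR ltrN2 ger0_norm ?fine_ge0.
  by rewrite !red//; exact: lt_eq (expR_gt0 _).
have real_eq (B : set R) : measurable B ->
    Q ((fun s => fine (X s)) @^-1` B) = Q' ((fun s => fine (X' s)) @^-1` B).
  move=> mB; have m1 := mfine _ _ _ mX; have m2 := mfine _ _ _ mX'.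
  pose nu := [the measure _ _ of pushforward Q (fun s => fine (X s))] : {measure set R -> \bar R}.
  pose nu' := [the measure _ _ of pushforward Q' (fun s => fine (X' s))] : {measure set R -> \bar R}.
  apply: (@measure_unique _ _ _ (@RGenOInfty.G R) (fun n => `]- n%:R, +oo[%classic)
    (RGenOInfty.measurableE R) _ _ _ (nu m1) (nu' m2) _ _ B mB).
  - move=> _ _ [x ->] [y ->]; exists (Num.max x y).
    apply/seteqP; split => z /=; rewrite !in_itv/= !andbT gt_max.
      by move=> [-> ->].
    by move=> /andP.
  - by move=> n; exists (- n%:R).
  - apply/seteqP; split => // x _; exists (Num.truncn `|x|).+1 => //=.
    rewrite in_itv/= andbT ltrNl; apply: le_lt_trans (ler_norm _) _.
    by rewrite normrN truncnS_gt.
  - move=> _ [x ->]; rewrite /nu /nu' /= /pushforward.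
    rewrite (_ : _ @^-1` _ = [set s | x < fine (X s)]); last first.
      by apply/seteqP; split => s /=; rewrite in_itv/= andbT.
    rewrite gt_eq; congr (Q' _).
    by apply/seteqP; split => s /=; rewrite in_itv/= andbT.
  - move=> n; rewrite /nu /= /pushforward (le_lt_trans (probability_le1 _ _)) ?ltry//.
    by rewrite -[X in measurable X]setTI; exact: m1.
move=> B mB.
have mEB : measurable (EFin @^-1` B).
  by rewrite -[X in measurable X]setTI; exact: EFin_measurable.
have red e (T : measurableType e) (P : probability T R) (Y : T -> \bar R) :
    measurable_fun setT Y -> {ae P, forall s, (0 <= Y s < +oo)%E} ->
    P (Y @^-1` B) = P ((fun s => fine (Y s)) @^-1` (EFin @^-1` B)).
  move=> mY Y0; apply: aeE.
  - by rewrite -[X in measurable X]setTI; exact: mY.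
  - by rewrite -[X in measurable X]setTI; exact: mfine.
  apply: filterS Y0 => s /andP[y0 y1] /=.
  by rewrite fineK// ge0_fin_numE.
by rewrite (red _ _ Q X)// (red _ _ Q' X')//; exact: real_eq.
Qed.

(** * The branching process *)

Section esum_complements.
Context {R : realType}.

Lemma esumZl (T : choiceType) (I : set T) (c : R) (a : T -> \bar R) :
  0 <= c -> (forall i, (0 <= a i)%E) ->
  (\esum_(i in I) (c%:E * a i) = c%:E * \esum_(i in I) a i)%E.
Proof.
move=> c0 a0; rewrite /esum -ereal_supZl//; last first.
  by apply/set0P; exists 0%E; exists set0; [exact: fsets_set0 | rewrite fsbig_set0].
congr ereal_sup; apply/seteqP; split => x /=.
  move=> [A hA <-]; exists (\sum_(i \in A) a i)%E; first by exists A.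
  by rewrite ge0_mule_fsumr.
by move=> [_ [A hA <-] <-]; exists A => //; rewrite ge0_mule_fsumr.
Qed.

Lemma esum_fiber (T T' : choiceType) (f : T' -> T) (a : T' -> \bar R) :
  (forall z, (0 <= a z)%E) ->
  (\esum_(t in [set: T]) \esum_(z in [set z | f z = t]) a z =
   \esum_(z in [set: T']) a z)%E.
Proof.
move=> a0; rewrite esum_esum//.
rewrite (reindex_esum [set: T'] _ (fun z => (f z, z)))//; split => //=.
- by move=> x y _ _ [].
- by move=> [t z] /= [_ h]; exists z => //; rewrite h.
Qed.

Lemma esum_ffun_prod (X : finType) (T : choiceType) (t0 : T)
    (a : X -> T -> R) (A : X -> R) :
  (forall x t, 0 <= a x t) ->
  (forall x, \esum_(t in [set: T]) (a x t)%:E = (A x)%:E)%E ->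
  (\esum_(z in [set: {ffun X -> T}]) (\prod_x a x (z x))%:E = (\prod_x A x)%:E)%E.
Proof.
move=> a0 hA.
have A0 x : 0 <= A x by rewrite -lee_fin -hA; apply: esum_ge0 => t _; rewrite lee_fin.
(* Distributivity, one index at a time: functions are free on [s] and pinned to [t0] elsewhere, and
   adding [x] to [s] amounts to choosing one more value at [x]. *)
suff H (s : seq X) : uniq s ->
  (\esum_(z in [set z : {ffun X -> T} | forall x, x \notin s -> z x = t0])
      (\prod_(x <- s) a x (z x))%:E = (\prod_(x <- s) A x)%:E)%E.
  rewrite -(H (index_enum X) (index_enum_uniq X)); congr (esum _ _).
  by apply/seteqP; split => // z _ x; rewrite mem_index_enum.
elim: s => [_|x s IHs /= /andP[xs us]].
  rewrite (_ : [set z | _] = [set [ffun=> t0]]).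
    by rewrite esum_set1 !big_nil ?lee_fin // ler01.
  apply/seteqP; split => z /=; first by move=> h; apply/ffunP => x; rewrite ffunE h.
  by move=> -> x _; rewrite ffunE.
pose E (s : seq X) := [set z : {ffun X -> T} | forall x, x \notin s -> z x = t0].
pose e (p : T * {ffun X -> T}) : {ffun X -> T} :=
  [ffun y => if y == x then p.1 else p.2 y].
rewrite (reindex_esum ([set: T] `*`` (fun=> E s)) _ e); last first.
  split.
  - move=> [t z] /= [_ Ez] y; rewrite inE negb_or => /andP[yx ys].
    by rewrite ffunE (negbTE yx) Ez.
  - move=> [t z] [t' z'] /=; rewrite !inE /= => -[_ Ez] [_ Ez'] /ffunP h.
    have := h x; rewrite !ffunE eqxx /= => ->; congr (_, _).
    apply/ffunP => y; have [->|yx] := eqVneq y x; first by rewrite Ez// Ez'.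
    by have := h y; rewrite !ffunE (negbTE yx).
  - move=> z /= Ez; exists (z x, [ffun y => if y == x then t0 else z y]) => /=.
      split => // y ys; rewrite ffunE; case: ifPn => // yx.
      by apply: Ez; rewrite inE negb_or yx.
    by apply/ffunP => y; rewrite !ffunE; case: eqP => [->|yx].
transitivity (\esum_(k in [set: T] `*`` (fun=> E s))
    ((a x k.1)%:E * (\prod_(y <- s) a y (k.2 y))%:E))%E.
  apply: eq_esum => -[t z] _; rewrite -EFinM big_cons ffunE eqxx; congr (_ * _)%:E.
  rewrite big_seq [RHS]big_seq; apply: eq_bigr => y ys.
  by rewrite ffunE ifN//; apply: contraNneq xs => <-.
have p0 z : (0 <= (\prod_(y <- s) a y (z y))%:E :> \bar R)%E.
  by rewrite lee_fin prodr_ge0.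
rewrite -(@esum_esum _ _ _ [set: T] (fun=> E s) (fun t z => (a x t)%:E * (\prod_(y <- s) a y (z y))%:E)%E); last first.
  by move=> t z _ _; rewrite mule_ge0// lee_fin.
under eq_esum do rewrite esumZl// IHs// muleC.
rewrite esumZl ?prodr_ge0//; last by move=> t; rewrite lee_fin.
by rewrite hA -EFinM big_cons mulrC.
Qed.

End esum_complements.

(** * Generating functions of the offspring laws *)

Section negative_multinomial.
Context {R : realType}.
Variables (L : nat) (a : 'I_L -> R).
Hypothesis a_ge0 : forall j, 0 <= a j.

Definition multinomial_weight (u : {ffun 'I_L -> nat}) : R :=
  ((\sum_j u j)%N`!)%:R / (\prod_j (u j)`!)%N%:R * \prod_j a j ^+ u j.

Lemma multinomial_weight_ge0 u : 0 <= multinomial_weight u.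
Proof. by rewrite mulr_ge0// prodr_ge0// => j _; rewrite exprn_ge0. Qed.

Let incr (j : 'I_L) (u : {ffun 'I_L -> nat}) : {ffun 'I_L -> nat} :=
  [ffun k => (u k + (k == j))%N].

Lemma multinomial_weight_incr j u :
  multinomial_weight (incr j u) * (u j).+1%:R =
  a j * multinomial_weight u * (\sum_k u k).+1%:R.
Proof.
have sE : (\sum_k incr j u k = (\sum_k u k).+1)%N.
  under eq_bigr do rewrite ffunE.
  by rewrite big_split /= -big_mkcond /= big_pred1_eq addn1.
have fE : (\prod_k (incr j u k)`! = (u j).+1 * \prod_k (u k)`!)%N.
  rewrite (bigD1 j)//= ffunE eqxx addn1 factS -mulnA; congr (_ * _)%N.
  rewrite [in RHS](bigD1 j)//=; congr (_ * _)%N.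
  by apply: eq_bigr => k kj; rewrite ffunE (negbTE kj) addn0.
have pE : \prod_k a k ^+ incr j u k = a j * \prod_k a k ^+ u k.
  rewrite (bigD1 j)//= ffunE eqxx addn1 exprS -mulrA; congr (_ * _).
  rewrite [in RHS](bigD1 j)//=; congr (_ * _).
  by apply: eq_bigr => k kj; rewrite ffunE (negbTE kj) addn0.
rewrite /multinomial_weight sE fE pE factS !natrM.
have d0 : (\prod_k (u k)`!)%N%:R != 0 :> R.
  by rewrite pnatr_eq0 -lt0n prodn_gt0// => k; exact: fact_gt0.
have j0 : (u j).+1%:R != 0 :> R by rewrite pnatr_eq0.
move: (_%:R) d0 (_.+1%:R) j0 => D d0 y j0; field.
by rewrite d0 j0.
Qed.

Let A := \sum_j a j.

Let slice N := [set u : {ffun 'I_L -> nat} | (\sum_k u k)%N = N].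

(** The multinomial theorem by induction. On vectors of size [N.+1] the shares [u j / N.+1] add up
    to 1; the share of [j] lives on the vectors [incr j u] with [u] of size [N], where the factor
    [u j / N.+1] cancels the change of the coefficient. *)
Lemma esum_multinomial_slice N :
  (\esum_(u in slice N) (multinomial_weight u)%:E = (A ^+ N)%:E)%E.
Proof.
elim: N => [|N IHN].
  rewrite (_ : slice 0 = [set [ffun=> 0%N]]).
    rewrite esum_set1 ?lee_fin ?multinomial_weight_ge0//.
    rewrite /multinomial_weight big1; last by move=> j _; rewrite ffunE.
    rewrite big1; last by move=> j _; rewrite ffunE.
    by rewrite big1 ?divr1 ?mulr1// => j _; rewrite ffunE.
  apply/seteqP; split => u /=.
    move=> /eqP; rewrite sum_nat_eq0 => /forallP h; apply/ffunP => j.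
    by have := h j; rewrite ffunE => /eqP.
  by move=> ->; rewrite /slice /= big1// => j _; rewrite ffunE.
have split_u u : slice N.+1 u -> (multinomial_weight u)%:E =
  (\sum_j (multinomial_weight u * (u j)%:R / N.+1%:R)%:E)%E.
  move=> su; rewrite sumEFin; congr EFin; rewrite -mulr_suml -mulr_sumr.
  by rewrite -natr_sum su mulfK// pnatr_eq0.
rewrite (eq_esum split_u) esum_sum; last first.
  by move=> u j _ _; rewrite lee_fin divr_ge0// mulr_ge0// multinomial_weight_ge0.
have one j : (\esum_(u in slice N.+1) (multinomial_weight u * (u j)%:R / N.+1%:R)%:E =
   (a j * A ^+ N)%:E)%E.
  rewrite (esumID [set u : {ffun 'I_L -> nat} | (0 < u j)%N]); last first.
    by move=> u _; rewrite lee_fin divr_ge0// mulr_ge0// multinomial_weight_ge0.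
  rewrite [X in (_ + X)%E]esum1 ?adde0; last first.
    by move=> u [_ /negP]; rewrite -eqn0Ngt => /eqP ->; rewrite mulr0 mul0r.
  rewrite (reindex_esum (slice N) _ (incr j)); last first.
    split.
    - move=> u /= su; split; last by rewrite /= ffunE eqxx addn1.
      rewrite /slice /=; under eq_bigr do rewrite ffunE.
      by rewrite big_split /= -big_mkcond /= big_pred1_eq su addn1.
    - move=> u v _ _ /ffunP h; apply/ffunP => k; have := h k; rewrite !ffunE.
      by move/addIn.
    - move=> u /= [su uj]; exists [ffun k => (u k - (k == j))%N] => /=.
        rewrite /slice /=; apply: succn_inj; rewrite -su [RHS](bigD1 j)//=.
        rewrite (bigD1 j)//= ffunE eqxx subn1 -addSn prednK//; congr (_ + _)%N.
        by apply: eq_bigr => k kj; rewrite ffunE (negbTE kj) subn0.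
      apply/ffunP => k; rewrite !ffunE; case: eqP => [->|_]; last by rewrite subn0 addn0.
      by rewrite subnK.
  transitivity (\esum_(u in slice N) ((a j)%:E * (multinomial_weight u)%:E))%E.
    apply: eq_esum => u su; rewrite -EFinM; congr EFin.
    rewrite [incr j u j]ffunE eqxx addn1 multinomial_weight_incr su.
    by rewrite mulfK// pnatr_eq0.
  rewrite esumZl//; last by move=> u; rewrite lee_fin multinomial_weight_ge0.
  by rewrite IHN.
under eq_bigr do rewrite one.
by rewrite sumEFin -mulr_suml exprS.
Qed.

Lemma esum_multinomial_weight : A < 1 ->
  (\esum_(u in [set: {ffun 'I_L -> nat}]) (multinomial_weight u)%:E =
   ((1 - A)^-1)%:E)%E.
Proof.
move=> A1; have A0 : 0 <= A by rewrite sumr_ge0.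
have -> : [set: {ffun 'I_L -> nat}] = \bigcup_(N in [set: nat]) slice N.
  by apply/seteqP; split => // u _; exists (\sum_k u k)%N.
rewrite esum_bigcupT; last 2 first.
- by apply/trivIsetP => i j _ _ ij; apply/seteqP; split => // u [/= h1 h2];
    move: ij; rewrite -h1 -h2 eqxx.
- by move=> u; rewrite lee_fin multinomial_weight_ge0.
under eq_esum do rewrite esum_multinomial_slice.
rewrite -nneseries_esumT; last by move=> N; rewrite lee_fin exprn_ge0.
apply/cvg_lim => //.
rewrite (_ : (fun n => _) = EFin \o series (geometric 1 A)); last first.
  by apply/funext => n /=; rewrite sumEFin; congr EFin; apply: eq_bigr => i _; rewrite /= mul1r.
apply/cvg_EFin; first exact: nearW.
by rewrite -[X in _ --> X]mul1r; apply: cvg_geometric_series; rewrite ger0_norm.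
Qed.

End negative_multinomial.

Section offspring_generating_function.
Variables (K : nat) (R : realType) (w : env K R) (i : int).
Hypothesis lam_gt0 : 0 < lam w i.

Let mu0 l : 0 <= mu w i l. Proof. by rewrite /mu. Qed.

Lemma rate_gt0 : 0 < rate w i.
Proof. by rewrite ltr_pwDl// sumr_ge0. Qed.

Lemma offspring_ge0 m v : 0 <= offspring w i m v.
Proof.
rewrite /offspring; case: ifP => // _; rewrite /multinomial_geometric.
rewrite mulr_ge0 ?divr_ge0 ?(ltW lam_gt0) ?(ltW rate_gt0)// mulr_ge0//.
by rewrite prodr_ge0// => j _; rewrite exprn_ge0// divr_ge0// ltW// rate_gt0.
Qed.

Lemma prod_pred_type (m : 'I_K.+1) (x : nat -> R) :
  \prod_(j < K.+1) x j ^+ (j.+1 == m :> nat) = if (m : nat) is l.+1 then x l else 1.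
Proof.
case: m => -[|l] lK /=; first by rewrite big1// => j _; rewrite expr0.
rewrite (bigD1 (Ordinal (ltnW lK)))//= eqxx expr1 big1 ?mulr1// => j jl.
rewrite eqSS (_ : (j == l :> nat) = false) ?expr0//.
by apply: contraNF jl => /eqP jl; apply/eqP/val_inj.
Qed.

(** The possible offspring are [u + e], with [e] the sure child of a type [m >= 2], which
    contributes the factor [x l]. The part [u] is negative multinomial and its series is geometric,
    convergent because [lam > 0] makes [\sum_j a j < 1]. *)
Lemma offspring_gf (m : 'I_K.+1) (x : nat -> R) : (forall j, 0 <= x j <= 1) ->
  (\esum_(v in [set: {ffun 'I_K.+1 -> nat}])
      (offspring w i m v * \prod_(j < K.+1) x j ^+ v j)%:E =
   (lam w i / rate w i / (1 - \sum_(j < K.+1) mu w i j / rate w i * x j) *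
     (if (m : nat) is l.+1 then x l else 1))%:E)%E.
Proof.
move=> x01; have x0 j : 0 <= x j by have /andP[] := x01 j.
have x1 j : x j <= 1 by have /andP[] := x01 j.
have r0 := rate_gt0.
pose e := fun j : 'I_K.+1 => (j.+1 == m :> nat) : nat.
pose a j := mu w i j / rate w i * x j.
have a0 j : 0 <= a j by rewrite mulr_ge0// divr_ge0// ltW.
have A1 : \sum_j a j < 1.
  apply: (@le_lt_trans _ _ (\sum_j mu w i j / rate w i)).
    by apply: ler_sum => j _; rewrite ler_piMr// divr_ge0// ltW.
  by rewrite -mulr_suml ltr_pdivrMr// mul1r /rate ltrDr.
have nn v : (0 <= (offspring w i m v * \prod_(j < K.+1) x j ^+ v j)%:E)%E.
  by rewrite lee_fin mulr_ge0 ?offspring_ge0// prodr_ge0// => j _; rewrite exprn_ge0.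
rewrite (esumID [set v : {ffun 'I_K.+1 -> nat} | forall j, (e j <= v j)%N])//.
rewrite [X in (_ + X)%E]esum1 ?adde0; last first.
  move=> v [_ /= h]; rewrite /offspring ifF ?mul0r//.
  by apply/negP => /forallP h'; apply: h.
rewrite setTI (reindex_esum [set: {ffun 'I_K.+1 -> nat}] _ (fun u => [ffun j => (u j + e j)%N])); last first.
  split.
  - by move=> u _ j; rewrite ffunE leq_addl.
  - move=> u v _ _ /ffunP h; apply/ffunP => k; have := h k; rewrite !ffunE.
    by move/addIn.
  - move=> v /= h; exists [ffun j => (v j - e j)%N] => //.
    by apply/ffunP => j; rewrite !ffunE subnK.
pose E : R := if (m : nat) is l.+1 then x l else 1.
have eE : \prod_(j < K.+1) x j ^+ e j = E.
  exact: prod_pred_type.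
have E0 : 0 <= E by rewrite /E; case: (nat_of_ord m).
transitivity (\esum_(u in [set: {ffun 'I_K.+1 -> nat}])
   ((lam w i / rate w i * E)%:E * (multinomial_weight a u)%:E))%E.
  apply: eq_esum => u _; rewrite -EFinM; congr EFin.
  rewrite /offspring ifT; last by apply/forallP => j; rewrite ffunE leq_addl.
  have -> : [ffun j => ([ffun j0 => (u j0 + e j0)%N] j - e j)%N] = u.
    by apply/ffunP => j; rewrite !ffunE addnK.
  have -> : \prod_(j < K.+1) x j ^+ [ffun j0 => (u j0 + e j0)%N] j = (\prod_(j < K.+1) x j ^+ u j) * E.
    by rewrite -eE -big_split; apply: eq_bigr => j _; rewrite ffunE exprD.
  rewrite /multinomial_weight; have -> : \prod_j a j ^+ u j = (\prod_j (mu w i j / rate w i) ^+ u j) * \prod_(j < K.+1) x j ^+ u j.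
    by rewrite -big_split; apply: eq_bigr => j _; rewrite exprMn.
  rewrite /multinomial_geometric; ring.
rewrite esumZl; last 2 first.
- by rewrite mulr_ge0// divr_ge0// ltW.
- by move=> u; rewrite lee_fin multinomial_weight_ge0.
rewrite esum_multinomial_weight// -EFinM; congr EFin.
by rewrite mulrAC.
Qed.

Lemma branching_step_ge0 u v : (0 <= branching_step w i u v)%E.
Proof.
apply: esum_ge0 => z _; rewrite lee_fin prodr_ge0// => x _.
exact: offspring_ge0.
Qed.

(** Summing over the total [v], then over the offspring families [z] with that total, is summing
    over all families; that sum factorizes over the individuals. *)
Lemma branching_step_gf (u : {ffun 'I_K.+1 -> nat}) (x : nat -> R) :
  (forall j, 0 <= x j <= 1) ->
  (\esum_(v in [set: {ffun 'I_K.+1 -> nat}])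
      (branching_step w i u v * (\prod_(j < K.+1) x j ^+ v j)%:E) =
   (\prod_(m < K.+1) (lam w i / rate w i / (1 - \sum_(j < K.+1) mu w i j / rate w i * x j) *
     (if (m : nat) is l.+1 then x l else 1)) ^+ u m)%:E)%E.
Proof.
move=> x01; have x0 j : 0 <= x j by have /andP[] := x01 j.
pose X := {m : 'I_K.+1 & 'I_(u m)}.
pose F (z : {ffun X -> {ffun 'I_K.+1 -> nat}}) : {ffun 'I_K.+1 -> nat} :=
  [ffun j => (\sum_x z x j)%N].
pose A (m : 'I_K.+1) := lam w i / rate w i / (1 - \sum_(j < K.+1) mu w i j / rate w i * x j) *
     (if (m : nat) is l.+1 then x l else 1).
pose c (y : X) v := offspring w i (tag y) v * \prod_(j < K.+1) x j ^+ v j.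
have c0 y v : 0 <= c y v.
  by rewrite mulr_ge0 ?offspring_ge0// prodr_ge0// => j _; rewrite exprn_ge0.
transitivity (\esum_(v in [set: {ffun 'I_K.+1 -> nat}]) \esum_(z in [set z | F z = v])
    (\prod_y c y (z y))%:E)%E.
  apply: eq_esum => v _; rewrite muleC /branching_step -esumZl; last 2 first.
  - by rewrite prodr_ge0// => j _; rewrite exprn_ge0.
  - by move=> z; rewrite lee_fin prodr_ge0// => y _; exact: offspring_ge0.
  rewrite (_ : [set z | F z = v] = [set z : {ffun X -> {ffun 'I_K.+1 -> nat}} | forall j, (\sum_x z x j)%N = v j]).
    apply: eq_esum => z /= zv; rewrite -EFinM; congr EFin.
    rewrite /c big_split /= mulrC; congr (_ * _).
    rewrite exchange_big /=; apply: eq_bigr => j _.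
    by rewrite -zv prodrXr.
  apply/seteqP; split => z /=; first by move=> <- j; rewrite ffunE.
  by move=> h; apply/ffunP => j; rewrite ffunE.
rewrite (esum_fiber F); last by move=> z; rewrite lee_fin prodr_ge0.
rewrite (@esum_ffun_prod _ X _ [ffun=> 0%N] c (fun y => A (tag y)))//; last first.
  by move=> y; exact: offspring_gf.
congr EFin; transitivity (\prod_(m < K.+1) \prod_(k < u m) A m); last first.
  by apply: eq_bigr => m _; rewrite prodr_const card_ord.
by rewrite sig_big_dep.
Qed.

(** Here the branching process meets the recursion of [pgf]. The exponent counts the clocks of site
    [- k]: one per individual of type 1 and one per child, each with Laplace factor [z]. The [z] of
    the children is absorbed in the arguments [x j] of the offspring generating function. A type 1
    individual gets one more [z] from [u ord0], a type [m >= 2] individual gets it from its sure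
    child, so that both produce the same factor [pgf b n.+1 k 0]. *)
Lemma pgf_branching_step (la : nat -> R) (mu' : nat -> 'I_K.+1 -> R) (b : R) n k
    (u : {ffun 'I_K.+1 -> nat}) : 0 <= b ->
  (forall k, 0 < la k) -> (forall k l, 0 <= mu' k l) ->
  lam w i = la k -> mu w i = mu' k ->
  (\esum_(v in [set: {ffun 'I_K.+1 -> nat}])
      (branching_step w i u v *
        ((rate w i / (rate w i + b)) ^+ (u ord0 + \sum_j v j) *
         \prod_(j < K.+1) pgf la mu' b n k.+1 j ^+ v j)%:E) =
   (\prod_(j < K.+1) pgf la mu' b n.+1 k j ^+ u j)%:E)%E.
Proof.
move=> b0 la0 mu'0 lE mE.
have r0 := rate_gt0.
have rE : rate w i = srate la mu' k by rewrite /rate lE mE.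
set z := rate w i / (rate w i + b).
have rb0 : 0 < rate w i + b by rewrite ltr_pwDl.
have z0 : 0 <= z by rewrite divr_ge0// ltW.
have z1 : z <= 1 by rewrite ler_pdivrMr// mul1r lerDl.
pose x j := z * pgf la mu' b n k.+1 j.
have x01 j : 0 <= x j <= 1.
  by rewrite mulr_ge0 ?pgf_ge0//= mulr_ile1 ?pgf_ge0 ?pgf_le1.
transitivity (\esum_(v in [set: {ffun 'I_K.+1 -> nat}])
   ((z ^+ u ord0)%:E * (branching_step w i u v * (\prod_(j < K.+1) x j ^+ v j)%:E)))%E.
  apply: eq_esum => v _; rewrite muleCA -EFinM; congr (_ * _%:E)%E.
  rewrite exprD -mulrA; congr (_ * _).
  have -> : z ^+ (\sum_j v j) = \prod_(j < K.+1) z ^+ v j by rewrite -prodrXr.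
  by rewrite -big_split /=; apply: eq_bigr => j _; rewrite /x [in RHS]exprMn.
rewrite esumZl; last 2 first.
- exact: exprn_ge0.
- move=> v; rewrite mule_ge0 ?branching_step_ge0// lee_fin prodr_ge0// => j _.
  by rewrite exprn_ge0//; have /andP[] := x01 j.
rewrite branching_step_gf// -EFinM; congr EFin.
rewrite [in LHS](bigD1 ord0)//= mulrA -exprMn [RHS](bigD1 ord0)//=.
have D0 : rate w i + b - \sum_(j < K.+1) mu' k j * pgf la mu' b n k.+1 j != 0.
  by rewrite gt_eqF// rE den_gt0// => j; exact: pgf_le1.
have key : z * (lam w i / rate w i / (1 - \sum_(j < K.+1) mu w i j / rate w i * x j)) =
   la k / (srate la mu' k + b - \sum_(j < K.+1) mu' k j * pgf la mu' b n k.+1 j).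
  have -> : \sum_(j < K.+1) mu w i j / rate w i * x j =
     (\sum_(j < K.+1) mu' k j * pgf la mu' b n k.+1 j) / (rate w i + b).
    rewrite mulr_suml; apply: eq_bigr => j _; rewrite /x /z mE.
    by field; rewrite !gt_eqF.
  rewrite -rE -lE /z; field; rewrite D0 !gt_eqF//.
congr (_ * _).
  by rewrite mulr1 key mulr1.
apply: eq_bigr => j j0; congr (_ ^+ _).
case: j j0 => -[|l] lK // _; rewrite /=.
by rewrite -key /x; ring.
Qed.

End offspring_generating_function.

(** * Countable partitions, measurable limits and removal of truncations *)

Section measure_complements.
Context d (S : measurableType d) (R : realType).

Lemma ge0_integral_ae_set (m : {measure set S -> \bar R}) (A B : set S) (f : S -> \bar R) :
  measurable A -> measurable B -> measurable_fun setT f -> (forall s, 0 <= f s)%E ->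
  {ae m, forall s, A s <-> B s} -> (\int[m]_(s in A) f s = \int[m]_(s in B) f s)%E.
Proof.
move=> mA mB mf f0 h; rewrite integral_mkcond [RHS]integral_mkcond.
have m_ C : measurable C -> measurable_fun setT (f \_ C).
  by move=> mC; apply: (proj1 (measurable_restrictT f mC)); exact: measurable_funTS.
have n_ (C : set S) s : (0 <= (f \_ C) s)%E by apply: erestrict_ge0 => ? _; exact: f0.
have h' : ae_eq m setT (f \_ A) (f \_ B).
  apply: filterS h => s h _; rewrite /patch.
  suff -> : (s \in A) = (s \in B) by [].
  by apply/idP/idP; rewrite !inE => /h.
by apply: ge0_ae_eq_integral => //; [exact: m_ | exact: m_].
Qed.

Lemma measurable_fiber (C : countType) (g : S -> C) (A : set C) :
  (forall v, measurable [set s | g s = v]) -> measurable [set s | A (g s)].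
Proof.
move=> mg; rewrite (_ : [set s | A (g s)] = \bigcup_(v in [set: C])
    (if v \in A then [set s | g s = v] else set0)).
  apply: countable_bigcupT_measurable; first exact: countableP.
  by move=> v; case: ifP.
apply/seteqP; split => s /=.
  by move=> h; exists (g s) => //; rewrite mem_set.
by move=> [v _]; case: ifPn => // /[!inE] Av /= ->.
Qed.

Lemma measurable_fun_fiber d' (T : measurableType d') (C : countType) (g : S -> C)
    (h : C -> S -> T) :
  (forall v, measurable [set s | g s = v]) -> (forall v, measurable_fun setT (h v)) ->
  measurable_fun setT (fun s => h (g s) s).
Proof.
move=> mg mh _ B mB; rewrite setTI.
rewrite (_ : _ @^-1` B = \bigcup_(v in [set: C]) ([set s | g s = v] `&` h v @^-1` B)).
  apply: countable_bigcupT_measurable; first exact: countableP.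
  move=> v; apply: measurableI => //; rewrite -[X in measurable X]setTI.
  exact: mh.
apply/seteqP; split => s /=; first by move=> h1; exists (g s).
by move=> [v _ [/= -> ]].
Qed.

Lemma integral_partition (m : {measure set S -> \bar R}) (C : countType) (g : S -> C)
    (D : set S) (f : S -> \bar R) :
  (forall v, measurable [set s | g s = v]) -> measurable D ->
  measurable_fun setT f -> (forall s, 0 <= f s)%E ->
  (\int[m]_(s in D) f s = \esum_(v in [set: C]) \int[m]_(s in D `&` [set s | g s = v]) f s)%E.
Proof.
move=> mg mD mf f0.
pose F n := D `&` [set s | pickle (g s) = n].
have mF n : measurable (F n).
  by apply: measurableI => //; exact: (measurable_fiber (fun v => pickle v = n)).
have DE : D = \bigcup_n F n.
  by apply/seteqP; split => s; [move=> Ds; exists (pickle (g s)) | move=> [n _ []]].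
rewrite {1}DE ge0_integral_bigcup//; last 2 first.
- exact: measurable_funTS.
- apply/trivIsetP => i j _ _ ij; apply/seteqP; split => // s [[_ /= h1] [_ /= h2]].
  by move: ij; rewrite -h1 -h2 eqxx.
rewrite nneseries_esumT; last by move=> n; exact: integral_ge0.
rewrite (esumID (range (@pickle C))); last by move=> n _; exact: integral_ge0.
rewrite !setTI [X in (_ + X)%E]esum1 ?adde0; last first.
  move=> n /= hn; rewrite (_ : F n = set0) ?integral_set0//.
  by apply/seteqP; split => // s [_ /= h]; apply: hn; exists (g s).
rewrite esum_image; last by move=> x y _ _; exact: (pcan_inj pickleK).
apply: eq_esum => v _; congr (integral _ _ _); rewrite /F; congr (_ `&` _).
by apply/seteqP; split => s /=; [exact: (pcan_inj pickleK) | move=> ->].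
Qed.

Lemma ereal_ltP_rat (a b : \bar R) : (a < b)%E -> exists q : rat, (a < (ratr q)%:E < b)%E.
Proof.
have rb (x y : R) : (x < y)%R -> (a <= x%:E)%E -> (y%:E <= b)%E ->
    exists q : rat, (a < (ratr q)%:E < b)%E.
  move=> xy ax yb; have [q] := rat_in_itvoo xy; rewrite in_itv /= => /andP[q1 q2].
  exists q; apply/andP; split; first by apply: le_lt_trans ax _; rewrite lte_fin.
  by apply: lt_le_trans yb; rewrite lte_fin.
case: a b rb => [x| |] [y| |] rb // ab.
- exact: (rb x y).
- by apply: (rb x (x + 1)); rewrite ?ltrDl ?leey.
- by apply: (rb (y - 1) y); rewrite ?ltrBlDr ?ltrDl ?leNye.
- by apply: (rb 0 1); rewrite ?leNye ?leey.
Qed.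

(* Off the convergence set, [lim] takes a constant junk value. *)
Lemma measurable_limn (f : nat -> S -> \bar R) :
  (forall n, measurable_fun setT (f n)) ->
  measurable_fun setT (fun s => limn (fun n => f n s)).
Proof.
move=> mf.
pose u s := limn_esup (f^~ s); pose l s := limn_einf (f^~ s).
have mu : measurable_fun setT u by exact: measurable_fun_limn_esup.
have ml : measurable_fun setT l.
  rewrite (_ : l = (fun s => - limn_esup (fun n => - f n s))%E); last first.
    apply/funext => s; rewrite /l -[in LHS](oppeK (limn_einf _)) -limn_esupN; congr (- limn_esup _)%E.
  apply: measurableT_comp => //; apply: measurable_fun_limn_esup => n.
  exact: measurableT_comp.
pose C := [set s | (l s < u s)%E].
have mC : measurable C.
  rewrite (_ : C = \bigcup_(q in [set: rat]) ([set s | (l s < (ratr q)%:E)%E] `&` [set s | ((ratr q)%:E < u s)%E])).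
    apply: countable_bigcupT_measurable; first exact: countableP.
    move=> q; apply: measurableI; rewrite -[X in measurable X]setTI.
      exact: emeasurable_fun_infty_o.
    exact: emeasurable_fun_o_infty.
  apply/seteqP; split => s /=.
    by move=> /ereal_ltP_rat[q /andP[h1 h2]]; exists q.
  by move=> [q _ [/= h1 h2]]; exact: lt_trans h2.
pose k : \bar R := point.
rewrite (_ : (fun s => _) = (fun s => if s \in C then k else u s)); last first.
  apply/funext => s; case: ifPn => [/[!inE] Cs|].
    apply: getPN => x hx.
    have [h1 h2] := cvg_limn_einf_sup hx.
    by move: Cs; rewrite /C /= /l /u h1 h2 ltxx.
  rewrite notin_setE /C /= => /negP; rewrite -leNgt => ul.
  rewrite -is_cvg_limn_esupE//.
  have lu : l s = u s by apply/eqP; rewrite eq_le ul limn_einf_sup.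
  apply/cvg_ex; exists (u s).
  apply: (@squeeze_cvge _ _ _ _ (einfs (f^~ s)) _ (esups (f^~ s))).
  - apply: nearW => n; apply/andP; split.
      by apply: ereal_inf_lbound; exists n => //=.
    by apply: ereal_sup_ubound; exists n => //=.
  - rewrite -lu /l limn_einf_lim; exact: is_cvg_einfs.
  - rewrite /u limn_esup_lim; exact: is_cvg_esups.
apply: measurable_fun_ifT => //; apply: (measurable_fun_bool true).
rewrite setTI (_ : _ @^-1` _ = C)//.
by apply/seteqP; split => s /=; [exact: set_mem | exact: mem_set].
Qed.

(** Outside [A n] the integral is between 0 and [1 - h n], which vanishes; the sets [A n] need not
    increase. This is how the truncations by generations and by jumps are removed. *)
Lemma integral_sandwich (m : probability S R) (A : nat -> set S) (f : S -> R) (g h : nat -> R) (c : R) :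
  (forall n, measurable (A n)) -> measurable_fun setT f -> (forall s, 0 <= f s <= 1) ->
  (forall n, \int[m]_(s in A n) (f s)%:E = (g n)%:E)%E ->
  (forall n, m (A n) = (h n)%:E) -> g @ \oo --> c -> h @ \oo --> (1 : R) ->
  (\int[m]_s (f s)%:E = c%:E)%E.
Proof.
move=> mA mf f01 Hg Hh cg ch.
have mf' D : measurable_fun D (fun s => (f s)%:E).
  by apply: measurable_funTS; exact/measurable_EFinP.
have f0 s : (0 <= (f s)%:E)%E by rewrite lee_fin; have /andP[] := f01 s.
have f1 s : ((f s)%:E <= 1)%E by rewrite lee_fin; have /andP[] := f01 s.
have [r rE] : exists r, (\int[m]_s (f s)%:E = r%:E)%E.
  exists (fine (\int[m]_s (f s)%:E)%E); rewrite fineK// ge0_fin_numE ?integral_ge0//.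
  apply: (@le_lt_trans _ _ (\int[m]_s (1%E : \bar R))%E); first exact: ge0_le_integral.
  by rewrite integral_cst// mul1e (le_lt_trans (probability_le1 m measurableT))// ltry.
have b n : g n <= r <= g n + (1 - h n).
  have E : (r%:E = (g n)%:E + \int[m]_(s in ~` A n) (f s)%:E)%E.
    rewrite -rE -Hg -ge0_integral_setU//.
    - by rewrite setUv.
    - exact: measurableC.
    - by apply/disj_setPS => s [].
  have up : (\int[m]_(s in ~` A n) (f s)%:E <= (1 - h n)%:E)%E.
    apply: (@le_trans _ _ (\int[m]_(s in ~` A n) (1%E : \bar R))%E).
      by apply: ge0_le_integral => //; exact: measurableC.
    apply: (@le_trans _ _ (m (~` A n))).
      by rewrite integral_cst ?mul1e//; exact: measurableC.
    by rewrite probability_setC// Hh EFinB.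
  have lo : (0 <= \int[m]_(s in ~` A n) (f s)%:E)%E by exact: integral_ge0.
  move: E up lo; case: (\int[m]_(s in ~` A n) (f s)%:E)%E => [x| |] //= [->].
  by rewrite !lee_fin lerDl lerD2l => -> ->.
have cgh : g n + (1 - h n) @[n --> \oo] --> c.
  rewrite -[X in _ --> X]addr0 -(subrr 1); apply: cvgD => //.
  by apply: cvgB => //; exact: cvg_cst.
rewrite rE; congr EFin; apply/eqP; rewrite eq_le; apply/andP; split.
  rewrite -(cvg_lim _ cgh)//; apply: limr_ge; first exact: cvgP cgh.
  by apply: nearW => n; have /andP[] := b n.
rewrite -(cvg_lim _ cg)//; apply: limr_le; first exact: cvgP cg.
by apply: nearW => n; have /andP[] := b n.
Qed.

Lemma ae_exists_of_cvg1 (m : probability S R) (A : nat -> set S) (h : nat -> R) :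
  (forall n, measurable (A n)) -> (forall n, m (A n) = (h n)%:E) -> h @ \oo --> (1 : R) ->
  {ae m, forall s, exists n, A n s}.
Proof.
move=> mA Hh ch; exists (~` \bigcup_n A n); split.
- by apply: measurableC; exact: bigcup_measurable.
- rewrite probability_setC; last exact: bigcup_measurable.
  suff -> : m (\bigcup_n A n) = 1%E by rewrite subee.
  apply/eqP; rewrite eq_le probability_le1//=; last exact: bigcup_measurable.
  have cE : (h n)%:E @[n --> \oo] --> (1%:E : \bar R).
    by apply/cvg_EFin => //; exact: nearW.
  rewrite -(cvg_lim _ cE)//; apply: lime_le; first exact: cvgP cE.
  apply: nearW => n; rewrite -Hh; apply: le_measure; rewrite ?inE//.
    exact: bigcup_measurable.
  exact: bigcup_sup.
- by move=> s /= h1 [n _ An]; apply: h1; exists n.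
Qed.

End measure_complements.

(** * Laplace transform of the branching time *)

Section branching_laplace.
Variables (K : nat) (R : realType) (w : env K R).
Hypothesis lam_gt0 : forall i, 0 < lam w i.
Context d (S : measurableType d) (Q : probability S R).
Variables (U : nat -> S -> {ffun 'I_K.+1 -> nat}) (xi xit : nat -> nat -> S -> R).
Hypothesis HM : branching_model w Q U xi xit.

Local Notation T := {ffun 'I_K.+1 -> nat}.
Let la k := lam w (- k%:Z).
Let mm k l := mu w (- k%:Z) l.
Let r k := rate w (- k%:Z).
Let r0 k : 0 < r k. Proof. by rewrite /r rate_gt0. Qed.
Let X := clocks xi xit.

Let mU n u : measurable [set s | U n s = u].
Proof. by have [[]] := HM. Qed.

Let mX j : measurable_fun setT (X j).
Proof. by have [_ h _ _ _] := HM; exact: h. Qed.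

Let mXgt j t : measurable [set s | t < X j s].
Proof. exact: measurable_gt_fun. Qed.

Definition prefix_event n (u : nat -> T) := [set s | forall k, (k <= n)%N -> U k s = u k].

Let mprefix n u : measurable (prefix_event n u).
Proof.
rewrite (_ : prefix_event n u = \bigcap_(k in [set k | (k <= n)%N]) [set s | U k s = u k]).
  by apply: bigcap_measurableType => k _; exact: mU.
by apply/seteqP; split.
Qed.

(** The model prescribes the probability of [t <= X], whereas [exp_family_laplace] works with strict
    tails. The event [t < X] is the increasing union of the closed tails at [t + i.+1%:R^-1]. *)
Lemma clock_tail j (t : R) : 0 <= t -> Q [set s | t < X j s] = (expR (- (r j.1.2 * t)))%:E.
Proof.
move=> t0; have [_ _ h _ _] := HM; case: j => -[b n] k /=.
pose A i := [set s | t + i.+1%:R^-1 <= X (b, n, k) s].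
have mA i : measurable (A i).
  by rewrite -[X in measurable X]setTI; apply: measurable_fun_ler.
have AE : [set s | t < X (b, n, k) s] = \bigcup_i A i.
  apply/seteqP; split => s /=.
    move=> ts; have d0 : 0 < X (b, n, k) s - t by rewrite subr_gt0.
    have [i hi] : exists i : nat, i.+1%:R^-1 <= X (b, n, k) s - t.
      exists (Num.truncn (X (b, n, k) s - t)^-1).
      by rewrite invf_ple ?posrE// ltW// truncnS_gt.
    by exists i => //; rewrite /A /= addrC -lerBrDr.
  move=> [i _]; apply: lt_le_trans; by rewrite ltrDl invr_gt0.
have nd : nondecreasing_seq A.
  apply/nondecreasing_seqP => i; apply/subsetPset => s; apply: le_trans.
  by rewrite lerD2l lef_pV2 ?posrE// ler_nat.
have cv := nondecreasing_cvg_mu (mu := Q) mA (bigcup_measurable (fun k _ => mA k)) nd.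
rewrite AE -(cvg_lim _ cv)//; apply/cvg_lim => //.
rewrite (_ : Q \o A = (fun i => (expR (- (r n * (t + i.+1%:R^-1))))%:E)); last first.
  by apply/funext => i /=; rewrite h// addr_ge0.
apply/cvg_EFin; first exact: nearW.
apply: continuous_cvg; first exact: continuous_expR.
apply: cvgN; apply: cvgM; first exact: cvg_cst.
rewrite -[X in _ --> X]addr0; apply: cvgD; [exact: cvg_cst | exact: cvg_harmonic].
Qed.

Lemma clocks_gt0_ae : {ae Q, forall s, forall j, 0 < X j s}.
Proof.
have one j : {ae Q, forall s, 0 < X j s}.
  exists (~` [set s | 0 < X j s]); split; first exact: measurableC.
    by rewrite probability_setC// clock_tail// mulr0 oppr0 expR0 subee.
  by move=> s.
have H : {ae Q, forall s, forall n : nat,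
    if unpickle n is Some j then 0 < X j s else true}.
  by apply: ae_foralln => n; case: unpickle => [j|]; [exact: one | exact: aeW].
by apply: filterS H => s h j; have := h (pickle j); rewrite pickleK.
Qed.

(* The clocks of rate [rate w (- k)]: [xi_{-k}] for the individuals of type 1 of
   generation [k], and [xit_{-k}] for all the individuals of generation [k + 1]. *)
Definition clock_block (u : nat -> T) k : seq (bool * nat * nat) :=
  [seq (false, k, i) | i <- iota 0 (u k ord0)] ++
  [seq (true, k, i) | i <- iota 0 (\sum_j u k.+1 j)].

Fixpoint clock_list (u : nat -> T) m : seq (bool * nat * nat) :=
  if m is m'.+1 then clock_list u m' ++ clock_block u m' else [::].

Lemma mem_clock_list u m j : j \in clock_list u m -> (j.1.2 < m)%N.
Proof.
elim: m => //= m IHm; rewrite mem_cat => /orP[/IHm/ltnW //|].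
by rewrite mem_cat => /orP[] /mapP[i _ ->] /=.
Qed.

Lemma uniq_clock_list u m : uniq (clock_list u m).
Proof.
elim: m => //= m IHm; rewrite cat_uniq IHm /=; apply/andP; split.
  apply/hasPn => j; rewrite mem_cat => jm; apply/negP => /mem_clock_list.
  by move: jm => /orP[] /mapP[i _ ->] /=; rewrite ltnn.
rewrite cat_uniq; apply/and3P; split.
- by rewrite map_inj_uniq ?iota_uniq// => x y [].
- by apply/hasPn => j /mapP[i _ ->]; apply/negP => /mapP[].
- by rewrite map_inj_uniq ?iota_uniq// => x y [].
Qed.

Lemma eq_clock_list u v m : (forall k, (k <= m)%N -> u k = v k) ->
  clock_list u m = clock_list v m.
Proof.
elim: m => //= m IHm h; rewrite IHm; last by move=> k km; apply: h; exact: ltnW.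
by rewrite /clock_block !h.
Qed.

Definition clock_sum (u : nat -> T) m s := \sum_(j <- clock_list u m) X j s.

Lemma measurable_clock_sum u m : measurable_fun setT (clock_sum u m).
Proof. by apply: measurable_sum => j; exact: mX. Qed.

Definition truncated_time m s := clock_sum (U^~ s) m s.

Lemma truncated_time_prefix u m s : prefix_event m u s -> truncated_time m s = clock_sum u m s.
Proof. by move=> h; rewrite /truncated_time /clock_sum (@eq_clock_list _ u). Qed.

Definition clock_weight (b : R) (u : nat -> T) m : R :=
  \prod_(k < m) (r k / (r k + b)) ^+ (u k ord0 + \sum_j u k.+1 j).

Lemma prod_clock_list (b : R) u m :
  \prod_(j <- clock_list u m) (r j.1.2 / (r j.1.2 + b)) = clock_weight b u m.
Proof.
rewrite /clock_weight; elim: m => [|m IHm]; first by rewrite big_nil big_ord0.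
rewrite big_cat big_ord_recr /= IHm; congr (_ * _).
rewrite big_cat !big_map /= exprD; congr (_ * _).
  by rewrite -[X in iota 0 X]subn0 prodr_const_nat subn0.
by rewrite -[X in iota 0 X]subn0 prodr_const_nat subn0.
Qed.

(** For a fixed history [u] the list of clocks in use is deterministic. Independence of [U] from the
    clocks splits off the history, and mutual independence applies to the list because it has no
    repetition. *)
Lemma clock_family_indep n u m (t : nat -> R) : (forall k, 0 <= t k) ->
  Q (prefix_event n u `&`
     [set s | forall k, (k < size (clock_list u m))%N ->
        t k < X (nth (false, 0, 0)%N (clock_list u m) k) s]) =
  (Q (prefix_event n u) * (\prod_(k < size (clock_list u m))
     expR (- (r (nth (false, 0, 0)%N (clock_list u m) k).1.2 * t k)))%:E)%E.
Proof.
move=> t0; have [_ _ _ hind hUX] := HM.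
set js := clock_list u m; set j0 := (false, 0, 0)%N.
pose B j : set R := `]t (index j js), +oo[%classic.
have E : [set s | forall k, (k < size js)%N -> t k < X (nth j0 js k) s] =
   [set s | forall j, j \in js -> B j (clocks xi xit j s)].
  apply/seteqP; split => s /= h.
    move=> j jj; rewrite /B /= in_itv /= andbT.
    by have := h (index j js); rewrite index_mem jj nth_index// => /(_ isT).
  move=> k kn; have := h (nth j0 js k) (mem_nth _ kn).
  by rewrite /B /= in_itv /= andbT index_uniq// uniq_clock_list.
rewrite hUX; last 2 first.
- rewrite (_ : prefix_event n u = \bigcap_(k in [set k | (k <= n)%N]) [set s | U k s = u k]); last first.
    by apply/seteqP; split.
  pose G := [set C | exists n u, C = [set s | U n s = u]].
  apply: (@bigcap_measurableType G.-sigma (g_sigma_algebraType G)) => k _.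
  by apply: sub_sigma_algebra; exists k, (u k).
- rewrite (_ : [set s | _] = \bigcap_(k in [set k | (k < size js)%N])
      (clocks xi xit (nth j0 js k) @^-1` `]t k, +oo[%classic)); last first.
    apply/seteqP; split => s /= h k kn; have := h k kn; rewrite /= in_itv /= andbT //.
  pose G := [set C | exists j (D : set R), measurable D /\ C = clocks xi xit j @^-1` D].
  apply: (@bigcap_measurableType G.-sigma (g_sigma_algebraType G)) => k _.
  apply: sub_sigma_algebra; exists (nth j0 js k), `]t k, +oo[%classic; split => //.
congr (_ * _)%E; rewrite E hind ?uniq_clock_list//; last by move=> j; exact: measurable_itv.
rewrite -prodEFin (big_nth j0) big_mkord; apply: eq_bigr => k _.
rewrite -clock_tail//; congr (Q _); apply/seteqP; split => s /=;
  by rewrite /B /= in_itv /= andbT index_uniq// uniq_clock_list.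
Qed.

Lemma integral_prefix_clock_sum (b : R) n u m : 0 <= b ->
  (\int[Q]_(s in prefix_event n u) (expR (- (b * clock_sum u m s)))%:E =
   Q (prefix_event n u) * (clock_weight b u m)%:E)%E.
Proof.
move=> b0; set js := clock_list u m; set j0 := (false, 0, 0)%N.
pose Y k := X (nth j0 js k); pose rho k := r (nth j0 js k).1.2.
have [c cE] : exists c, Q (prefix_event n u) = c%:E.
  by exists (fine (Q (prefix_event n u))); rewrite fineK// fin_num_measure.
have c0 : 0 <= c by rewrite -lee_fin -cE measure_ge0.
have mY k : measurable_fun setT (Y k) by exact: mX.
have rho0 k : 0 < rho k by exact: r0.
have hyp t : (forall k, 0 <= t k) ->
   Q (prefix_event n u `&` [set s | forall k, (k < size js)%N -> t k < Y k s]) =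
   (c * \prod_(k < size js) expR (- (rho k * t k)))%:E.
  by move=> t0; rewrite clock_family_indep// cE EFinM.
have := @exp_family_laplace _ S R Q (prefix_event n u) Y rho c b (size js)
  (mprefix n u) mY c0 rho0 b0 hyp.
rewrite cE -EFinM.
have -> : \prod_(k < size js) (rho k / (rho k + b)) = clock_weight b u m.
  by rewrite -prod_clock_list (big_nth j0) big_mkord.
move=> <-.
transitivity (\int[Q]_(s in prefix_event n u) (\prod_(k < size js) expR (- (b * Y k s)))%:E)%E.
  apply: eq_integral => s _; rewrite /clock_sum mulr_sumr -sumrN expR_sum.
  by rewrite (big_nth j0) big_mkord.
apply: ge0_integral_ae_set.
- exact: mprefix.
- apply: measurableI; first exact: mprefix.
  rewrite (_ : [set s | _] = \bigcap_(k in [set k | (k < size js)%N]) [set s | 0 < Y k s]).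
    by apply: bigcap_measurableType => k _; exact: mXgt.
  by apply/seteqP; split.
- apply/measurable_EFinP; apply: measurable_prod => k _.
  apply: measurableT_comp => //; apply: measurableT_comp => //.
  exact: measurable_funM.
- by move=> s; rewrite lee_fin prodr_ge0// => k _; exact: expR_ge0.
by apply: filterS clocks_gt0_ae => s h; split => [ps|[]//]; split => // k _; exact: h.
Qed.

End branching_laplace.

Section branching_law.
Variables (K : nat) (R : realType) (w : env K R).
Hypothesis lam_gt0 : forall i, 0 < lam w i.
Context d (S : measurableType d) (Q : probability S R).
Variables (U : nat -> S -> {ffun 'I_K.+1 -> nat}) (xi xit : nat -> nat -> S -> R).
Hypothesis HM : branching_model w Q U xi xit.

Local Notation T := {ffun 'I_K.+1 -> nat}.
Let la k := lam w (- k%:Z).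
Let mm k l := mu w (- k%:Z) l.
Let la0 k : 0 < la k. Proof. exact: lam_gt0. Qed.
Let mm0 k l : 0 <= mm k l. Proof. by rewrite /mm /mu. Qed.
Let X := clocks xi xit.
Let mU n u : measurable [set s | U n s = u].
Proof. by have [[]] := HM. Qed.
Let mX j : measurable_fun setT (X j).
Proof. by have [_ h _ _ _] := HM; exact: h. Qed.
Let mprefix n u : measurable (prefix_event U n u).
Proof.
rewrite (_ : prefix_event U n u = \bigcap_(k in [set k | (k <= n)%N]) [set s | U k s = u k]).
  by apply: bigcap_measurableType => k _; exact: mU.
by apply/seteqP; split.
Qed.

Let trunc_time := truncated_time U xi xit.

(** A history as a point of a countable type, so that events and functions can be split according to
    it. *)
Definition prefix_fun n s : {ffun 'I_n.+1 -> T} := [ffun k : 'I_n.+1 => U k s].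

Lemma measurable_prefix_fun n p : measurable [set s | prefix_fun n s = p].
Proof.
rewrite (_ : [set s | _] = prefix_event U n (fun k => p (inord k))); first exact: mprefix.
apply/seteqP; split => s /=.
  by move=> <- k kn; rewrite ffunE inordK.
move=> h; apply/ffunP => k; rewrite ffunE h; last by rewrite -ltnS.
by rewrite inord_val.
Qed.

Lemma measurable_trunc_time m : measurable_fun setT (trunc_time m).
Proof.
have := @measurable_fun_fiber _ S _ _ _ (prefix_fun m)
  (fun p s => clock_sum xi xit (fun k => p (inord k)) m s)
  (measurable_prefix_fun (n := m)) (fun p => measurable_clock_sum HM _ m).
congr measurable_fun; apply/funext => s; apply/esym/truncated_time_prefix => k km.
by rewrite ffunE inordK.
Qed.

Lemma prefix_eventS n u :
  Q (prefix_event U n.+1 u) = (Q (prefix_event U n u) * branching_step w (- n%:Z) (u n) (u n.+1))%E.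
Proof. by have [[_ h] _ _ _ _] := HM; rewrite /prefix_event !h big_ord_recr /= muleA. Qed.

Definition e1 : T := [ffun j => (j == ord0) : nat].

Lemma prefix_event0 u : Q (prefix_event U 0 u) = ((u 0%N == e1)%:R)%:E.
Proof. by have [[_ h] _ _ _ _] := HM; rewrite /prefix_event h big_ord0 mule1. Qed.

Let mexpt (b : R) m : measurable_fun setT (fun s => (expR (- (b * trunc_time m s)))%:E).
Proof.
apply/measurable_EFinP; apply: measurableT_comp => //; apply: measurableT_comp => //.
by apply: measurable_funM => //; exact: measurable_trunc_time.
Qed.

(** The descendances of the individuals of generation [m] are independent, one of type [j]
    contributing [pgf b n m j]. The induction on [n] splits according to the value [v] of the next
    generation, appends [v] to the history, and sums over [v] by [pgf_branching_step]. *)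
Lemma integral_prefix_extinct (b : R) n m u : 0 <= b ->
  (\int[Q]_(s in prefix_event U m u `&` [set s | U (m + n)%N s = [ffun=> 0%N]])
     (expR (- (b * trunc_time (m + n) s)))%:E =
   Q (prefix_event U m u) *
   (clock_weight w b u m * \prod_(j < K.+1) pgf la mm b n m j ^+ u m j)%:E)%E.
Proof.
move=> b0; elim: n m u => [|n IHn] m u.
  (* As [pgf b 0] is 0, the product is made of powers of 0: it is 1 for an empty generation, since
     [0 ^+ 0 = 1], and 0 otherwise. *)
  rewrite addn0 /=; have [um|um] := eqVneq (u m) [ffun=> 0%N].
    rewrite (_ : _ `&` _ = prefix_event U m u); last first.
      by apply/seteqP; split => s /=; [move=> [] | move=> h; split => //; rewrite h].
    rewrite big1 ?mulr1; last by move=> j _; rewrite um ffunE expr0.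
    rewrite -(integral_prefix_clock_sum lam_gt0 HM)//.
    by apply: eq_integral => s; rewrite inE => ps; rewrite /trunc_time (truncated_time_prefix _ _ ps).
  rewrite (_ : _ `&` _ = set0); last first.
    apply/seteqP; split => // s [/= h]; rewrite h// => um'.
    by rewrite um' eqxx in um.
  rewrite integral_set0; have [j uj] : exists j, u m j != 0%N.
    apply/existsP; apply: contraNT um => /existsPn h; apply/eqP/ffunP => j.
    by rewrite ffunE; apply/eqP; have := h j; rewrite negbK.
  by rewrite (bigD1 j)//= expr0n (negbTE uj) mul0r mulr0 mule0.
have mU0 k : measurable [set s | U k s = [ffun=> 0%N]] by exact: mU.
have mD : measurable (prefix_event U m u `&` [set s | U (m + n.+1)%N s = [ffun=> 0%N]]).
  by apply: measurableI => //; exact: mprefix.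
have nn s : (0 <= (expR (- (b * trunc_time (m + n.+1) s)))%:E)%E by rewrite lee_fin expR_ge0.
rewrite (integral_partition Q (mU m.+1) mD (mexpt b _) nn).
pose u' (v : T) k := if k == m.+1 then v else u k.
have setE v : prefix_event U m u `&` [set s | U (m + n.+1)%N s = [ffun=> 0%N]] `&` [set s | U m.+1 s = v]
  = prefix_event U m.+1 (u' v) `&` [set s | U (m.+1 + n)%N s = [ffun=> 0%N]].
  rewrite addnS -addSn; apply/seteqP; split => s /=.
    move=> [[h1 h2] h3]; split => // k; rewrite leq_eqVlt /u'.
    by case: eqP => [-> //|_ /=]; rewrite ltnS; exact: h1.
  move=> [h1 h2]; split; [split => //|].
    move=> k km; have := h1 k (leqW km); rewrite /u' ifN//.
    by apply/eqP => e; rewrite e ltnn in km.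
  by have := h1 m.+1 (leqnn _); rewrite /u' eqxx.
have pE v : Q (prefix_event U m (u' v)) = Q (prefix_event U m u).
  congr (Q _); apply/seteqP; split => s h k km; have := h k km; rewrite /u' ifN//;
  by apply/eqP => e; rewrite e ltnn in km.
have [c cE] : exists c, Q (prefix_event U m u) = c%:E.
  by exists (fine (Q (prefix_event U m u))); rewrite fineK// fin_num_measure.
have c0 : 0 <= c by rewrite -lee_fin -cE measure_ge0.
have z0 k : 0 <= rate w (- k%:Z) / (rate w (- k%:Z) + b).
  have rk := rate_gt0 (lam_gt0 (- k%:Z)).
  by apply: divr_ge0; [exact: ltW | apply: addr_ge0 => //; exact: ltW].
have wt0 : 0 <= clock_weight w b u m.
  by apply: prodr_ge0 => k _; exact: exprn_ge0.
transitivity (\esum_(v in [set: T]) ((c * clock_weight w b u m)%:E *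
   (branching_step w (- m%:Z) (u m) v * ((rate w (- m%:Z) / (rate w (- m%:Z) + b)) ^+ (u m ord0 + \sum_j v j) *
         \prod_(j < K.+1) pgf la mm b n m.+1 j ^+ v j)%:E)))%E.
  apply: eq_esum => v _; rewrite setE (_ : (m + n.+1)%N = (m.+1 + n)%N); last by rewrite addSnnS.
  rewrite IHn prefix_eventS pE cE.
  have -> : u' v m = u m by rewrite /u' ifN// neq_ltn ltnSn.
  have -> : u' v m.+1 = v by rewrite /u' eqxx.
  have -> : clock_weight w b (u' v) m.+1 = clock_weight w b u m *
     (rate w (- m%:Z) / (rate w (- m%:Z) + b)) ^+ (u m ord0 + \sum_j v j).
    rewrite /clock_weight big_ord_recr /=; congr (_ * _); last first.
      by rewrite /u' eqxx ifN// neq_ltn ltnSn.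
    apply: eq_bigr => k _; have km := ltn_ord k.
    by rewrite /u' (ltn_eqF (leqW km)) eqSS (ltn_eqF km).
  rewrite -(mulrA (clock_weight w b u m)) (EFinM c) (EFinM (clock_weight w b u m)) -!muleA.
  by congr (_ * _)%E; rewrite muleCA.
rewrite esumZl; last 2 first.
- by rewrite mulr_ge0.
- move=> v; rewrite mule_ge0 ?branching_step_ge0// lee_fin mulr_ge0 ?exprn_ge0//.
  by rewrite prodr_ge0// => j _; rewrite exprn_ge0// pgf_ge0.
rewrite (@pgf_branching_step K R w (- m%:Z) (lam_gt0 _) la mm b n m (u m))//.
by rewrite cE -!EFinM mulrA.
Qed.

Definition extinct n := [set s | U n s = [ffun=> 0%N]].

Lemma U0_ae : {ae Q, forall s, U 0 s = e1}.
Proof.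
exists (~` [set s | U 0 s = e1]); split; first exact: measurableC.
  rewrite probability_setC//.
  rewrite (_ : [set s | U 0 s = e1] = prefix_event U 0 (fun=> e1)).
    by rewrite prefix_event0 eqxx subee.
  apply/seteqP; split => s /=; last by apply.
  by move=> h [|//] _.
by move=> s.
Qed.

Lemma integral_extinct (b : R) n : 0 <= b ->
  (\int[Q]_(s in extinct n) (expR (- (b * trunc_time n s)))%:E = (pgf la mm b n 0 0)%:E)%E.
Proof.
move=> b0; have := integral_prefix_extinct n 0 (fun=> e1) b0.
rewrite add0n prefix_event0 eqxx mul1e /clock_weight big_ord0 mul1r.
rewrite (bigD1 ord0)//= big1 ?mulr1; last first.
  by move=> j j0; rewrite ffunE (negbTE j0) expr0.
rewrite ffunE eqxx expr1 => <-.
have h : {ae Q, forall s, extinct n s <->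
    (prefix_event U 0 (fun=> e1) `&` [set s | U n s = [ffun=> 0%N]]) s}.
  apply: filterS U0_ae => s h; split => [es|[]//]; split => // k.
  by rewrite leqn0 => /eqP ->.
have mE : measurable (prefix_event U 0 (fun=> e1) `&` [set s | U n s = [ffun=> 0%N]]).
  by apply: measurableI; [exact: mprefix | exact: mU].
have nn s : (0 <= (expR (- (b * trunc_time n s)))%:E)%E by rewrite lee_fin expR_ge0.
exact: (ge0_integral_ae_set (mU n _) mE (mexpt b n) nn h).
Qed.

Lemma prob_extinct n : Q (extinct n) = (pgf la mm 0 n 0 0)%:E.
Proof.
rewrite -integral_extinct//; under eq_integral do rewrite mul0r oppr0 expR0.
by rewrite integral_cst ?mul1e//; exact: mU.
Qed.

Lemma branching_step_absorb i v : v != [ffun=> 0%N] ->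
  branching_step w i [ffun=> 0%N] v = 0%E.
Proof.
move=> v0; rewrite /branching_step (_ : [set z | _] = set0) ?esum_set0//.
apply/seteqP; split => // z /= h; move/eqP: v0; apply; apply/ffunP => j.
rewrite -h ffunE big1// => -[m [k km]] _; exfalso; by move: km; rewrite ffunE.
Qed.

Lemma extinct_absorb_ae : {ae Q, forall s, forall n, extinct n s -> extinct n.+1 s}.
Proof.
apply: ae_foralln => n.
pose A := extinct n `&` ~` extinct n.+1.
have mA : measurable A by apply: measurableI; [exact: mU | apply: measurableC; exact: mU].
exists A; split => //; last by move=> s /= /not_implyP.
have := integral_partition Q (measurable_prefix_fun (n := n.+1)) mA (measurable_cst (1%E : \bar R))
  (fun=> lee01).
rewrite integral_cst// mul1e => ->; apply: esum1 => p _.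
rewrite integral_cst ?mul1e; last by apply: measurableI => //; exact: measurable_prefix_fun.
pose u k := p (inord k) : T.
have [[p1 p2]|h] := pselect (u n = [ffun=> 0%N] /\ u n.+1 != [ffun=> 0%N]).
  apply/eqP; rewrite eq_le measure_ge0 andbT.
  apply: (@le_trans _ _ (Q (prefix_event U n.+1 u))).
    apply: le_measure; rewrite ?inE.
    - by apply: measurableI => //; exact: measurable_prefix_fun.
    - exact: mprefix.
    by move=> s [_ /= ps] k kn; rewrite /u -ps ffunE inordK.
  by rewrite prefix_eventS p1 branching_step_absorb// mule0.
rewrite (_ : _ `&` _ = set0) ?measure0//.
apply/seteqP; split => // s [[s1 s2] /= ps]; apply: h; rewrite /u -ps !ffunE !inordK//.
by split => //; apply/eqP.
Qed.

Lemma extinct_le s n m : (forall k, extinct k s -> extinct k.+1 s) -> (n <= m)%N ->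
  extinct n s -> extinct m s.
Proof.
move=> h /subnK <-; elim: (m - n)%N => //= k IHk en; rewrite addSn; apply: h.
exact: IHk.
Qed.

Lemma branching_time_extinct s n : U 0 s = e1 ->
  (forall k, extinct k s -> extinct k.+1 s) -> extinct n s ->
  branching_time U xi xit s = (trunc_time n s)%:E.
Proof.
move=> U0 hs en.
have U_0 m : (n <= m)%N -> U m s = [ffun=> 0%N].
  by move=> nm; exact: extinct_le hs nm en.
have n0 : (0 < n)%N.
  rewrite lt0n; apply/negP => /eqP n0; move: en; rewrite n0 /extinct /= U0.
  by move=> /ffunP/(_ ord0); rewrite !ffunE eqxx.
have eseries_fin (f : nat -> R) N : (forall k, (N <= k)%N -> f k = 0) ->
   (\sum_(0 <= k <oo) (f k)%:E = (\sum_(0 <= k < N) f k)%:E)%E.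
  move=> f0; apply/cvg_lim => //; apply: cvg_near_cst.
  exists N => // M /= NM; apply/eqP.
  rewrite (@big_cat_nat _ _ _ N)//= [X in (_ + X)%E]big_nat_cond [X in (_ + X)%E]big1.
    by rewrite adde0 sumEFin.
  by move=> k /andP[/andP[Nk _] _]; rewrite f0.
(* The first series runs over [U n.+1], so it stops one index earlier than the generation of
   extinction. *)
rewrite /branching_time (eseries_fin _ n.-1); last first.
  move=> k nk; rewrite U_0; last by rewrite -(prednK n0).
  by rewrite ffunE big_ord0.
rewrite (eseries_fin _ n); last first.
  move=> k nk; have -> : (\sum_j U k.+1 s j = 0)%N; last by rewrite big_ord0.
  by rewrite U_0 ?leqW// big1// => j _; rewrite ffunE.
rewrite -!EFinD; congr EFin.
rewrite /trunc_time /truncated_time /clock_sum.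
have io N : iota 0 N = index_iota 0 N by rewrite /index_iota subn0.
have -> : \sum_(j <- clock_list (U^~ s) n) X j s =
   \sum_(0 <= k < n) \sum_(i < U k s ord0) xi k i s +
   \sum_(0 <= k < n) \sum_(i < \sum_j U k.+1 s j) xit k i s.
  elim: n {en U_0 n0} => [|n IHn]; first by rewrite !big_geq// big_nil addr0.
  rewrite big_cat IHn big_cat !big_map /= !big_nat_recr//= addrACA; congr (_ + _ + (_ + _)).
    by rewrite io big_mkord.
  by rewrite io big_mkord.
(* The isolated clock [xi 0 0] is the missing term of index 0, because generation 0 is a single
   individual of type 1. *)
congr (_ + _); rewrite -[in RHS](prednK n0) [RHS]big_nat_recl//; congr (_ + _).
by rewrite U0 ffunE eqxx big_ord1.
Qed.

(** Clocks may be negative on a null set, so the partial sums need not be monotone everywhere; the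
    limits are handled by [measurable_limn]. *)
Lemma measurable_branching_time : measurable_fun setT (branching_time U xi xit).
Proof.
have msum (c : T -> nat) (f : nat -> S -> R) n : (forall k, measurable_fun setT (f k)) ->
    measurable_fun setT (fun s => (\sum_(k < c (U n s)) f k s)%:E).
  move=> mf; apply/measurable_EFinP.
  apply: (measurable_fun_fiber (g := U n) (h := fun u s => \sum_(k < c u) f k s)) => //.
  by move=> u; apply: measurable_sum => k; exact: mf.
have mser (F : nat -> S -> \bar R) : (forall n, measurable_fun setT (F n)) ->
    measurable_fun setT (fun s => \sum_(0 <= n <oo) F n s)%E.
  move=> mF; apply: (measurable_limn (f := fun n s => \sum_(0 <= k < n) F k s)%E) => n.
  by apply: emeasurable_sum.
apply: emeasurable_funD; first apply: emeasurable_funD.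
- by apply/measurable_EFinP; exact: (mX (false, 0, 0)%N).
- by apply: mser => n; apply: (msum (fun u => u ord0) (xi n.+1)) => k; exact: (mX (false, n.+1, k)).
- by apply: mser => n; apply: (msum (fun u => \sum_j u j)%N (xit n)) => k; exact: (mX (true, n, k)).
Qed.

Hypothesis rec : lpgf la mm 0 0 0 = 1.

Let pgf_cvg0 : (fun n => pgf la mm 0 n 0 0) @ \oo --> (1 : R).
Proof. by rewrite -rec; apply: pgf_cvg. Qed.

Lemma branching_time_ae : {ae Q, forall s, exists n, extinct n s /\
  branching_time U xi xit s = (trunc_time n s)%:E}.
Proof.
have h := ae_exists_of_cvg1 (m := Q) (A := extinct) (fun n => mU n _) prob_extinct pgf_cvg0.
apply: filterS3 h U0_ae extinct_absorb_ae => s [n en] U0 hs; exists n; split => //.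
exact: branching_time_extinct.
Qed.

Lemma branching_time_ge0_fin : {ae Q, forall s, (0 <= branching_time U xi xit s < +oo)%E}.
Proof.
have h1 := clocks_gt0_ae HM.
move: branching_time_ae; apply: (filterS2 _ _ h1) => s Xpos [n [_ ->]].
by rewrite ltry andbT lee_fin; apply: sumr_ge0 => j _; rewrite ltW.
Qed.

Lemma branching_laplace (b : R) : 0 <= b ->
  (\int[Q]_s (expR (- (b * fine (branching_time U xi xit s))))%:E = (lpgf la mm b 0 0)%:E)%E.
Proof.
move=> b0.
(* The time is nonnegative only almost surely, while [integral_sandwich] asks for values in [[0, 1]]
   everywhere. *)
pose f s := expR (- (b * Num.max 0 (fine (branching_time U xi xit s)))).
have mf : measurable_fun setT f.
  apply: measurableT_comp => //; apply: measurableT_comp => //.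
  apply: measurable_funM => //; apply: measurable_maxr => //.
  by apply: measurableT_comp => //; exact: measurable_branching_time.
have f01 s : 0 <= f s <= 1.
  by rewrite expR_ge0 /= -expR0 ler_expR oppr_le0 mulr_ge0// le_max lexx.
transitivity (\int[Q]_s (f s)%:E)%E.
  have h : ae_eq Q setT (fun s => (expR (- (b * fine (branching_time U xi xit s))))%:E) (fun s => (f s)%:E).
    apply: filterS branching_time_ge0_fin => s /andP[h _] _.
    by rewrite /f (max_idPr (fine_ge0 h)).
  have mb : measurable_fun setT (fun s => (expR (- (b * fine (branching_time U xi xit s))))%:E).
    apply/measurable_EFinP; apply: measurableT_comp => //; apply: measurableT_comp => //.
    by apply: measurable_funM => //; apply: measurableT_comp => //; exact: measurable_branching_time.
  have mf' : measurable_fun setT (fun s => (f s)%:E) by exact/measurable_EFinP.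
  have n1 s : setT s -> (0 <= (expR (- (b * fine (branching_time U xi xit s))))%:E)%E.
    by rewrite lee_fin expR_ge0.
  have n2 s : setT s -> (0 <= (f s)%:E)%E by rewrite lee_fin expR_ge0.
  exact: (ge0_ae_eq_integral measurableT mb mf' n1 n2 h).
apply: (integral_sandwich (A := extinct) (g := fun n => pgf la mm b n 0 0) (h := fun n => pgf la mm 0 n 0 0)) => //.
- by move=> n; exact: mU.
- move=> n; rewrite -integral_extinct//.
  have mE : measurable (extinct n) by exact: mU.
  have h : ae_eq Q (extinct n) (fun s => (f s)%:E) (fun s => (expR (- (b * trunc_time n s)))%:E).
    apply: filterS3 branching_time_ge0_fin U0_ae extinct_absorb_ae => s /andP[h _] U0 hs en.
    by rewrite /f (max_idPr (fine_ge0 h)) (branching_time_extinct U0 hs en).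
  have m1 : measurable_fun (extinct n) (fun s => (f s)%:E).
    by apply: measurable_funTS; exact/measurable_EFinP.
  have m2 := measurable_funTS (D := extinct n) (mexpt b n).
  have n1 s : extinct n s -> (0 <= (f s)%:E)%E by rewrite lee_fin expR_ge0.
  have n2 s : extinct n s -> (0 <= (expR (- (b * trunc_time n s)))%:E)%E.
    by rewrite lee_fin expR_ge0.
  exact: (ge0_ae_eq_integral mE m1 m2 n1 n2 h).
- exact: prob_extinct.
- exact: pgf_cvg.
Qed.

End branching_law.

(** * The walk *)

Section hitting_weights.
Variables (R : realType) (K : nat) (la : nat -> R) (mu : nat -> 'I_K.+1 -> R).
Hypothesis la_gt0 : forall k, 0 < la k.
Hypothesis mu_ge0 : forall k l, 0 <= mu k l.
Variable b : R.
Hypothesis b_ge0 : 0 <= b.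

(* The state [c] stands for the site [1 - c]. *)
Fixpoint hitw (n c : nat) : R :=
  if c is c'.+1 then
    if n is n'.+1 then
      (la c' * hitw n' c' + \sum_(j < K.+1) mu c' j * hitw n' (c' + j).+2) /
      (srate la mu c' + b)
    else 0
  else 1.

Let rb0 c : 0 < srate la mu c + b.
Proof. by rewrite ltr_pwDl// srate_gt0. Qed.

(* The Laplace transform at [b] of the time to reach 1 from [1 - c]. *)
Let V c : R := if c is c'.+1 then lpgf la mu b 0 c' else 1.

Let lpgf_split c l : lpgf la mu b 0 (c + l) = V c * lpgf la mu b c l.
Proof.
case: c => [|c]; first by rewrite add0n mul1r.
rewrite /= !lpgf_prod// -addnS big_split_ord /=; congr (_ * _).
Qed.

Let V_harm c : (la c * V c + \sum_(j < K.+1) mu c j * V (c + j).+2) / (srate la mu c + b) = V c.+1.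
Proof.
have E := lpgf0E la_gt0 mu_ge0 c b_ge0.
apply: (mulIf (lt0r_neq0 (rb0 c))); rewrite divfK ?lt0r_neq0//.
have -> : V c.+1 = V c * lpgf la mu b c 0 by rewrite /V -lpgf_split addn0.
have -> : \sum_(j < K.+1) mu c j * V (c + j).+2 =
   V c * lpgf la mu b c 0 * \sum_(j < K.+1) mu c j * lpgf la mu b c.+1 j.
  rewrite mulr_sumr; apply: eq_bigr => j _.
  have -> : V (c + j).+2 = lpgf la mu b 0 (c + j.+1) by rewrite addnS.
  by rewrite lpgf_split lpgfS//; ring.
rewrite -E; ring.
Qed.

Lemma hitw_ge0 n c : 0 <= hitw n c.
Proof.
elim: n c => [|n IHn] [|c] //=; apply: divr_ge0; last exact: ltW.
by apply: addr_ge0; [rewrite mulr_ge0// ltW | apply: sumr_ge0 => j _; rewrite mulr_ge0].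
Qed.

Lemma hitw_le n c : hitw n c <= V c.
Proof.
elim: n c => [|n IHn] [|c] //=; first exact: lpgf_ge0.
rewrite -[X in _ <= X]/(V c.+1) -V_harm ler_pM2r ?invr_gt0//; apply: lerD.
  by rewrite ler_pM2l.
by apply: ler_sum => j _; rewrite ler_wpM2l.
Qed.

Lemma hitw_nd n c : hitw n c <= hitw n.+1 c.
Proof.
elim: n c => [|n IHn] [|c] //; first exact: hitw_ge0.
rewrite [X in X <= _]/= [X in _ <= X]/= -/(hitw n.+1).
rewrite ler_pM2r ?invr_gt0//; apply: lerD; first by rewrite ler_pM2l.
by apply: ler_sum => j _; rewrite ler_wpM2l.
Qed.

(** The limit [A] solves the same first-jump equations as [V], but these may have several solutions
    (at [b = 0] the constant 1 is one), so both inequalities are proved. [A <= V] is [hitw_le];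
    conversely [pgf b n k l * A k <= A (k + l).+1] by induction on [n], read at [k = l = 0]. *)
Lemma hitw_cvg : hitw n 1 @[n --> \oo] --> lpgf la mu b 0 0.
Proof.
have cv c : cvgn (hitw^~ c).
  apply: nondecreasing_is_cvgn; first by apply/nondecreasing_seqP => n; exact: hitw_nd.
  by exists (V c) => _ [n _ <-]; exact: hitw_le.
pose A c := limn (hitw^~ c).
have cA c : hitw n c @[n --> \oo] --> A c by exact: cv.
have A0 : A 0%N = 1.
  by apply/cvg_lim => //; apply: cvg_near_cst; apply: nearW => -[|n].
have A_ge0 c : 0 <= A c.
  apply: limr_ge; first exact: cv.
  by apply: nearW => n; exact: hitw_ge0.
have AE c : A c.+1 * (srate la mu c + b) = la c * A c + \sum_(j < K.+1) mu c j * A (c + j).+2.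
  apply: (mulIf (invr_neq0 (lt0r_neq0 (rb0 c)))); rewrite mulfK ?lt0r_neq0//.
  apply/cvg_lim => //; rewrite -(cvg_shiftS (hitw^~ c.+1)) /=.
  apply: cvgM; last exact: cvg_cst.
  apply: cvgD; first by apply: cvgM; [exact: cvg_cst | exact: cA].
  by apply: cvg_sumr => j; apply: cvgM; [exact: cvg_cst | exact: cA].
have low n k l : pgf la mu b n k l * A k <= A (k + l).+1.
  elim: n k l => [|n IHn] k l; first by rewrite mul0r.
  rewrite pgfS; set h := la k / _.
  have d0 := den_gt0 la_gt0 mu_ge0 k b_ge0 (fun j => pgf_le1 la_gt0 mu_ge0 n k.+1 j b_ge0).
  have hA : h * A k <= A k.+1.
    rewrite /h mulrAC ler_pdivrMr// mulrBr AE lerBrDr lerD2l mulr_sumr.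
    apply: ler_sum => j _; rewrite mulrCA ler_wpM2l//.
    by rewrite mulrC; apply: le_trans (IHn k.+1 j) _; rewrite addSn.
  case: l => [|l]; first by rewrite mulr1 addn0.
  rewrite mulrAC; apply: (@le_trans _ _ (A k.+1 * pgf la mu b n k.+1 l)).
    by rewrite ler_wpM2r// pgf_ge0.
  by rewrite mulrC addnS -addSn.
have -> : lpgf la mu b 0 0 = A 1%N; last exact: cA.
apply/eqP; rewrite eq_le; apply/andP; split.
  by apply: lpgf_le => // n; have := low n 0%N 0%N; rewrite A0 mulr1.
apply: limr_le; first exact: cv.
by apply: nearW => n; exact: hitw_le.
Qed.

End hitting_weights.

Lemma ae_forall_countable d (S : measurableType d) (R : realType)
    (m : {measure set S -> \bar R}) (C : countType) (P : C -> S -> Prop) :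
  (forall c, {ae m, forall s, P c s}) -> {ae m, forall s, forall c, P c s}.
Proof.
move=> h.
have H : {ae m, forall s, forall n : nat, if unpickle n is Some c then P c s else True}.
  by apply: ae_foralln => n; case: unpickle => [c|]; [exact: h | exact: aeW].
by apply: filterS H => s hs c; have := hs (pickle c); rewrite pickleK.
Qed.

Lemma esum_indicator (R : realType) (T : choiceType) (a : T) (F : T -> R) :
  (forall v, 0 <= F v) ->
  (\esum_(v in [set: T]) ((v == a)%:R * F v)%:E = (F a)%:E)%E.
Proof.
move=> F0; rewrite (esumID [set a]); last by move=> v _; rewrite lee_fin mulr_ge0.
rewrite !setTI esum_set1 ?eqxx ?mul1r ?lee_fin// esum1 ?adde0//.
by move=> v /= /eqP va; rewrite (negbTE va) mul0r.
Qed.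

(** * Paths and holding times of the embedded chain *)

Section chain.
Variables (K : nat) (R : realType) (w : env K R).
Hypothesis lam_gt0 : forall i, 0 < lam w i.
Context d (S : measurableType d) (Pw : probability S R).
Variables (Y : nat -> S -> int) (tau : nat -> S -> R).
Hypothesis mY : forall k n, measurable [set s | Y k s = n].
Hypothesis mtau : forall k, measurable_fun setT (tau k).
Hypothesis law : forall n (y : nat -> int) (t : nat -> R), (forall k, 0 <= t k) ->
  Pw [set s | forall k, (k <= n)%N -> Y k s = y k /\ t k < tau k s] =
  ((y 0%N == 0 :> int)%:R * \prod_(k < n) jump_prob w (y k) (y k.+1) *
   \prod_(k < n.+1) expR (- (rate w (y k) * t k)))%:E.

Let mu0 i l : 0 <= mu w i l. Proof. by rewrite /mu. Qed.
Let rw0 i : 0 < rate w i. Proof. exact: rate_gt0. Qed.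

Lemma esum_jump_prob x (F : int -> R) : (forall v, 0 <= F v) ->
  (\esum_(v in [set: int]) (jump_prob w x v * F v)%:E =
   ((lam w x * F (x + 1) + \sum_(l < K.+1) mu w x l * F (x - l.+1%:Z)) / rate w x)%:E)%E.
Proof.
move=> F0; have ri0 : 0 <= (rate w x)^-1 by rewrite invr_ge0 ltW.
have c0 (c : R) v : 0 <= c -> 0 <= c / rate w x * F v by move=> ?; rewrite !mulr_ge0.
transitivity (\esum_(v in [set: int]) (((v == x + 1)%:R * (lam w x / rate w x * F v))%:E +
   \sum_(l < K.+1) ((v == x - l.+1%:Z)%:R * (mu w x l / rate w x * F v))%:E))%E.
  apply: eq_esum => v _; rewrite sumEFin -EFinD; congr EFin.
  rewrite /jump_prob !mulrDl; congr (_ + _); first by ring.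
  by rewrite !mulr_suml; apply: eq_bigr => l _; ring.
have l0 : 0 <= lam w x by rewrite ltW.
rewrite esumD; last 2 first.
- by move=> v _; rewrite lee_fin mulr_ge0 ?c0.
- by move=> v _; apply: sume_ge0 => l _; rewrite lee_fin mulr_ge0 ?c0.
rewrite esum_sum; last by move=> v l _ _; rewrite lee_fin mulr_ge0 ?c0.
rewrite esum_indicator; last by move=> v; exact: c0.
under eq_bigr => l _ do rewrite (esum_indicator _ (fun v => c0 _ v (mu0 x l))).
rewrite sumEFin -EFinD; congr EFin; rewrite mulrDl mulr_suml; congr (_ + _); first by rewrite mulrAC.
by apply: eq_bigr => l _; rewrite mulrAC.
Qed.

Lemma esum_jump_prob1 x : (\esum_(v in [set: int]) (jump_prob w x v)%:E = 1)%E.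
Proof.
have := esum_jump_prob x (fun=> ler01); under eq_esum do rewrite mulr1.
move=> ->; rewrite mulr1; under eq_bigr do rewrite mulr1.
by rewrite -/(rate w x) divff// gt_eqF.
Qed.

Lemma jump_prob_ge0 x v : 0 <= jump_prob w x v.
Proof.
apply: divr_ge0; last exact: ltW.
by rewrite addr_ge0 ?mulr_ge0 ?(ltW (lam_gt0 _))// sumr_ge0// => l _; rewrite mulr_ge0.
Qed.

Definition path_prob n (y : nat -> int) : R :=
  (y 0%N == 0 :> int)%:R * \prod_(k < n) jump_prob w (y k) (y k.+1).

Lemma path_prob_ge0 n y : 0 <= path_prob n y.
Proof. by rewrite mulr_ge0// prodr_ge0// => k _; exact: jump_prob_ge0. Qed.

Definition extend_path j (y : nat -> int) v k : int := if k == j.+1 then v else y k.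

Lemma path_prob_extend j y v :
  path_prob j.+1 (extend_path j y v) = path_prob j y * jump_prob w (y j) v.
Proof.
rewrite /path_prob big_ord_recr /= mulrA; congr (_ * _).
  congr (_ * _); apply: eq_bigr => k _; have kj := ltn_ord k.
  by rewrite /extend_path (ltn_eqF (leqW kj)) eqSS (ltn_eqF kj).
by rewrite /extend_path eqxx (ltn_eqF (ltnSn j)).
Qed.

Definition path_event n (y : nat -> int) := [set s | forall k, (k <= n)%N -> Y k s = y k].

Lemma measurable_path_event n y : measurable (path_event n y).
Proof.
rewrite (_ : path_event n y = \bigcap_(k in [set k | (k <= n)%N]) [set s | Y k s = y k]).
  by apply: bigcap_measurableType => k _; exact: mY.
by apply/seteqP; split.
Qed.

Let mtgt k t : measurable [set s | t < tau k s].
Proof. exact: measurable_gt_fun. Qed.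

Lemma path_event_extend j y v :
  path_event j y `&` [set s | Y j.+1 s = v] = path_event j.+1 (extend_path j y v).
Proof.
apply/seteqP; split => s /=.
  move=> [h1 h2] k; rewrite leq_eqVlt /extend_path.
  by case: eqP => [-> //|_ /=]; rewrite ltnS; exact: h1.
move=> h; split; last by have := h j.+1 (leqnn _); rewrite /extend_path eqxx.
move=> k kj; have := h k (leqW kj); rewrite /extend_path ifN//.
by apply/eqP => e; rewrite e ltnn in kj.
Qed.

Definition pos_event n := [set s | forall k, (k <= n)%N -> 0 < tau k s].

Let mpos n : measurable (pos_event n).
Proof.
rewrite (_ : pos_event n = \bigcap_(k in [set k | (k <= n)%N]) [set s | 0 < tau k s]).
  by apply: bigcap_measurableType => k _; exact: mtgt.
by apply/seteqP; split.
Qed.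

Lemma prob_path_pos n y : Pw (path_event n y `&` pos_event n) = (path_prob n y)%:E.
Proof.
have := law n y (fun=> lexx 0); rewrite [X in _ * X]big1 ?mulr1; last first.
  by move=> k _; rewrite mulr0 oppr0 expR0.
move=> <-; congr (Pw _); apply/seteqP; split => s /=.
  by move=> [h1 h2] k kn; split; [exact: h1 | exact: h2].
by move=> h; split => k kn; have [] := h k kn.
Qed.

Definition path_fun n s : {ffun 'I_n.+1 -> int} := [ffun k : 'I_n.+1 => Y k s].

Lemma start_ae : {ae Pw, forall s, Y 0 s = 0 /\ 0 < tau 0 s}.
Proof.
pose A := path_event 0 (fun=> 0) `&` pos_event 0.
have mA : measurable A by apply: measurableI => //; exact: measurable_path_event.
exists (~` A); split; first exact: measurableC.
  by rewrite probability_setC// prob_path_pos /path_prob eqxx mul1r big_ord0 subee.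
move=> s /= h1 h2; apply: h1; case: h2 => h2 h3.
by split; [exact: h2 | exact: h3].
Qed.

(** The law is given only for a path together with all its holding times. Summed over the value of
    [Y n.+1], the probabilities of a path with [tau 0, ..., tau n.+1] positive give back that of its
    first [n] jumps with [tau 0, ..., tau n] positive, because jump probabilities add up to 1. So
    the extra condition excludes a null set. *)
Lemma holding_time_gt0_ae : {ae Pw, forall s, forall k, 0 < tau k s}.
Proof.
have step n : {ae Pw, forall s, pos_event n s -> pos_event n.+1 s}.
  have null (p : {ffun 'I_n.+1 -> int}) : {ae Pw, forall s, path_fun n s = p ->
      pos_event n s -> pos_event n.+1 s}.
    pose y k := p (inord k).
    pose A := path_event n y `&` pos_event n.
    pose B := [set s | 0 < tau n.+1 s].
    have mA : measurable A by apply: measurableI => //; exact: measurable_path_event.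
    have mB : measurable B by exact: mtgt.
    exists (A `\` B); split; first exact: measurableD.
      have E : Pw (A `&` B) = Pw A.
        have one (D : set S) : measurable D -> Pw D = (\int[Pw]_(s in D) (1%E : \bar R))%E.
          by move=> mD; rewrite integral_cst ?mul1e.
        rewrite one; last exact: measurableI.
        rewrite (integral_partition Pw (mY n.+1)) //; last exact: measurableI.
        transitivity (\esum_(v in [set: int]) ((path_prob n y)%:E * (jump_prob w (y n) v)%:E))%E.
          apply: eq_esum => v _; rewrite -one; last by apply: measurableI => //; exact: measurableI.
          rewrite -EFinM -path_prob_extend -prob_path_pos -path_event_extend; congr (Pw _).
          apply/seteqP; split => s /=.
            move=> [[[h1 h2] h3] h4]; split; first by split.
            move=> k; by rewrite leq_eqVlt => /predU1P[->//|]; rewrite ltnS; exact: h2.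
          move=> [[h1 h2] h3]; split; last exact: h2.
          split; last exact: (h3 n.+1 (leqnn _)).
          by split => // k kn; apply: h3; exact: leqW.
        rewrite esumZl ?path_prob_ge0//; last by move=> v; rewrite lee_fin jump_prob_ge0.
        by rewrite esum_jump_prob1 mule1 prob_path_pos.
      have fA : (Pw A < +oo)%E by rewrite -ge0_fin_numE// fin_num_measure.
      transitivity (Pw A - Pw (A `&` B))%E; first exact: measureD.
      by rewrite E subee// fin_num_measure.
    move=> s /= /not_implyP[sp /not_implyP[pn npn]]; split.
      by split => // k kn; rewrite /y -sp ffunE inordK.
    move=> Bs; apply: npn => k; rewrite leq_eqVlt => /predU1P[->//|].
    by rewrite ltnS; exact: pn.
  by have := ae_forall_countable null; apply: filterS => s h; exact: (h (path_fun n s)).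
have := ae_foralln step; move: start_ae; apply: filterS2 => s [_ h0] hs.
suff h n : pos_event n s by move=> k; exact: (h k k (leqnn k)).
elim: n => [|n IHn]; last exact: hs.
by move=> k; rewrite leqn0 => /eqP ->.
Qed.

Let mexp (b : R) k : measurable_fun setT (fun s => expR (- (b * tau k s))).
Proof.
apply: measurableT_comp => //; apply: measurableT_comp => //.
exact: measurable_funM.
Qed.

(** The time spent in the last state [y j] is not discounted: [law] is applied with threshold 0 for
    it, and the condition [0 < tau j] holds almost surely. *)
Lemma integral_path_holding (b : R) j (y : nat -> int) : 0 <= b ->
  (\int[Pw]_(s in path_event j y) (\prod_(k < j) expR (- (b * tau k s)))%:E =
   (path_prob j y * \prod_(k < j) (rate w (y k) / (rate w (y k) + b)))%:E)%E.
Proof.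
move=> b0.
have mpe := measurable_path_event j y.
have mall t : measurable [set s | forall k, (k < j)%N -> t k < tau k s].
  rewrite (_ : [set s | _] = \bigcap_(k in [set k | (k < j)%N]) [set s | t k < tau k s]).
    by apply: bigcap_measurableType => k _; exact: mtgt.
  by apply/seteqP; split.
have aeeq (A B : set S) : measurable A -> measurable B -> {ae Pw, forall s, A s <-> B s} -> Pw A = Pw B.
  move=> mA mB h; have one (D : set S) : measurable D -> Pw D = (\int[Pw]_(s in D) (1%E : \bar R))%E.
    by move=> mD; rewrite integral_cst ?mul1e.
  rewrite !one//; apply: ge0_integral_ae_set => //.
have hyp t : (forall k, 0 <= t k) ->
   Pw (path_event j y `&` [set s | forall k, (k < j)%N -> t k < tau k s]) =
   (path_prob j y * \prod_(k < j) expR (- (rate w (y k) * t k)))%:E.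
  move=> t0; pose t' k := if (k < j)%N then t k else 0.
  have t'0 k : 0 <= t' k by rewrite /t'; case: ifP.
  have t'j : t' j = 0 by rewrite /t' ltnn.
  have := law j y t'0; rewrite big_ord_recr /= t'j mulr0 oppr0 expR0 mulr1.
  have -> : \prod_(k < j) expR (- (rate w (y k) * t' k)) = \prod_(k < j) expR (- (rate w (y k) * t k)).
    by apply: eq_bigr => k _; rewrite /t' ltn_ord.
  move=> <-; apply: aeeq.
  - exact: measurableI.
  - rewrite (_ : [set s | _] = path_event j y `&`
        ([set s | forall k, (k < j)%N -> t k < tau k s] `&` [set s | 0 < tau j s])).
      by apply: measurableI => //; apply: measurableI.
    apply/seteqP; split => s /= h.
      split; first by move=> k kj; have [] := h k kj.
      split; last by have [_] := h j (leqnn j); rewrite /t' ltnn.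
      by move=> k kj; have [_] := h k (ltnW kj); rewrite /t' kj.
    move=> k kj; case: h => h1 [h2 h3]; split; first exact: h1.
    move: kj; rewrite leq_eqVlt /t' => /predU1P[->|kj]; first by rewrite ltnn.
    by rewrite kj; exact: h2.
  apply: filterS holding_time_gt0_ae => s pos; split.
    move=> [h1 h2] k kj; split; first exact: h1.
    by rewrite /t'; case: ifP => kj'; [exact: h2 | exact: pos].
  move=> h; split; first by move=> k kj; have [] := h k kj.
  by move=> k kj; have [_] := h k (ltnW kj); rewrite /t' kj.
rewrite -(@exp_family_laplace _ S R Pw (path_event j y) tau (fun k => rate w (y k))
  (path_prob j y) b j mpe mtau (path_prob_ge0 _ _) (fun k => rw0 _) b0 hyp).
apply: ge0_integral_ae_set => //.
- by apply: measurableI => //; exact: mall.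
- by apply/measurable_EFinP; apply: measurable_prod => k _; exact: mexp.
- by move=> s; rewrite lee_fin prodr_ge0// => k _; exact: expR_ge0.
by apply: filterS holding_time_gt0_ae => s pos; split => [h|[]//]; split => // k _; exact: pos.
Qed.

End chain.

(** By right-continuity the walk keeps the value 1 for a while, so the hitting time is below [x] if
    and only if the walk is at 1 at some rational time in []0, x[]. *)
Lemma measurable_hitting_time1 d (S : measurableType d) (R : realType) (N : R -> S -> int) :
  step_process N -> measurable_fun setT (hitting_time1 N).
Proof.
move=> [mN rN].
apply: (measurability _ (ErealGenCInfty.measurableE R)) => //.
move=> _ [_ [x ->] <-]; rewrite setTI.
have -> : hitting_time1 N @^-1` `[x%:E, +oo[%classic = ~` \bigcup_(q in [set: rat])
   (if 0 < (ratr q : R) < x then [set s | N (ratr q) s = 1] else set0); last first.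
  apply: measurableC; apply: countable_bigcupT_measurable; first exact: countableP.
  by move=> q; case: ifP => // /andP[q0 _]; apply: mN; exact: ltW.
apply/seteqP; split => s /=; rewrite in_itv /= andbT.
  move=> xT [q _]; case: ifP => // /andP[q0 qx] /= Nq.
  have : (hitting_time1 N s <= (ratr q)%:E)%E by apply: ereal_inf_lbound; exists (ratr q).
  by move=> /(le_trans xT); rewrite lee_fin leNgt qx.
move=> h; rewrite leNgt; apply/negP => /ereal_inf_lt[_ [t [t0 Nt] <-]]; rewrite lte_fin => tx.
have := rN t s (ltW t0); rewrite near_withinE => -[e /= e0 he].
have lt1 : t < Num.min x (t + e) by rewrite lt_min tx ltrDl.
have [q] := rat_in_itvoo lt1; rewrite in_itv /= lt_min => /andP[tq /andP[qx qe]].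
apply: h; exists q => //; rewrite (lt_trans t0 tq) qx /=.
rewrite he// /ball /= distrC ger0_norm ?subr_ge0 ?(ltW tq)//.
by rewrite ltrBlDl.
Qed.

(** * Laplace transform of the hitting time *)

Section chain_hitting.
Variables (K : nat) (R : realType) (w : env K R).
Hypothesis lam_gt0 : forall i, 0 < lam w i.
Context d (S : measurableType d) (Pw : probability S R).
Variables (Y : nat -> S -> int) (tau : nat -> S -> R).
Hypothesis mY : forall k n, measurable [set s | Y k s = n].
Hypothesis mtau : forall k, measurable_fun setT (tau k).
Hypothesis law : forall n (y : nat -> int) (t : nat -> R), (forall k, 0 <= t k) ->
  Pw [set s | forall k, (k <= n)%N -> Y k s = y k /\ t k < tau k s] =
  ((y 0%N == 0 :> int)%:R * \prod_(k < n) jump_prob w (y k) (y k.+1) *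
   \prod_(k < n.+1) expR (- (rate w (y k) * t k)))%:E.
Let la k := lam w (- k%:Z).
Let mm k l := mu w (- k%:Z) l.
Let mu0 i l : 0 <= mu w i l. Proof. by rewrite /mu. Qed.
Let rw0 i : 0 < rate w i. Proof. exact: rate_gt0. Qed.

(* Laplace weight of the time needed from step [j] on to reach 1 within [n]
   further jumps. *)
Fixpoint tailw (b : R) n j s : R :=
  if Y j s == 1 then 1 else
  if n is n'.+1 then expR (- (b * tau j s)) * tailw b n' j.+1 s else 0.

(** The mean of [tailw] when the chain is at [x]. It is indexed by sites, as the paths are; [intwE]
    identifies it with [hitw]. *)
Fixpoint intw (b : R) n (x : int) : R :=
  if x == 1 then 1 else
  if n is n'.+1 then
    (lam w x * intw b n' (x + 1) + \sum_(l < K.+1) mu w x l * intw b n' (x - l.+1%:Z)) /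
    (rate w x + b)
  else 0.

Lemma intw_ge0 (b : R) n x : 0 <= b -> 0 <= intw b n x.
Proof.
move=> b0; elim: n x => [|n IHn] x /=; case: ifP => // _.
apply: divr_ge0; last by rewrite addr_ge0// ltW.
by rewrite addr_ge0 ?mulr_ge0 ?(ltW (lam_gt0 _))// sumr_ge0// => l _; rewrite mulr_ge0.
Qed.

Lemma intwE (b : R) n c : intw b n (1 - c%:Z) = hitw la mm b n c.
Proof.
elim: n c => [|n IHn] [|c]; rewrite [LHS]/= ?subr0 ?eqxx//.
  by rewrite ifF//; lia.
have cE : 1 - c.+1%:Z = - c%:Z by lia.
rewrite ifF; last by lia.
rewrite cE (_ : - c%:Z + 1 = 1 - c%:Z) ?IHn; last by lia.
rewrite /=; congr ((_ + _) / _); apply: eq_bigr => j _.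
by rewrite (_ : - c%:Z - j.+1%:Z = 1 - (c + j).+2%:Z) ?IHn//; lia.
Qed.

Lemma tailw_ge0 (b : R) n j s : 0 <= tailw b n j s.
Proof. by elim: n j => [|n IHn] j /=; case: ifP => // _; rewrite mulr_ge0// expR_ge0. Qed.

Let mexp (b : R) k : measurable_fun setT (fun s => expR (- (b * tau k s))).
Proof.
apply: measurableT_comp => //; apply: measurableT_comp => //.
exact: measurable_funM.
Qed.

Lemma measurable_tailw (b : R) n j : measurable_fun setT (tailw b n j).
Proof.
elim: n j => [|n IHn] j /=.
  apply: (measurable_fun_fiber (g := Y j) (h := fun (v : int) (_ : S) => if v == 1 then 1 : R else 0)) => //.
apply: (measurable_fun_fiber (g := Y j)
  (h := fun (v : int) s => if v == 1 then 1 else expR (- (b * tau j s)) * tailw b n j.+1 s)) => // v.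
by case: (v == 1) => //; apply: measurable_funM.
Qed.

(** The Markov property at step [j], by induction on [n]: the path is extended by the value of
    [Y j.+1], and summing over that value is the first-jump equation of [intw]. The holding factor
    [rate / (rate + b)] turns the denominator [rate] of the jump probabilities into [rate + b]. *)
Lemma integral_tailw (b : R) n j (y : nat -> int) : 0 <= b ->
  (\int[Pw]_(s in path_event Y j y) ((\prod_(k < j) expR (- (b * tau k s))) * tailw b n j s)%:E =
   (path_prob w j y * \prod_(k < j) (rate w (y k) / (rate w (y k) + b)) * intw b n (y j))%:E)%E.
Proof.
move=> b0.
have mpe i z := measurable_path_event mY i z.
have base i z : z i = 1 -> (\int[Pw]_(s in path_event Y i z) ((\prod_(k < i) expR (- (b * tau k s))))%:E =
   (path_prob w i z * \prod_(k < i) (rate w (z k) / (rate w (z k) + b)) * 1)%:E)%E.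
  by move=> _; rewrite mulr1 (integral_path_holding lam_gt0 mY mtau law).
elim: n j y => [|n IHn] j y /=.
  have [yj|yj] := eqVneq (y j) 1.
    rewrite -base//; apply: eq_integral => s; rewrite inE => ps.
    by rewrite ps// yj eqxx mulr1.
  rewrite mulr0 integral0_eq// => s ps.
  by rewrite ps// (negbTE yj) mulr0.
have [yj|yj] := eqVneq (y j) 1.
  rewrite -base//; apply: eq_integral => s; rewrite inE => ps.
  by rewrite ps// yj eqxx mulr1.
pose g s := (\prod_(k < j.+1) expR (- (b * tau k s))) * tailw b n j.+1 s.
have mg : measurable_fun setT (fun s => (g s)%:E).
  apply/measurable_EFinP; apply: measurable_funM; last exact: measurable_tailw.
  by apply: measurable_prod => k _; exact: mexp.
have g0 s : (0 <= (g s)%:E)%E.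
  by rewrite lee_fin mulr_ge0 ?tailw_ge0// prodr_ge0// => k _; exact: expR_ge0.
transitivity (\int[Pw]_(s in path_event Y j y) (g s)%:E)%E.
  apply: eq_integral => s; rewrite inE => ps.
  by rewrite ps// (negbTE yj) /g big_ord_recr /= mulrA.
rewrite (integral_partition Pw (mY j.+1) (mpe j y) mg g0).
have z0 i : 0 <= rate w i / (rate w i + b).
  by apply: divr_ge0; [exact: ltW | apply: addr_ge0 => //; exact: ltW].
set c := path_prob w j y * \prod_(k < j) (rate w (y k) / (rate w (y k) + b)).
have c0 : 0 <= c.
  apply: mulr_ge0; first exact: path_prob_ge0.
  by apply: prodr_ge0.
transitivity (\esum_(v in [set: int]) ((c * (rate w (y j) / (rate w (y j) + b)))%:E *
    (jump_prob w (y j) v * intw b n v)%:E))%E.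
  apply: eq_esum => v _; rewrite path_event_extend /g IHn path_prob_extend -EFinM; congr EFin.
  have -> : \prod_(k < j.+1) (rate w (extend_path j y v k) / (rate w (extend_path j y v k) + b)) =
     \prod_(k < j) (rate w (y k) / (rate w (y k) + b)) * (rate w (y j) / (rate w (y j) + b)).
    rewrite big_ord_recr /= /extend_path (ltn_eqF (ltnSn j)); congr (_ * _).
    by apply: eq_bigr => k _; rewrite (ltn_eqF (leqW (ltn_ord k))).
  by rewrite /extend_path eqxx /c; ring.
rewrite esumZl; last 2 first.
- by rewrite mulr_ge0.
- by move=> v; rewrite lee_fin mulr_ge0 ?intw_ge0// jump_prob_ge0.
rewrite esum_jump_prob//; last by move=> v; exact: intw_ge0.
rewrite -EFinM -mulrA; congr (_ * _)%:E.
have rb0 : rate w (y j) + b != 0 by rewrite gt_eqF// ltr_pwDl.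
have r0 : rate w (y j) != 0 by rewrite gt_eqF.
by field; rewrite rb0 r0.
Qed.

Lemma integral_tailw0 (b : R) n : 0 <= b ->
  (\int[Pw]_s (tailw b n 0 s)%:E = (hitw la mm b n 1)%:E)%E.
Proof.
move=> b0; have := integral_tailw n 0 (fun=> 0) b0.
rewrite /path_prob eqxx !big_ord0 !mul1r -intwE subrr => <-.
have h : {ae Pw, forall s, setT s <-> path_event Y 0 (fun=> 0) s}.
  apply: filterS (start_ae mY mtau law) => s [h _]; split => // _ k.
  by rewrite leqn0 => /eqP ->.
rewrite (ge0_integral_ae_set measurableT _ _ _ h).
- by apply: eq_integral => s _; rewrite big_ord0 mul1r.
- exact: measurable_path_event.
- by apply/measurable_EFinP; exact: measurable_tailw.
- by move=> s; rewrite lee_fin tailw_ge0.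
Qed.

Definition hit_event n := [set s | exists2 k, (k <= n)%N & Y k s = 1].

Lemma measurable_hit_event n : measurable (hit_event n).
Proof.
rewrite (_ : hit_event n = \bigcup_(k in [set k | (k <= n)%N]) [set s | Y k s = 1]).
  by apply: bigcup_measurable => k _; exact: mY.
by apply/seteqP; split => s [k]; exists k.
Qed.

Lemma tailw_nohit (b : R) n j s : (forall k, (k <= n)%N -> Y (j + k)%N s != 1) -> tailw b n j s = 0.
Proof.
elim: n j => [|n IHn] j h /=; have := h 0%N isT; rewrite addn0 => /negbTE -> //.
by rewrite IHn ?mulr0// => k kn; rewrite addSnnS; exact: h.
Qed.

Lemma tailw_hit (b : R) n j s k : (k <= n)%N -> (forall i, (i < k)%N -> Y (j + i)%N s != 1) ->
  Y (j + k)%N s = 1 -> tailw b n j s = expR (- (b * \sum_(i < k) tau (j + i)%N s)).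
Proof.
elim: n j k => [|n IHn] j [|k] //= kn h.
- by rewrite addn0 => ->; rewrite eqxx big_ord0 mulr0 oppr0 expR0.
- by rewrite addn0 => ->; rewrite eqxx big_ord0 mulr0 oppr0 expR0.
move=> Yk; have := h 0%N isT; rewrite addn0 => /negbTE ->.
rewrite (IHn j.+1 k)//; last 2 first.
- by move=> i ik; rewrite addSnnS; exact: h.
- by rewrite addSnnS.
rewrite -expRD -opprD -mulrDr big_ord_recl addn0; congr (expR (- (b * (_ + _)))).
by apply: eq_bigr => i _; rewrite lift0 addSnnS.
Qed.

Variable N : R -> S -> int.
Hypothesis hN : step_process N.
Hypothesis hpath : {ae Pw, forall s, forall k (t : R),
  \sum_(j < k) tau j s <= t < \sum_(j < k.+1) tau j s -> N t s = Y k s}.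

(** The first [k] holding intervals cover the times before the sum, and there the walk follows [Y],
    which has not yet visited 1. *)
Lemma hitting_time1_first s k : (forall k, 0 < tau k s) -> Y 0 s = 0 ->
  (forall k (t : R), \sum_(j < k) tau j s <= t < \sum_(j < k.+1) tau j s -> N t s = Y k s) ->
  (forall i, (i < k)%N -> Y i s != 1) -> Y k s = 1 ->
  hitting_time1 N s = (\sum_(i < k) tau i s)%:E.
Proof.
move=> tau0 Y0 hp hk Yk.
have k0 : (0 < k)%N by case: k Yk {hk} => //; rewrite Y0.
have T0 : 0 < \sum_(i < k) tau i s.
  by rewrite -(prednK k0) big_ord_recr /= ltr_wpDl// sumr_ge0// => i _; exact: ltW.
apply/eqP; rewrite eq_le; apply/andP; split.
  apply: ereal_inf_lbound; exists (\sum_(i < k) tau i s) => //; split => //.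
  by rewrite (hp k) ?Yk// big_ord_recr /= lexx ltrDl tau0.
apply: le_ereal_inf_tmp => _ [t [t0 Nt] <-]; rewrite lee_fin leNgt; apply/negP => tT.
suff [i ik hi] : exists2 i, (i < k)%N & \sum_(j < i) tau j s <= t < \sum_(j < i.+1) tau j s.
  by have := hk i ik; rewrite -(hp i t hi) Nt eqxx.
elim: k {k0 T0 hk Yk} tT => [|k IHk]; first by rewrite big_ord0 ltNge ltW.
have [tk _|kt tk] := ltP t (\sum_(i < k) tau i s).
  by have [i ik hi] := IHk tk; exists i => //; exact: ltnW.
by exists k => //; rewrite kt.
Qed.

Lemma hit_event_time (b : R) n s : (forall k, 0 < tau k s) -> Y 0 s = 0 ->
  (forall k (t : R), \sum_(j < k) tau j s <= t < \sum_(j < k.+1) tau j s -> N t s = Y k s) ->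
  hit_event n s -> exists2 T : R, hitting_time1 N s = T%:E /\ 0 <= T &
    tailw b n 0 s = expR (- (b * T)).
Proof.
move=> tau0 Y0 hp [k0 k0n Yk0].
have ex : exists k, Y k s == 1 by exists k0; rewrite Yk0.
have [k /eqP Yk kmin] := ex_minnP ex.
have kn : (k <= n)%N by apply: leq_trans k0n; apply: kmin; rewrite Yk0.
have hk i : (i < k)%N -> Y i s != 1.
  by move=> ik; apply/negP => /kmin; rewrite leqNgt ik.
exists (\sum_(i < k) tau i s).
  by split; [exact: hitting_time1_first | rewrite sumr_ge0// => i _; exact: ltW].
exact: (@tailw_hit b n 0 s k).
Qed.

Hypothesis rec : lpgf la mm 0 0 0 = 1.
Let la0 k : 0 < la k. Proof. exact: lam_gt0. Qed.
Let mm0 k l : 0 <= mm k l. Proof. exact: mu0. Qed.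

Let good : {ae Pw, forall s, [/\ forall k, 0 < tau k s, Y 0 s = 0 &
  forall k (t : R), \sum_(j < k) tau j s <= t < \sum_(j < k.+1) tau j s -> N t s = Y k s]}.
Proof.
have h1 := holding_time_gt0_ae lam_gt0 mY mtau law.
have h2 := start_ae mY mtau law.
by apply: filterS3 h1 h2 hpath => s a [b _] c; split.
Qed.

Lemma integral_hit_event (b : R) n : 0 <= b ->
  (\int[Pw]_(s in hit_event n) (tailw b n 0 s)%:E = (hitw la mm b n 1)%:E)%E.
Proof.
move=> b0; rewrite -integral_tailw0// [LHS]integral_mkcond; apply: eq_integral => s _.
rewrite /patch; case: ifPn => // /negP hs; rewrite tailw_nohit// => k kn.
by rewrite add0n; apply/eqP => Yk; apply: hs; rewrite inE; exists k.
Qed.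

Lemma prob_hit_event n : Pw (hit_event n) = (hitw la mm 0 n 1)%:E.
Proof.
rewrite -integral_hit_event//.
have E : {ae Pw, forall s, hit_event n s -> (tailw 0 n 0 s)%:E = 1%:E}.
  apply: filterS good => s [a b c] hs.
  by have [T _ ->] := @hit_event_time 0 n s a b c hs; rewrite mul0r oppr0 expR0.
have mh := measurable_hit_event n.
have m1 : measurable_fun (hit_event n) (fun s => (tailw 0 n 0 s)%:E).
  by apply: measurable_funTS; apply/measurable_EFinP; exact: measurable_tailw.
rewrite (@ge0_ae_eq_integral _ _ _ Pw (hit_event n) _ (fun=> 1%:E) mh m1)//.
- by rewrite integral_cst// mul1e.
- by move=> s _; rewrite lee_fin tailw_ge0.
Qed.

Lemma hitting_time1_ge0_fin : {ae Pw, forall s, (0 <= hitting_time1 N s < +oo)%E}.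
Proof.
have cv : hitw la mm 0 n 1 @[n --> \oo] --> (1 : R) by rewrite -rec; exact: hitw_cvg.
have h := ae_exists_of_cvg1 measurable_hit_event prob_hit_event cv.
apply: filterS2 h good => s [n hn] [a b c].
have [T [-> T0] _] := @hit_event_time 0 n s a b c hn.
by rewrite lee_fin T0 ltry.
Qed.

(** On [hit_event n] the integrand is almost surely [tailw]. An infinite hitting time would be sent
    to 0 by [fine], but the complement of [hit_event n] has vanishing probability by [rec]. *)
Lemma hitting_time1_laplace (b : R) : 0 <= b ->
  (\int[Pw]_s (expR (- (b * fine (hitting_time1 N s))))%:E = (lpgf la mm b 0 0)%:E)%E.
Proof.
move=> b0.
have T0 s : 0 <= fine (hitting_time1 N s).
  by apply: fine_ge0; apply: le_ereal_inf_tmp => _ [t [t0 _] <-]; rewrite lee_fin ltW.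
have mT := measurable_hitting_time1 hN.
have mf : measurable_fun setT (fun s => expR (- (b * fine (hitting_time1 N s)))).
  apply: measurableT_comp => //; apply: measurableT_comp => //.
  by apply: measurable_funM => //; apply: measurableT_comp.
apply: (integral_sandwich (A := hit_event) (g := fun n => hitw la mm b n 1) (h := fun n => hitw la mm 0 n 1)) => //.
- exact: measurable_hit_event.
- by move=> s; rewrite expR_ge0 /= -expR0 ler_expR oppr_le0 mulr_ge0.
- move=> n; rewrite -integral_hit_event//.
  have h : ae_eq Pw (hit_event n) (fun s => (expR (- (b * fine (hitting_time1 N s))))%:E)
       (fun s => (tailw b n 0 s)%:E).
    apply: filterS good => s [a1 a2 a3] hs.
    by have [T [-> _] ->] := @hit_event_time b n s a1 a2 a3 hs.
  have mh := measurable_hit_event n.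
  have m1 : measurable_fun (hit_event n) (fun s => (tailw b n 0 s)%:E).
    by apply: measurable_funTS; apply/measurable_EFinP; exact: measurable_tailw.
  have m2 : measurable_fun (hit_event n) (fun s => (expR (- (b * fine (hitting_time1 N s))))%:E).
    by apply: measurable_funTS; apply/measurable_EFinP.
  have n1 s : hit_event n s -> (0 <= (expR (- (b * fine (hitting_time1 N s))))%:E)%E.
    by rewrite lee_fin expR_ge0.
  have n2 s : hit_event n s -> (0 <= (tailw b n 0 s)%:E)%E by rewrite lee_fin tailw_ge0.
  exact: (ge0_ae_eq_integral mh m2 m1 n1 n2 h).
- exact: prob_hit_event.
- exact: hitw_cvg.
- by rewrite -rec; exact: hitw_cvg.
Qed.

End chain_hitting.

(* The values of a probability kernel are declared as measures only. *)
Definition unit_mass d (S : measurableType d) (R : realType)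
  (m : {measure set S -> \bar R}) of m setT = 1%E : set S -> \bar R := m.

Section unit_mass_probability.
Context d (S : measurableType d) (R : realType) (m : {measure set S -> \bar R}).
Hypothesis m1 : m setT = 1%E.

HB.instance Definition _ := isMeasure.Build _ _ _ (unit_mass m1)
  (measure0 m) (measure_ge0 m) (@measure_semi_sigma_additive _ _ _ m).
HB.instance Definition _ := Measure_isProbability.Build _ _ _ (unit_mass m1) m1.

Lemma probability_of_measure :
  exists Q : probability S R, (Q : {measure set S -> \bar R}) = m.
Proof. by exists (unit_mass m1); exact: eq_measure. Qed.

End unit_mass_probability.

(** The exponential lies above its tangent at [a * z]; the inequalities at [z] and at 0 are added
    with weights [a] and [1 - a]. *)
Lemma expR_convex_le1 (R : realType) (a z : R) : 0 <= a <= 1 ->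
  expR (a * z) <= 1 - a + a * expR z.
Proof.
move=> /andP[a0 a1].
have h1 : expR (a * z) * (1 + (1 - a) * z) <= expR z.
  have -> : expR z = expR (a * z) * expR ((1 - a) * z) by rewrite -expRD; congr expR; ring.
  by rewrite ler_wpM2l ?expR_ge0// expR_ge1Dx.
have h2 : expR (a * z) * (1 - a * z) <= 1.
  rewrite -[leRHS](expR0 R) -(subrr (a * z)) expRD ler_wpM2l ?expR_ge0//.
  exact: expR_ge1Dx.
have h3 : 0 <= a * (expR z - expR (a * z) * (1 + (1 - a) * z)) by rewrite mulr_ge0// subr_ge0.
have h4 : 0 <= (1 - a) * (1 - expR (a * z) * (1 - a * z)) by rewrite mulr_ge0// subr_ge0.
rewrite -subr_ge0; move: (addr_ge0 h3 h4).
by rewrite [X in 0 <= X -> _](_ : _ = 1 - a + a * expR z - expR (a * z)); last ring.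
Qed.

(** * The mean hitting time *)

Section laplace_slope.
Variables (R : realType) (x : R).
Hypothesis x0 : 0 <= x.

Definition laplace_slope (u : R) := (1 - expR (- (u * x))) / u.

Lemma laplace_slope_anti u v : 0 < u -> u <= v -> laplace_slope v <= laplace_slope u.
Proof.
move=> u0 uv; have v0 := lt_le_trans u0 uv.
have h : 0 <= u / v <= 1 by rewrite divr_ge0 ?(ltW u0) ?(ltW v0)//= ler_pdivrMr// mul1r.
have := expR_convex_le1 (- (v * x)) h.
rewrite /laplace_slope (_ : u / v * - (v * x) = - (u * x)); last by field; rewrite gt_eqF.
move=> le1; rewrite ler_pdivlMr//.
rewrite (_ : _ / v * u = u / v * (1 - expR (- (v * x)))); last by ring.
lra.
Qed.

Lemma laplace_slope_cvg (u : nat -> R) : (forall m, 0 < u m) -> u @ \oo --> 0 ->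
  laplace_slope (u m) @[m --> \oo] --> x.
Proof.
move=> u0 uc.
(* Both bounds come from [1 + y <= expR y], at [y = u m * x] for the lower one and at its opposite
   for the upper one. *)
apply: (@squeeze_cvgr _ _ _ R (fun m => x / (1 + u m * x)) (fun=> x)).
- near=> m; have um := u0 m; have p : 0 < 1 + u m * x by rewrite ltr_pwDl// mulr_ge0// ltW.
  rewrite /laplace_slope ler_pdivlMr// ler_pdivrMr//; apply/andP; split.
    rewrite mulrAC ler_pdivrMr// mulrC.
    have : expR (- (u m * x)) * (1 + u m * x) <= 1.
      rewrite -[leRHS](expR0 R) -(addNr (u m * x)) expRD ler_wpM2l ?expR_ge0//.
      exact: expR_ge1Dx.
    lra.
  have := expR_ge1Dx (- (u m * x)); lra.
- have -> : nbhs x = nbhs (x / (1 + 0 * x)) by rewrite mul0r addr0 divr1.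
  apply: cvgM; first exact: cvg_cst.
  apply: cvgV; first by rewrite mul0r addr0 oner_neq0.
  by apply: cvgD; [exact: cvg_cst | apply: cvgM => //; exact: cvg_cst].
- exact: cvg_cst.
Unshelve. all: by end_near.
Qed.

End laplace_slope.

(** As [u m] decreases to 0 the quotients increase to [X] almost surely, so monotone convergence
    gives the mean, be it finite or infinite. *)
Lemma integral_laplace_slope d (S : measurableType d) (R : realType) (Q : probability S R)
    (X : S -> \bar R) (u g : nat -> R) :
  measurable_fun setT X -> (forall s, (0 <= X s)%E) -> {ae Q, forall s, (X s < +oo)%E} ->
  (forall m, 0 < u m) -> (forall m, u m.+1 <= u m) -> u @ \oo --> 0 ->
  (forall m, \int[Q]_s (expR (- (u m * fine (X s))))%:E = (g m)%:E)%E ->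
  ((1 - g m) / u m)%:E @[m --> \oo] --> (\int[Q]_s X s)%E.
Proof.
move=> mX X0 Xoo u0 ud uc hg.
have x0 s : 0 <= fine (X s) by exact: fine_ge0.
have mexp m : measurable_fun setT (fun s => expR (- (u m * fine (X s)))).
  apply: measurableT_comp => //; apply: measurableT_comp => //.
  by apply: measurable_funM => //; apply: measurableT_comp.
pose f m s := (laplace_slope (fine (X s)) (u m))%:E.
have mf m : measurable_fun setT (f m).
  apply/measurable_EFinP; apply: measurable_funM => //.
  exact: measurable_funB.
have f0 m s : setT s -> (0 <= f m s)%E.
  move=> _; rewrite lee_fin divr_ge0 ?(ltW (u0 m))// subr_ge0 -expR0 ler_expR oppr_le0.
  by rewrite mulr_ge0// ltW.
have fnd s : setT s -> {homo f ^~ s : n m / (n <= m)%N >-> (n <= m)%E}.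
  move=> _; apply: homo_leq => [a|a b c|m]; [exact: lexx|exact: le_trans|].
  by rewrite lee_fin laplace_slope_anti.
have fcvg s : f m s @[m --> \oo] --> (fine (X s))%:E.
  by apply: cvg_EFin; [exact: nearW | exact: laplace_slope_cvg].
have E1 : (\int[Q]_s limn (f ^~ s) = \int[Q]_s X s)%E.
  have h : ae_eq Q setT (fun s => limn (f ^~ s)) X.
    apply: filterS Xoo => s Xs _; rewrite (cvg_lim _ (fcvg s))// fineK//.
    by rewrite ge0_fin_numE.
  have m1 : measurable_fun setT (fun s => limn (f ^~ s)).
    apply: (eq_measurable_fun (fun s => (fine (X s))%:E)).
      by move=> s _; rewrite (cvg_lim _ (fcvg s)).
    by apply/measurable_EFinP; apply: measurableT_comp.
  have n1 s : setT s -> (0 <= limn (f ^~ s))%E.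
    by move=> _; rewrite (cvg_lim _ (fcvg s))// lee_fin.
  exact: (ge0_ae_eq_integral measurableT m1 mX n1 (fun s _ => X0 s) h).
have C : (\int[Q]_s f m s)%E @[m --> \oo] --> (\int[Q]_s X s)%E.
  by rewrite -E1; exact: cvg_monotone_convergence.
suff E m : (\int[Q]_s f m s = ((1 - g m) / u m)%:E)%E by move: C; under eq_fun do rewrite E.
have um := u0 m.
transitivity (\int[Q]_s (((u m)^-1)%:E * (1 - (expR (- (u m * fine (X s))))%:E)))%E.
  by apply: eq_integral => s _; rewrite /f /laplace_slope mulrC.
rewrite ge0_integralZl//; last 3 first.
- by apply: emeasurable_funB => //; apply/measurable_EFinP.
- move=> s _; rewrite -EFinB lee_fin subr_ge0 -expR0 ler_expR oppr_le0.
  by rewrite mulr_ge0// ltW.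
- by rewrite lee_fin invr_ge0 ltW.
rewrite integralB_EFin//; last 2 first.
- exact: finite_measure_integrable_cst.
- apply: (@le_integrable _ _ _ _ _ measurableT _ (cst 1%E)); first exact/measurable_EFinP.
    move=> s _ /=; rewrite ger0_norm ?expR_ge0// normr1 lee_fin -expR0 ler_expR oppr_le0.
    by rewrite mulr_ge0// ltW.
  exact: finite_measure_integrable_cst.
have -> : (\int[Q]_s (1%:E : \bar R) = 1%:E)%E.
  by rewrite integral_cst// mul1e; exact: probability_setT.
by rewrite hg -EFinB -EFinM mulrC.
Qed.

(** * The quenched statements *)

Section assembly.
Variables (K : nat) (R : realType) (w : env K R).
Hypothesis lam_gt0 : forall i, 0 < lam w i.
Let la k := lam w (- k%:Z).
Let mm k l := mu w (- k%:Z) l.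
Hypothesis rec : forall k, lpgf la mm 0 k 0 = 1.
Context d (S : measurableType d) (Pw : {measure set S -> \bar R}) (N : R -> S -> int).
Hypothesis Pw1 : Pw setT = 1%E.
Hypothesis hN : step_process N.
Hypothesis hch : quenched_chain w Pw N.

Lemma hitting_time1_ge0 s : (0 <= hitting_time1 N s)%E.
Proof. by apply: le_ereal_inf_tmp => _ [t [t0 _] <-]; rewrite lee_fin ltW. Qed.

Lemma quenched_hitting_time1_fin : {ae Pw, forall s, (0 <= hitting_time1 N s < +oo)%E}.
Proof.
have [Q QE] := probability_of_measure Pw1.
move: hch; rewrite -QE => -[Y [tau [mY mtau law hpath]]].
exact: (hitting_time1_ge0_fin lam_gt0 mY mtau law hpath).
Qed.

Lemma quenched_hitting_time1_prob : Pw [set s | (hitting_time1 N s < +oo)%E] = 1%E.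
Proof.
have mA : measurable [set s | (hitting_time1 N s < +oo)%E].
  rewrite -[X in measurable X]setTI; apply: emeasurable_fun_infty_o => //.
  exact: measurable_hitting_time1.
have h : {ae Pw, forall s, setT s <-> [set s | (hitting_time1 N s < +oo)%E] s}.
  by apply: filterS quenched_hitting_time1_fin => s /andP[].
rewrite -[LHS]mul1e -integral_cst//.
rewrite -(ge0_integral_ae_set measurableT mA _ _ h)//.
by rewrite integral_cst// mul1e.
Qed.

Lemma quenched_equal_in_law d' (S' : measurableType d') (Q : probability S' R)
    (U : nat -> S' -> {ffun 'I_K.+1 -> nat}) (xi xit : nat -> nat -> S' -> R) :
  branching_model w Q U xi xit ->
  equal_in_law Pw (hitting_time1 N) Q (branching_time U xi xit).
Proof.
move=> HM; have mT := measurable_hitting_time1 hN.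
have mB := measurable_branching_time HM; split => //.
have fT := quenched_hitting_time1_fin.
have [Q0 QE] := probability_of_measure Pw1.
move: hch fT; rewrite -QE => -[Y [tau [mY mtau law hpath]]] fT.
apply: laplace_determines_law => //; first exact: branching_time_ge0_fin.
move=> n; rewrite (branching_laplace lam_gt0 HM)//.
exact: (hitting_time1_laplace lam_gt0 mY mtau law hN hpath).
Qed.

Lemma quenched_mean_hitting_time1 :
  (\int[Pw]_s hitting_time1 N s =
   \sum_(0 <= n <oo)
     ((lam w (- n%:Z))^-1 *
      ((delta_mx ord0 ord0 : 'rV[R]_K.+1) *m
       (\prod_(j < n) Mmx w (- j%:Z)) *m
       (const_mx 1 : 'cV[R]_K.+1)) ord0 ord0)%:E)%E.
Proof.
have mT := measurable_hitting_time1 hN.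
have fT := quenched_hitting_time1_fin.
have [Q0 QE] := probability_of_measure Pw1.
move: hch fT; rewrite -QE => -[Y [tau [mY mtau law hpath]]] fT.
pose u (m : nat) : R := m.+1%:R^-1.
have u0 m : 0 < u m by rewrite invr_gt0 ltr0Sn.
have uc : u @ \oo --> 0 by exact: cvg_harmonic.
have C : ((1 - lpgf la mm (u m) 0 0) / u m)%:E @[m --> \oo] --> (\int[Q0]_s hitting_time1 N s)%E.
  apply: (integral_laplace_slope mT hitting_time1_ge0 _ u0 _ uc).
  - by apply: filterS fT => s /andP[].
  - by move=> m; rewrite lef_pV2 ?posrE ?ltr0Sn// ler_nat.
  - move=> m; rewrite (hitting_time1_laplace lam_gt0 mY mtau law hN hpath)//.
    exact: ltW.
have mm0 k l : 0 <= mm k l by rewrite /mm /mu.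
have la0 k : 0 < la k by exact: lam_gt0.
have := cvg_onem_lpgf_div la0 mm0 u0 uc rec C.
move/(@cvg_lim _ (@ereal_hausdorff R)) => <-; apply: congr_lim; apply/funext => n /=.
rewrite (@WserE _ _ la mm n 0 ord0) big_mkord sumEFin; congr (_%:E).
apply: eq_bigr => i _; congr (_ * _).
have row0 (A : 'cV[R]_K.+1) : A ord0 ord0 = ((delta_mx ord0 ord0 : 'rV[R]_K.+1) *m A) ord0 ord0.
  by rewrite -rowE mxE.
rewrite -mulmxA -row0; congr ((_ *m _) _ _).
Qed.

End assembly.

Theorem theorem2 (R : realType) (K : nat) (P : probability (env K R) R)
    (d : measure_display) (S : measurableType d)
    (Pq : R.-pker (env K R) ~> S) (N : R -> S -> int)
    (gamma : 'I_K.+1 -> R)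
    (hiid : iid_env P)
    (hC1 : condC1 P) (hC2 : condC2 P) (hC3 : condC3 P)
    (hN : step_process N)
    (hPq : {ae P, forall w, quenched_chain w (Pq w) N})
    (hgamma : lyapunov_exponents P gamma)
    (hgammaL : gamma ord_max <= 0) :
  [/\ annealed P Pq [set s | (hitting_time1 N s < +oo)%E] = 1%E,
      {ae P, forall w,
        forall (d' : measure_display) (S' : measurableType d')
          (Q : probability S' R)
          (U : nat -> S' -> {ffun 'I_K.+1 -> nat})
          (xi xit : nat -> nat -> S' -> R),
        branching_model w Q U xi xit ->
        equal_in_law (Pq w) (hitting_time1 N) Q (branching_time U xi xit)} &
      {ae P, forall w,
        (\int[Pq w]_s hitting_time1 N s =
         \sum_(0 <= n <oo)
           ((lam w (- n%:Z))^-1 *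
            ((delta_mx ord0 ord0 : 'rV[R]_K.+1) *m
             (\prod_(j < n) Mmx w (- j%:Z)) *m
             (const_mx 1 : 'cV[R]_K.+1)) ord0 ord0)%:E)%E}].
Proof.
have hrec := recurrent_ae hiid hC3 hgamma hgammaL.
have Pq1 w : Pq w setT = 1%E by exact: prob_kernel.
split.
- have mA : measurable [set s | (hitting_time1 N s < +oo)%E].
    rewrite -[X in measurable X]setTI; apply: emeasurable_fun_infty_o => //.
    exact: measurable_hitting_time1.
  have h : ae_eq P setT (fun w => Pq w [set s | (hitting_time1 N s < +oo)%E]) (fun=> 1%E).
    by apply: filterS2 hrec hPq => w [h1 h2] h3 _; exact: quenched_hitting_time1_prob.
  transitivity (\int[P]_w (1%:E : \bar R))%E.
    apply: (ge0_ae_eq_integral measurableT _ _ _ _ h) => //.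
    exact: measurable_kernel.
  by rewrite integral_cst// mul1e; exact: probability_setT.
- by apply: filterS2 hrec hPq => w [h1 h2] h3 d' S' Q U xi xit; exact: quenched_equal_in_law.
- by apply: filterS2 hrec hPq => w [h1 h2] h3; exact: quenched_mean_hitting_time1.
Qed.
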